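(* Let $0<b<1$, and let $R(t)=c_R\,(t+t_0)^{1/2}$ with constants $c_R>0$, $t_0>0$. There exist constants $\varepsilon>0$ and $C>0$ such that for every initial datum $f_0$ with $0\le f_0\in L^1_{-2}(\mathbb{R}^3)\cap L^\infty_w(\mathbb{R}^3)$ and $\|f_0\|_{L^\infty_w}<\varepsilon$, the massless Boltzmann equation with soft potential $$\partial_t f(t,p) = R(t)^{-3+b}\int_{\mathbb{R}^3}\int_{\mathbb{S}^2}\frac{\varrho^{2-b}}{|p||q|}\bigl(f(t,p') f(t,q') - f(t,p) f(t,q)\bigr)\, d\omega\, dq,\qquad f(0)=f_0,$$ has a unique non-negative solution $f\in C^1([0,\infty);L^1(\mathbb{R}^3)\cap L^1_{-1}(\mathbb{R}^3))$ satisfying $$\sup_{0\leq t<\infty} \|f(t)\|_{L^\infty_w}\leq C\varepsilon.$$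
   Context: Setting: the spatially homogeneous relativistic Boltzmann equation for massless particles in the FLRW spacetime with metric $g=-dt^2+R^2((dx^1)^2+(dx^2)^2+(dx^3)^2)$ and scale factor $R(t)=c_R(t+t_0)^{1/2}$, $c_R,t_0>0$. The unknown is the distribution function $f=f(t,p)$, $t\ge 0$, $p=(p_1,p_2,p_3)\in\mathbb{R}^3$ (covariant momentum components); the scattering kernel is $\sigma(h,\omega)=h^{-b}$ with $0<b<1$, where the relative momentum is $h=R^{-1}\varrho$, and substituting this gives the equation in the claim. Notation: for $p,q\in\mathbb{R}^3$, $|p|$ and $p\cdot q$ are the Euclidean norm and inner product, $dq$ is Lebesgue measure on $\mathbb{R}^3$, $d\omega$ is the surface measure on the unit sphere $\mathbb{S}^2\subset\mathbb{R}^3$, and $$\varrho=\sqrt{2(|p||q|-p\cdot q)}.$$ The post-collision momenta, functions of $(p,q,\omega)$, are $$p'=\frac{p+q}{2}+\frac{1}{2}\left(\varrho\,\omega+\frac{((p+q)\cdot\omega)(p+q)}{|p|+|q|+\varrho}\right),\qquad q'=\frac{p+q}{2}-\frac{1}{2}\left(\varrho\,\omega+\frac{((p+q)\cdot\omega)(p+q)}{|p|+|q|+\varrho}\right).$$ Function spaces: for $r\in\mathbb{R}$, $L^1_r(\mathbb{R}^3)$ is the space of functions with finite norm $\|f\|_{L^1_r}=\int_{\mathbb{R}^3}|f(p)|\,|p|^r\,dp$ (so $L^1=L^1_0$), and $L^\infty_w(\mathbb{R}^3)$ is the space of functions with finite norm $\|f\|_{L^\infty_w}=\sup_{p\in\mathbb{R}^3}|w(p)f(p)|$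 with weight $w(p)=|p|e^{|p|}$ (functions equal almost everywhere are identified, so the supremum is an essential supremum). *)

(* Defs.v *)
From HB Require Import structures.
From mathcomp Require Import all_boot all_order all_algebra.
From mathcomp Require Import all_classical all_reals all_analysis.
From mathcomp Require Import measurable_realfun.

Set Implicit Arguments.
Unset Strict Implicit.
Unset Printing Implicit Defensive.
Import Order.TTheory GRing.Theory Num.Theory.
Import numFieldNormedType.Exports.
Local Open Scope classical_set_scope.
Local Open Scope ring_scope.

Notation R2 R := (measurableTypeR R * measurableTypeR R)%type.
Notation R3 R := (R2 R * measurableTypeR R)%type.

(* The library's instance of this fact is shadowed by the one for
   subprobabilities. *)
Lemma sigma_finite_product d1 d2 (T1 : measurableType d1)
    (T2 : measurableType d2) (R : realType)
    (m1 : {sigma_finite_measure set T1 -> \bar R})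
    (m2 : {sigma_finite_measure set T2 -> \bar R}) :
  sigma_finite setT (m1 \x m2)%E.
Proof.
have /sigma_finiteP[F [TF ndF Foo]] := sigma_finiteT m1.
have /sigma_finiteP[G [TG ndG Goo]] := sigma_finiteT m2.
exists (fun n => F n `*` G n).
  rewrite -setXTT TF TG predeqE => -[x y]; split.
    move=> [/= [n _ Fnx] [k _ Gky]]; exists (maxn n k) => //; split.
    - by move: x Fnx; exact/subsetPset/ndF/leq_maxl.
    - by move: y Gky; exact/subsetPset/ndG/leq_maxr.
  by move=> [n _ []/= ? ?]; split; exists n.
move=> k; have [? ?] := Foo k; have [? ?] := Goo k.
split; first exact: measurableX.
by rewrite product_measure1E// lte_mul_pinfty// ge0_fin_numE.
Qed.

Definition leb1 (R : realType) :
    {sigma_finite_measure set (measurableTypeR R) -> \bar R} :=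
  @lebesgue_measure R.

Definition leb2 (R : realType) : set (R2 R) -> \bar R := (leb1 R \x leb1 R)%E.
Arguments leb2 : clear implicits.
HB.instance Definition _ (R : realType) := Measure.on (leb2 R).
HB.instance Definition _ (R : realType) :=
  Measure_isSigmaFinite.Build _ _ _ (leb2 R)
    (sigma_finite_product (leb1 R) (leb1 R)).

Definition leb3 (R : realType) : set (R3 R) -> \bar R := (leb2 R \x leb1 R)%E.
Arguments leb3 : clear implicits.
HB.instance Definition _ (R : realType) := Measure.on (leb3 R).
HB.instance Definition _ (R : realType) :=
  Measure_isSigmaFinite.Build _ _ _ (leb3 R)
    (sigma_finite_product (leb2 R) (leb1 R)).

Section euclidean.
Variable R : realType.
Implicit Types p q : R3 R.

(* The norm that the library puts on a product is the sup norm, hence the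
   Euclidean structure below. *)
Definition dot3 p q : R := p.1.1 * q.1.1 + p.1.2 * q.1.2 + p.2 * q.2.

Definition norm3 p : R := Num.sqrt (dot3 p p).

End euclidean.

Section sphere.
Variable R : realType.

(* Spherical coordinates: polar angle a.1, azimuth a.2; the area element of
   this parametrization is sin a.1. *)
Definition sphere_point (a : R2 R) : R3 R :=
  (sin a.1 * cos a.2, sin a.1 * sin a.2, cos a.1).

Definition sphere_angles : set (R2 R) :=
  `[0, pi]%classic `*` `[0, 2 * pi]%classic.

(* Surface measure of the unit sphere, as a measure on R^3 carried by it. *)
Definition sphere_measure (A : set (R3 R)) : \bar R :=
  (\int[leb2 R]_(a in sphere_angles `&` sphere_point @^-1` A)
     (sin a.1)%:E)%E.

Let msphere_point : measurable_fun setT sphere_point.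
Proof.
have m1 : measurable_fun setT
  (fst : R2 R -> R).
  exact: measurable_fst.
have m2 : measurable_fun setT
  (snd : R2 R -> R).
  exact: measurable_snd.
have ms1 := measurableT_comp (continuous_measurable_fun (@continuous_sin R)) m1.
have mc1 := measurableT_comp (continuous_measurable_fun (@continuous_cos R)) m1.
have ms2 := measurableT_comp (continuous_measurable_fun (@continuous_sin R)) m2.
have mc2 := measurableT_comp (continuous_measurable_fun (@continuous_cos R)) m2.
apply: measurable_fun_pair => //; apply: measurable_fun_pair => //.
- exact: measurable_funM.
- exact: measurable_funM.
Qed.

Let mangles : measurable sphere_angles.
Proof. by apply: measurableX; exact: measurable_itv. Qed.

Let msin : measurable_fun setT
  (fun a : R2 R => (sin a.1)%:E).
Proof.
apply/measurable_EFinP.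
apply: (measurableT_comp (continuous_measurable_fun (@continuous_sin R))).
exact: measurable_fst.
Qed.

Let sin_ge0 a : sphere_angles a -> (0 <= (sin a.1)%:E)%E.
Proof.
case=> /=; rewrite in_itv/= => /andP[a0 api] _.
by rewrite lee_fin sin_ge0_pi// a0.
Qed.

Let sphere0 : sphere_measure set0 = 0%E.
Proof. by rewrite /sphere_measure preimage_set0 setI0 integral_set0. Qed.

Let sphere_ge0 A : (0 <= sphere_measure A)%E.
Proof. by apply: integral_ge0 => a [/sin_ge0]. Qed.

Let sphere_sigma_additive : semi_sigma_additive sphere_measure.
Proof.
move=> F mF tF mUF; rewrite /sphere_measure preimage_bigcup setI_bigcupr.
have mG k : measurable (sphere_angles `&` sphere_point @^-1` F k).
  by apply: measurableI => //; rewrite -[X in measurable X]setTI;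
     exact: msphere_point.
rewrite ge0_integral_bigcup//; last 3 first.
- exact: measurable_funS msin.
- by move=> a [k _ [/sin_ge0]].
- apply/trivIsetP => i j _ _ ij.
  rewrite setIACA setIid -preimage_setI.
  by move/trivIsetP : tF => /(_ i j Logic.I Logic.I ij) ->;
     rewrite preimage_set0 setI0.
apply: is_cvg_nneseries => n _ _; exact: sphere_ge0.
Qed.

HB.instance Definition _ := isMeasure.Build _ _ _ sphere_measure
  sphere0 sphere_ge0 sphere_sigma_additive.

Let sphere_finite : fin_num_fun sphere_measure.
Proof.
apply: lty_fin_num_fun.
rewrite /= /sphere_measure preimage_setT setIT.
apply: (@le_lt_trans _ _ (\int[leb2 R]_(a in sphere_angles) cst 1%E a)%E).
  apply: ge0_le_integral => //=.
  - exact: measurable_funS msin.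
  - by move=> a _; rewrite lee_fin sin_le1.
rewrite integral_cst//= mul1e.
rewrite /sphere_angles [X in (X < _)%E]product_measure1E//.
have itv_fin (a b : R) : (lebesgue_measure `[a, b]%classic < +oo)%E.
  by rewrite lebesgue_measure_itv/=; case: ifP => _ //; rewrite -EFinD ltry.
apply: lte_mul_pinfty.
- exact: measure_ge0.
- by rewrite ge0_fin_numE//; exact: itv_fin.
- exact: itv_fin.
Qed.

HB.instance Definition _ := Measure_isFinite.Build _ _ _ sphere_measure
  sphere_finite.

End sphere.
Arguments sphere_measure : clear implicits.

Section momenta.
Variable R : realType.
Implicit Types p q w : R3 R.

Definition rho p q : R := Num.sqrt (2 * (norm3 p * norm3 q - dot3 p q)).

Definition post_half p q w : R3 R :=
  (2^-1 : R) *: (rho p q *: w +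
    (dot3 (p + q) w / (norm3 p + norm3 q + rho p q)) *: (p + q)).

Definition post_p p q w : R3 R := (2^-1 : R) *: (p + q) + post_half p q w.

Definition post_q p q w : R3 R := (2^-1 : R) *: (p + q) - post_half p q w.

Definition collision_integrand (b : R) (f : R3 R -> R) p q w : R :=
  rho p q `^ (2 - b) / (norm3 p * norm3 q) *
  (f (post_p p q w) * f (post_q p q w) - f p * f q).

End momenta.

Section function_spaces.
Variable R : realType.
Implicit Types g : R3 R -> R.

(* For r < 0 the library's power vanishes at base 0; this only concerns the
   null set {0}. *)
Definition L1norm (r : R) g : \bar R :=
  (\int[leb3 R]_p (`|g p| * norm3 p `^ r)%:E)%E.

Definition in_L1 (r : R) g := measurable_fun setT g /\ (L1norm r g < +oo)%E.

Definition Linfw_norm g : \bar R :=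
  Lnorm (leb3 R) +oo%E (fun p => (norm3 p * expR (norm3 p) * g p)%:E).

Definition in_Linfw g := measurable_fun setT g /\ (Linfw_norm g < +oo)%E.

(* The Banach space X = L^1 \cap L^1_{-1}. *)
Definition in_X g := in_L1 0 g /\ in_L1 (-1) g.

Definition X_norm g : \bar R := (L1norm 0 g + L1norm (-1) g)%E.

(* u is C^1 from [0, +oo[ to X with derivative du, one-sided at 0; the values
   of u and du at negative times are irrelevant. *)
Definition C1_X (u du : R -> R3 R -> R) : Prop :=
  [/\ forall t, 0 <= t -> in_X (u t),
      forall t, 0 <= t -> in_X (du t),
      forall t, 0 <= t ->
        X_norm (fun p => (u s p - u t p) / (s - t) - du t p)
          @[s --> within [set s | 0 <= s] t^'] --> 0%E
    & forall t, 0 <= t ->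
        X_norm (fun p => du s p - du t p)
          @[s --> within [set s | 0 <= s] (nbhs t)] --> 0%E].

End function_spaces.

Section boltzmann.
Variable R : realType.

Definition scale_factor (cR t0 t : R) : R := cR * (t + t0) `^ 2^-1.

(* Equation between elements of X, hence for almost every p. The integral over
   (q, w) is required to exist: it is total in the library, with a
   conventional value on non-integrable functions. *)
Definition boltzmann_eq (b cR t0 : R) (f df : R -> R3 R -> R) (t : R) : Prop :=
  {ae leb3 R, forall p,
    (leb3 R \x sphere_measure R)%E.-integrable setT
      (fun z => (collision_integrand b (f t) p z.1 z.2)%:E) /\
    (df t p)%:E =
      ((scale_factor cR t0 t `^ (- 3 + b))%:E *
       \int[leb3 R]_q \int[sphere_measure R]_w
         (collision_integrand b (f t) p q w)%:E)%E}.

Definition is_solution (b cR t0 : R) (f0 : R3 R -> R) (f : R -> R3 R -> R) :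
    Prop :=
  {ae leb3 R, forall p, f 0 p = f0 p} /\
  exists df : R -> R3 R -> R,
    C1_X f df /\ forall t, 0 <= t -> boltzmann_eq b cR t0 f df t.

Definition nonneg_on (f : R -> R3 R -> R) : Prop :=
  forall t, 0 <= t -> {ae leb3 R, forall p, 0 <= f t p}.

Definition sup_Linfw_norm (f : R -> R3 R -> R) : \bar R :=
  ereal_sup [set Linfw_norm (f t) | t in `[0, +oo[%classic].

End boltzmann.

(* Main.v *)
(* In the time variable tau with d tau / dt = R(t)^(-3+b), which stays bounded
   because R(t)^(-3+b) is integrable, the equation is autonomous. Conservation
   of energy |p'| + |q'| = |p| + |q| and the bounds
     |p'| |q'| >= rho^2 / 4,   |p'|, |q'| >= (|p| + |q|) (1 - (u.w)^2) / 4,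
   with u the direction of p + q, show that the gain operator maps
   W x W to W and B x W to B, and that the loss frequency of W or B is at most
   K |p|^(-b/2), where W = |p|^-1 e^-|p| and B = |p|^(-1-b/2) e^(-|p|/2)
   dominates |p|^(-b/2) W. Solving the mild equation with the loss as an
   integrating factor is then a contraction, for differences measured against
   B, on the functions bounded by 2 eps W, pointwise in p. The fixed point is
   Lipschitz in tau with its derivative, against an integrable weight, whence
   the C^1 regularity in X.

   For uniqueness, let |f - g| <= N B. The loss term acting on f - g itself
   has a favourable sign, so |f - g| grows at most at rate 6 eps K N B; this
   is made rigorous for curves that are only differentiable in L^1 by a
   Dini-derivative argument for the L^1 norm of (|f - g| - tau 6 eps K N B)_+.
   Since eps is small, N improves to N / 2, and one iterates. As g is
   controlled only almost everywhere, one needs that (p, q, w) |-> p', q' pull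
   null sets back to null sets away from the origin: the maps commute with the
   similarities v |-> h v h^* of R^3 given by the quaternions, a group that acts
   transitively on nonzero vectors, so by a Fubini argument in the group
   variable no Jacobian has to be computed. *)

Require Import Defs.
From HB Require Import structures.
From mathcomp Require Import all_boot all_order all_algebra.
From mathcomp Require Import all_classical all_reals all_analysis.
From mathcomp Require Import measurable_realfun ring lra.
Import Order.TTheory GRing.Theory Num.Theory.
Import numFieldNormedType.Exports.
Local Open Scope classical_set_scope.
Local Open Scope ring_scope.
Set Implicit Arguments.
Unset Strict Implicit.
Unset Printing Implicit Defensive.

(** * Null sets *)

(** The loss frequency behaves like |p|^(-b/2) at the origin, so it is no bounded perturbation: in a
    difference of two solutions it produces |p|^(-b/2) W, which no multiple of W controls. Measuring
    differences in B absorbs precisely this factor, and the gain estimate survives because the extra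
    exponent b/2 may sit on either post-collision momentum. The decay rate 1/2 in B leaves room for
    W <= B. In the gain, rho^(2-b) is cancelled by the power 1 - b/2 of |p'| |q'|; what remains
    costs an angular singularity (1 - (u.w)^2)^(-b), whose integral over the sphere is finite,
    uniformly in u, for b < 1. Smallness of eps means 12 K eps T <= 1, with T the total rescaled
    time: gain differences contribute 4 eps K N and loss differences 2 eps K N, so that a time T at
    the rate 6 eps K N B turns N into at most N / 2. The same count serves the fixed point and
    uniqueness. *)

Section almost_everywhere.
Context d (T : measurableType d) (R : realType).
Variable mu : {measure set T -> \bar R}.
Implicit Types P Q : T -> Prop.

Lemma ae_imp P Q : (forall x, P x -> Q x) ->
  {ae mu, forall x, P x} -> {ae mu, forall x, Q x}.
Proof. by move=> PQ; apply: filterS. Qed.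

Lemma ae_and P Q : {ae mu, forall x, P x} -> {ae mu, forall x, Q x} ->
  {ae mu, forall x, P x /\ Q x}.
Proof. by move=> aP aQ; apply: filterS2 aP aQ. Qed.

Lemma ae_nat (P : nat -> T -> Prop) : (forall n, {ae mu, forall x, P n x}) ->
  {ae mu, forall x, forall n, P n x}.
Proof.
move=> aP; apply: (negligibleS _ (negligible_bigcup aP)).
by move=> x /= /existsNP[n nP]; exists n.
Qed.

Lemma aeT P : (forall x, P x) -> {ae mu, forall x, P x}.
Proof. by move=> aP; apply: aeW. Qed.

End almost_everywhere.

Section null_sets.
Context d1 d2 (T1 : measurableType d1) (T2 : measurableType d2) (R : realType).
Variable m1 : {sigma_finite_measure set T1 -> \bar R}.
Variable m2 : {sigma_finite_measure set T2 -> \bar R}.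

Lemma ge0_integral_eq0_ae d (T : measurableType d)
    (mu : {measure set T -> \bar R}) (f : T -> \bar R) :
  measurable_fun setT f -> (forall x, 0 <= f x)%E ->
  (\int[mu]_x f x = 0)%E <-> {ae mu, forall x, f x = 0%E}.
Proof.
move=> mf f0; have := ae_eq_integral_abs mu measurableT mf.
rewrite (eq_integral f); last by move=> x _; rewrite gee0_abs.
move=> ->; split; apply: filterS => x //; exact.
Qed.

Lemma product_null_xsection (S : set (T1 * T2)) : measurable S ->
  ((m1 \x m2)%E S = 0%E) <-> {ae m1, forall x, m2 (xsection S x) = 0%E}.
Proof.
move=> mS; rewrite -(ge0_integral_eq0_ae m1 (f := m2 \o xsection S))//.
exact: measurable_fun_xsection.
Qed.

Lemma product_null_ysection (S : set (T1 * T2)) : measurable S ->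
  ((m1 \x m2)%E S = 0%E) <-> {ae m2, forall y, m1 (ysection S y) = 0%E}.
Proof.
move=> mS; rewrite -(ge0_integral_eq0_ae m2 (f := m1 \o ysection S))//; last first.
  exact: measurable_fun_ysection.
have := @indic_fubini_tonelli _ _ _ _ _ m1 m2 S mS.
rewrite (indic_fubini_tonelli_FE m2 mS) (indic_fubini_tonelli_GE m1 mS) => <-.
by [].
Qed.

Lemma ae_exists d (T : measurableType d) (mu : {measure set T -> \bar R})
    (P : T -> Prop) : mu setT != 0%E -> {ae mu, forall x, P x} -> exists x, P x.
Proof.
move=> mu0 [N [mN N0 PN]]; apply: contrapT => nP.
have : N = setT.
  by rewrite -subTset => x _; apply: PN => /= Px; apply: nP; exists x.
by move=> NT; move: mu0; rewrite -NT N0 eqxx.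
Qed.

End null_sets.

(* Weil's argument: a null set is met by almost no translate, so the image of
   the invariant measure under [L] has the same null sets. *)
Lemma null_preimage_linear d (T : measurableType d) (R : realType)
    (mu : {sigma_finite_measure set T -> \bar R}) (add : T -> T -> T)
    (L : T -> T) (N : set T) :
  mu setT != 0%E ->
  measurable_fun setT (fun z : T * T => add z.1 z.2) ->
  (forall a A, measurable A -> mu A = 0%E -> mu (add a @^-1` A) = 0%E) ->
  (forall a A, measurable A -> mu A = 0%E -> mu (add ^~ a @^-1` A) = 0%E) ->
  (forall a, exists b, forall x, add a (add b x) = x) ->
  measurable_fun setT L -> {morph L : x y / add x y} ->
  (forall y, exists x, L x = y) ->
  measurable N -> mu N = 0%E -> mu (L @^-1` N) = 0%E.
Proof.
move=> muT madd shl shr oppP mL Ladd Lsurj mN N0.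
pose S : set (T * T) := (fun z : T * T => add z.1 (L z.2)) @^-1` N.
have mS : measurable S.
  rewrite -[S]setTI.
  suff : measurable_fun setT (fun z : T * T => add z.1 (L z.2)) by apply.
  have -> : (fun z : T * T => add z.1 (L z.2)) =
    (fun z : T * T => add z.1 z.2) \o (fun z : T * T => (z.1, L z.2)) by [].
  apply: measurableT_comp => //; apply: measurable_fun_pair => //=.
  by apply: measurableT_comp.
have : (mu \x mu)%E S = 0%E.
  apply/product_null_ysection => //; apply: aeT => y.
  rewrite [ysection _ _](_ : _ = add ^~ (L y) @^-1` N); first exact: shr.
  by rewrite /ysection; apply/seteqP; split=> x /=; rewrite inE.
move=> /product_null_xsection => /(_ mS) /(ae_exists muT)[y].
rewrite (_ : xsection _ _ = (fun x => add y (L x)) @^-1` N); last first.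
  by rewrite /xsection; apply/seteqP; split=> x /=; rewrite inE.
(* Writing [y = L z] turns the null section into a translate of the preimage of [N] under [L], by
   additivity of [L]; the inverse [z'] of [z] undoes the translation. *)
have [z <-] := Lsurj y => Sz; have [z' zK] := oppP z.
have mLN : measurable (L @^-1` N) by rewrite -[X in measurable X]setTI; apply: mL.
have -> : L @^-1` N = add z' @^-1` ((fun x => add (L z) (L x)) @^-1` N).
  by apply/seteqP; split=> x /=; rewrite -Ladd zK.
apply: shl => //.
rewrite -[X in measurable X]setTI.
suff : measurable_fun setT (fun x => add (L z) (L x)) by apply.
have mp : measurable_fun setT (fun x : T => (L z, L x)).
  by apply: measurable_fun_pair.
exact: (measurableT_comp madd mp).
Qed.

Section shifts.
Variable R : realType.

Lemma leb1_shift (a : R) (A : set R) : measurable (A : set (measurableTypeR R)) ->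
  leb1 R ((fun x => x + a) @^-1` A) = leb1 R A.
Proof.
move=> mA.
have mf : measurable_fun setT ((fun x => x + a) : measurableTypeR R -> measurableTypeR R).
  exact: measurable_funD.
apply/esym.
apply: (@lebesgue_measure_unique R (pushforward (@lebesgue_measure R)
  ((fun x => x + a) : measurableTypeR R -> measurableTypeR R)) _ A mA).
move=> _ [[x y]] _ <- /=; rewrite /pushforward.
rewrite [X in _ = lebesgue_measure X](_ : _ = `]x - a, y - a]%classic); last first.
  apply/seteqP; split=> z /=; rewrite !in_itv/= => /andP[? ?]; apply/andP; split; lra.
rewrite !lebesgue_measure_itv/= !lte_fin ltrD2r.
by case: ifP => // _; rewrite -!EFinB; congr EFin; lra.
Qed.

End shifts.

(** Sections of the preimage are preimages of sections, so Fubini reduces the claim to one factor at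
    a time. Only null sets are compared: neither map has to preserve or rescale its measure. *)
Lemma product_null_map d1 d2 (T1 : measurableType d1) (T2 : measurableType d2)
    (R : realType) (m1 : {sigma_finite_measure set T1 -> \bar R})
    (m2 : {sigma_finite_measure set T2 -> \bar R}) (f : T1 -> T1) (g : T2 -> T2) A :
  measurable_fun setT f -> measurable_fun setT g ->
  (forall B, measurable B -> m1 B = 0%E -> m1 (f @^-1` B) = 0%E) ->
  (forall B, measurable B -> m2 B = 0%E -> m2 (g @^-1` B) = 0%E) ->
  measurable A -> (m1 \x m2)%E A = 0%E ->
  (m1 \x m2)%E ((fun z => (f z.1, g z.2)) @^-1` A) = 0%E.
Proof.
move=> mf mg f0 g0 mA.
have mfg : measurable ((fun z : T1 * T2 => (f z.1, g z.2)) @^-1` A).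
  rewrite -[X in measurable X]setTI.
  suff : measurable_fun setT (fun z : T1 * T2 => (f z.1, g z.2)) by apply.
  by apply: measurable_fun_pair; apply: measurableT_comp.
move=> /product_null_xsection => /(_ mA) -[N [mN N0 AN]].
apply/product_null_xsection => //.
exists (f @^-1` N); split.
- by rewrite -[X in measurable X]setTI; apply: mf.
- exact: f0.
- move=> x /= h; apply: AN => /= AN0; apply: h.
  have -> : xsection ((fun z => (f z.1, g z.2)) @^-1` A) x = g @^-1` (xsection A (f x)).
    by rewrite /xsection; apply/seteqP; split=> y /=; rewrite !inE.
  apply: g0 => //; exact: measurable_xsection.
Qed.

Section shifts3.
Variable R : realType.

Lemma leb1_null_shift (a : R) (A : set (measurableTypeR R)) : measurable A ->
  leb1 R A = 0%E -> leb1 R ((fun x => x + a) @^-1` A) = 0%E.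
Proof. by move=> mA A0; rewrite leb1_shift. Qed.

Lemma leb2_null_shift (a : R2 R) (A : set (R2 R)) : measurable A ->
  leb2 R A = 0%E -> leb2 R ((fun x => x + a) @^-1` A) = 0%E.
Proof.
move=> mA A0; apply: (@product_null_map _ _ _ _ R (leb1 R) (leb1 R)
   (fun x => x + a.1) (fun x => x + a.2)) => //.
- exact: measurable_funD.
- exact: measurable_funD.
- by move=> *; exact: leb1_null_shift.
- by move=> *; exact: leb1_null_shift.
Qed.

Lemma leb3_null_shift (a : R3 R) (A : set (R3 R)) : measurable A ->
  leb3 R A = 0%E -> leb3 R ((fun x => x + a) @^-1` A) = 0%E.
Proof.
move=> mA A0; apply: (@product_null_map _ _ _ _ R (leb2 R) (leb1 R)
   (fun x => x + a.1) (fun x => x + a.2)) => //.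
- by apply: measurable_fun_pair; apply: measurable_funD => //=.
- exact: measurable_funD.
- by move=> *; exact: leb2_null_shift.
- by move=> *; exact: leb1_null_shift.
Qed.

End shifts3.

Lemma measurable_preimage d d' (T : measurableType d) (T' : measurableType d')
    (f : T -> T') (N : set T') :
  measurable_fun setT f -> measurable N -> measurable (f @^-1` N).
Proof. by move=> mf mN; rewrite -[X in measurable X]setTI; exact: mf. Qed.

Lemma measurable_fun_fst d d1 d2 (T : measurableType d) (T1 : measurableType d1)
    (T2 : measurableType d2) (D : set T) (g : T -> T1 * T2) :
  measurable_fun D g -> measurable_fun D (fun x => (g x).1).
Proof. by move=> mg; exact: (measurableT_comp measurable_fst mg). Qed.

Lemma measurable_fun_snd d d1 d2 (T : measurableType d) (T1 : measurableType d1)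
    (T2 : measurableType d2) (D : set T) (g : T -> T1 * T2) :
  measurable_fun D g -> measurable_fun D (fun x => (g x).2).
Proof. by move=> mg; exact: (measurableT_comp measurable_snd mg). Qed.

Section composition_measurability.
Variable R : realType.

Lemma measurable_cosT d (T : measurableType d) (f : T -> R) :
  measurable_fun setT f -> measurable_fun setT (fun x => cos (f x)).
Proof.
exact: (measurableT_comp (continuous_measurable_fun (@continuous_cos R))).
Qed.

Lemma measurable_sinT d (T : measurableType d) (f : T -> R) :
  measurable_fun setT f -> measurable_fun setT (fun x => sin (f x)).
Proof.
exact: (measurableT_comp (continuous_measurable_fun (@continuous_sin R))).
Qed.

Lemma measurable_oppT d (T : measurableType d) (f : T -> R) :
  measurable_fun setT f -> measurable_fun setT (fun x => - f x).
Proof. exact: (measurableT_comp (@oppr_measurable R setT)). Qed.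

End composition_measurability.

Ltac measurable_tac :=
  repeat match goal with
  | |- measurable_fun _ _ => assumption
  | |- measurable_fun _ (fun=> ?c) => exact: measurable_cst
  | |- measurable_fun _ (fun x => x) => exact: measurable_id
  | |- measurable_fun _ fst => exact: measurable_fst
  | |- measurable_fun _ snd => exact: measurable_snd
  | |- measurable_fun _ (fun x => (_, _)) => apply: measurable_fun_pair
  | |- measurable_fun _ (fun x => fst _) => apply: measurable_fun_fst
  | |- measurable_fun _ (fun x => snd _) => apply: measurable_fun_snd
  | |- measurable_fun _ (fun x => cos _) => apply: measurable_cosT
  | |- measurable_fun _ (fun x => sin _) => apply: measurable_sinT
  | |- measurable_fun _ (fun x => - _) => apply: measurable_oppT
  | |- measurable_fun _ (fun x => _ - _) => apply: measurable_funB
  | |- measurable_fun _ (fun x => _ + _) => apply: measurable_funD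
  | |- measurable_fun _ (fun x => _ * _) => apply: measurable_funM
  end.

Section linear_images.
Variable R : realType.

Lemma leb1_setT : leb1 R setT = +oo%E.
Proof. by rewrite /leb1/= -set_itvNyy lebesgue_measure_itv. Qed.

Lemma leb2_setT : leb2 R setT = +oo%E.
Proof.
rewrite -setXTT; transitivity (leb1 R setT * leb1 R setT)%E; first exact: product_measure1E.
by rewrite leb1_setT mulyy.
Qed.

Lemma leb3_setT : leb3 R setT = +oo%E.
Proof.
rewrite -setXTT; transitivity (leb2 R setT * leb1 R setT)%E; first exact: product_measure1E.
by rewrite leb1_setT leb2_setT mulyy.
Qed.

Lemma leb2_null_linear (L : R2 R -> R2 R) N :
  measurable_fun setT L -> {morph L : x y / x + y} ->
  (forall y, exists x, L x = y) ->
  measurable N -> leb2 R N = 0%E -> leb2 R (L @^-1` N) = 0%E.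
Proof.
move=> mL Ladd Lsurj mN N0.
apply: (@null_preimage_linear _ _ R (leb2 R) +%R L N) => //.
- by rewrite /= leb2_setT.
- by apply: measurable_fun_pair => /=; measurable_tac.
- move=> a A mA A0; have -> : +%R a = (fun x => x + a).
    by apply/funext => x; rewrite addrC.
  exact: leb2_null_shift.
- by move=> *; exact: leb2_null_shift.
- by move=> a; exists (- a) => x; rewrite addrA subrr add0r.
Qed.

Lemma leb3_null_linear (L : R3 R -> R3 R) N :
  measurable_fun setT L -> {morph L : x y / x + y} ->
  (forall y, exists x, L x = y) ->
  measurable N -> leb3 R N = 0%E -> leb3 R (L @^-1` N) = 0%E.
Proof.
move=> mL Ladd Lsurj mN N0.
apply: (@null_preimage_linear _ _ R (leb3 R) +%R L N) => //.
- by rewrite /= leb3_setT.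
- by apply: measurable_fun_pair => /=; [apply: measurable_fun_pair => /=|]; measurable_tac.
- move=> a A mA A0; have -> : +%R a = (fun x => x + a).
    by apply/funext => x; rewrite addrC.
  exact: leb3_null_shift.
- by move=> *; exact: leb3_null_shift.
- by move=> a; exists (- a) => x; rewrite addrA subrr add0r.
Qed.

Lemma leb1_null_scale (c : R) (N : set (measurableTypeR R)) : c != 0 ->
  measurable N -> leb1 R N = 0%E -> leb1 R ((fun x => c * x) @^-1` N) = 0%E.
Proof.
move=> c0 mN N0.
apply: (@null_preimage_linear _ _ R (leb1 R) +%R (fun x => c * x) N) => //.
- by rewrite /= leb1_setT.
- by measurable_tac.
- move=> a A mA A0; have -> : +%R a = (fun x : measurableTypeR R => x + a).
    by apply/funext => x; rewrite addrC.
  exact: leb1_null_shift.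
- by move=> *; exact: leb1_null_shift.
- by move=> a; exists (- a) => x; rewrite addrA subrr add0r.
- by measurable_tac.
- by move=> x y; rewrite mulrDr.
- by move=> y; exists (y / c); rewrite mulrC divfK.
Qed.

Lemma leb1_set1 (a : R) : leb1 R [set a] = 0%E.
Proof. by rewrite /leb1/= lebesgue_measure_set1. Qed.

Lemma leb2_ae_fst_neq0 : {ae leb2 R, forall z, z.1 != 0}.
Proof.
exists ([set 0] `*` setT); split => //.
- exact: measurableX.
- transitivity (leb1 R [set 0%R] * leb1 R setT)%E; first exact: product_measure1E.
  by rewrite leb1_set1 mul0e.
- by move=> z /= /negP; rewrite negbK => /eqP.
Qed.

End linear_images.

(** * Polar and spherical coordinates as nonsingular maps *)

Section polar.
Variable R : realType.

Definition polar (z : R2 R) : R2 R := (z.1 * cos z.2, z.1 * sin z.2).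

Let cmul (w z : R2 R) : R2 R := (w.1 * z.1 - w.2 * z.2, w.1 * z.2 + w.2 * z.1).

Lemma measurable_polar : measurable_fun setT polar.
Proof.
by rewrite /polar; measurable_tac.
Qed.

Let polar_exists (x y : R) : x != 0 ->
  exists r t : R, [/\ r != 0, r * cos t = x & r * sin t = y].
Proof.
move=> x0; set r := Num.sqrt (x ^+ 2 + y ^+ 2).
have r2 : r ^+ 2 = x ^+ 2 + y ^+ 2 by rewrite sqr_sqrtr// addr_ge0// sqr_ge0.
have r0 : 0 < r.
  by rewrite sqrtr_gt0 ltr_wpDr// ?sqr_ge0// exprn_even_gt0.
have x1 : -1 <= x / r <= 1.
  rewrite -ler_norml normrM normfV (gtr0_norm r0) ler_pdivrMr// mul1r.
  rewrite -(@ler_pXn2r _ 2) ?nnegrE ?normr_ge0 ?(ltW r0)//.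
  by rewrite real_normK ?num_real// r2 lerDl sqr_ge0.
have s2 : sin (acos (x / r)) = `|y| / r.
  rewrite sin_acos//.
  have -> : 1 - (x / r) ^+ 2 = (`|y| / r) ^+ 2.
    rewrite !expr_div_n real_normK ?num_real// r2.
    by field; rewrite -r2 expf_neq0// gt_eqF.
  by rewrite sqrtr_sqr ger0_norm// divr_ge0// ltW.
have c2 : cos (acos (x / r)) = x / r by rewrite acosK// in_itv.
have rn : r != 0 by rewrite gt_eqF.
have [w20|w20] := leP 0 y.
  exists r, (acos (x / r)); rewrite s2 c2 (ger0_norm w20).
  by split => //; rewrite mulrC divfK.
exists r, (- acos (x / r)); rewrite cosN sinN s2 c2 (ltr0_norm w20).
by rewrite mulNr opprK; split => //; rewrite mulrC divfK.
Qed.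

Lemma polar_surj (w : R2 R) : w.1 != 0 -> exists2 z, polar z = w & z.1 != 0.
Proof.
case: w => x y /= x0; have [r [t [r0 <- <-]]] := polar_exists y x0.
by exists (r, t).
Qed.

Let cmul_surj z : polar z != 0 -> forall y, exists x, cmul x (polar z) = y.
Proof.
move=> z0 [y1 y2]; case E : (polar z) => [a b].
have ab : a ^+ 2 + b ^+ 2 != 0.
  apply: contra_neq z0 => /eqP; rewrite E paddr_eq0 ?sqr_ge0// !sqrf_eq0.
  by move=> /andP[/eqP-> /eqP->].
exists ((y1 * a + y2 * b) / (a ^+ 2 + b ^+ 2), (y2 * a - y1 * b) / (a ^+ 2 + b ^+ 2)).
by rewrite /cmul/=; congr (_, _); field.
Qed.

(** Complex multiplication [cmul] plays the part that translation plays in Weil's argument: it is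
    linear in the first factor, and in polar coordinates it multiplies radii and adds angles. By
    Fubini some [polar z] has a null set of [y] with [cmul (polar z) (polar y)] in [N]; undoing the
    scaling and the shift gives the claim. *)
Lemma polar_null N : measurable N -> leb2 R N = 0%E -> leb2 R (polar @^-1` N) = 0%E.
Proof.
move=> mN N0.
pose S : set (R2 R * R2 R) := (fun z => cmul z.1 (polar z.2)) @^-1` N.
have mS : measurable S.
  have mF : measurable_fun setT (fun z : R2 R * R2 R => cmul z.1 (polar z.2)).
    by rewrite /cmul/polar/=; measurable_tac.
  by rewrite -[S]setTI; exact: mF.
have : (leb2 R \x leb2 R)%E S = 0%E.
  apply/product_null_ysection => //.
  apply: ae_imp (leb2_ae_fst_neq0 R) => z z0.
  rewrite (_ : ysection _ _ = (cmul ^~ (polar z)) @^-1` N); last first.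
    by rewrite /ysection; apply/seteqP; split=> x /=; rewrite inE.
  apply: leb2_null_linear => //.
  - by rewrite /cmul; measurable_tac.
  - by move=> x y; rewrite /cmul/=; congr (_, _) => /=; ring.
  - apply: cmul_surj; apply: contra_neq z0 => /(congr1 (fun w => w.1 ^+ 2 + w.2 ^+ 2)) /= /eqP.
    rewrite !exprMn -mulrDr cos2Dsin2 mulr1 expr0n/= addr0 sqrf_eq0.
    by move/eqP.
move=> /product_null_xsection => /(_ mS) h.
have : {ae leb2 R, forall w, leb2 R (xsection S w) = 0%E /\ w.1 != 0}.
  exact: ae_and h (leb2_ae_fst_neq0 R).
move=> /ae_exists[|w [+ w0]]; first by rewrite /= leb2_setT.
have [z <- z0] := polar_surj w0.
rewrite (_ : xsection _ _ = (fun y => polar (z.1 * y.1, y.2 + z.2)) @^-1` N); last first.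
  have E x : cmul (polar z) (polar x) = polar (z.1 * x.1, x.2 + z.2).
    by rewrite /cmul/polar/= cosD sinD; congr (_, _); ring.
  by rewrite /xsection; apply/seteqP; split=> x /=; rewrite inE /S/= E.
move=> A0.
have mA : measurable ((fun y : R2 R => polar (z.1 * y.1, y.2 + z.2)) @^-1` N).
  have mF : measurable_fun setT (fun y : R2 R => polar (z.1 * y.1, y.2 + z.2)).
    by rewrite /polar; measurable_tac.
  by rewrite -[X in measurable X]setTI; apply: mF.
have -> : polar @^-1` N = (fun y => (z.1^-1 * y.1, y.2 - z.2)) @^-1`
    ((fun y => polar (z.1 * y.1, y.2 + z.2)) @^-1` N).
  by apply/seteqP; split=> -[x y] /=; rewrite mulVKf// subrK.
apply: (@product_null_map _ _ _ _ R (leb1 R) (leb1 R) (fun x => z.1^-1 * x) (fun x => x - z.2)) => //.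
- by measurable_tac.
- by measurable_tac.
- by move=> B mB B0; apply: leb1_null_scale => //; rewrite invr_neq0.
- by move=> *; exact: leb1_null_shift.
Qed.

End polar.

Section spherical.
Variable R : realType.

Let rot (x : R3 R) : R3 R := ((x.1.2, x.2), x.1.1).
Let unrot (x : R3 R) : R3 R := ((x.2, x.1.1), x.1.2).

Let rot_null N : measurable N -> leb3 R N = 0%E -> leb3 R (rot @^-1` N) = 0%E.
Proof.
apply: leb3_null_linear => //.
- by rewrite /rot; measurable_tac.
- by move=> [[a b] c]; exists ((c, a), b).
Qed.

Let unrot_null N : measurable N -> leb3 R N = 0%E -> leb3 R (unrot @^-1` N) = 0%E.
Proof.
apply: leb3_null_linear => //.
- by rewrite /unrot; measurable_tac.
- by move=> [[a b] c]; exists ((b, c), a).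
Qed.

Lemma scale3E (c : R) (x : R3 R) :
  c *: x = ((c * x.1.1, c * x.1.2), c * x.2) :> R3 R.
Proof. by []. Qed.

Lemma add3E (x y : R3 R) :
  x + y = ((x.1.1 + y.1.1, x.1.2 + y.1.2), x.2 + y.2) :> R3 R.
Proof. by []. Qed.

Definition spherical (x : R3 R) : R3 R := x.1.1 *: sphere_point (x.1.2, x.2).

(** Spherical coordinates are two planar polar changes with a cyclic permutation of the coordinates
    between them; the last [unrot] and [rot] of the factorization cancel. *)
Lemma spherical_null N : measurable N -> leb3 R N = 0%E ->
  leb3 R (spherical @^-1` N) = 0%E.
Proof.
move=> mN N0.
pose pol_id (x : R3 R) : R3 R := (polar x.1, x.2).
have pol_null M : measurable M -> leb3 R M = 0%E -> leb3 R (pol_id @^-1` M) = 0%E.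
  apply: (@product_null_map _ _ _ _ R (leb2 R) (leb1 R) (@polar R) idfun) => //.
  - exact: measurable_polar.
  - exact: measurable_id.
  - by move=> B mB B0; exact: (polar_null mB B0).
have mpol : measurable_fun setT pol_id.
  by apply: measurable_fun_pair; [apply: (measurableT_comp (@measurable_polar R))|].
have mpre (f : R3 R -> R3 R) M : measurable_fun setT f -> measurable M -> measurable (f @^-1` M).
  by move=> mf mM; rewrite -[X in measurable X]setTI; exact: mf.
have mrot : measurable_fun setT rot by rewrite /rot; measurable_tac.
have -> : spherical @^-1` N = pol_id @^-1` (rot @^-1` (pol_id @^-1` (unrot @^-1` (rot @^-1` N)))).
  apply/seteqP; split => -[[r t] u]; rewrite /spherical/pol_id/rot/polar/sphere_point/= scale3E/= !mulrA//.
apply: (pol_null); first by do 4 (apply: (mpre) => //; try by rewrite /unrot; measurable_tac).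
apply: rot_null; first by do 3 (apply: (mpre) => //; try by rewrite /unrot; measurable_tac).
apply: (pol_null); first by do 2 (apply: (mpre) => //; try by rewrite /unrot; measurable_tac).
apply: unrot_null; first by do 1 (apply: (mpre) => //).
exact: rot_null.
Qed.

Definition direction (x : R3 R) : R3 R := (norm3 x)^-1 *: x.

Lemma dot3_sphere_point a : dot3 (sphere_point a) (sphere_point a) = 1 :> R.
Proof.
rewrite /dot3 /sphere_point/=.
rewrite -!expr2 !exprMn -mulrDr cos2Dsin2 mulr1 addrC cos2Dsin2.
by [].
Qed.

Lemma norm3_sphere_point a : norm3 (sphere_point a) = 1 :> R.
Proof. by rewrite /norm3 dot3_sphere_point sqrtr1. Qed.

Lemma dot3Z (c : R) x y : dot3 (c *: x) y = c * dot3 x y.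
Proof. by rewrite /dot3 scale3E/=; ring. Qed.

Lemma dot3C (x y : R3 R) : dot3 x y = dot3 y x.
Proof. by rewrite /dot3; ring. Qed.

Lemma dot3D (x y z : R3 R) : dot3 (x + y) z = dot3 x z + dot3 y z.
Proof. by rewrite /dot3 add3E/=; ring. Qed.

Lemma dot3_ge0 (x : R3 R) : 0 <= dot3 x x.
Proof. by rewrite /dot3 -!expr2 !addr_ge0// sqr_ge0. Qed.

Lemma norm3Z (c : R) (x : R3 R) : norm3 (c *: x) = `|c| * norm3 x.
Proof.
by rewrite /norm3 dot3Z dot3C dot3Z mulrA -expr2 sqrtrM ?sqr_ge0// sqrtr_sqr.
Qed.

Lemma direction_spherical (r t u : R) : 0 < r -> direction (spherical ((r, t), u)) = sphere_point (t, u).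
Proof.
move=> r0; rewrite /direction /spherical/= norm3Z norm3_sphere_point mulr1 gtr0_norm//.
by rewrite scalerA mulVf ?scale1r// gt_eqF.
Qed.

Lemma norm3_ge0 (x : R3 R) : 0 <= norm3 x.
Proof. exact: sqrtr_ge0. Qed.

Lemma norm3_sqr (x : R3 R) : norm3 x ^+ 2 = dot3 x x.
Proof. by rewrite sqr_sqrtr// dot3_ge0. Qed.

Lemma measurable_dot3 d (T : measurableType d) (f g : T -> R3 R) :
  measurable_fun setT f -> measurable_fun setT g ->
  measurable_fun setT (fun x => dot3 (f x) (g x)).
Proof. by move=> mf mg; rewrite /dot3; measurable_tac => //. Qed.

Lemma measurable_sqrtr d (T : measurableType d) (f : T -> R) :
  measurable_fun setT f -> measurable_fun setT (fun x => Num.sqrt (f x)).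
Proof.
exact: (measurableT_comp (continuous_measurable_fun (@sqrt_continuous R))).
Qed.

Lemma measurable_norm3 d (T : measurableType d) (f : T -> R3 R) :
  measurable_fun setT f -> measurable_fun setT (fun x => norm3 (f x)).
Proof. by move=> mf; apply: measurable_sqrtr; exact: measurable_dot3. Qed.

Lemma measurable_scale3 d (T : measurableType d) (c : T -> R) (f : T -> R3 R) :
  measurable_fun setT c -> measurable_fun setT f ->
  measurable_fun setT (fun x => c x *: f x : R3 R).
Proof.
move=> mc mf.
suff : measurable_fun setT
  (fun x => ((c x * (f x).1.1, c x * (f x).1.2), c x * (f x).2) : R3 R) by [].
by measurable_tac.
Qed.

Lemma measurable_add3 d (T : measurableType d) (f g : T -> R3 R) :
  measurable_fun setT f -> measurable_fun setT g ->
  measurable_fun setT (fun x => f x + g x : R3 R).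
Proof.
move=> mf mg.
suff : measurable_fun setT (fun x =>
  (((f x).1.1 + (g x).1.1, (f x).1.2 + (g x).1.2), (f x).2 + (g x).2) : R3 R) by [].
by measurable_tac.
Qed.

Lemma measurable_opp3 d (T : measurableType d) (f : T -> R3 R) :
  measurable_fun setT f -> measurable_fun setT (fun x => - f x : R3 R).
Proof.
move=> mf.
suff : measurable_fun setT
  (fun x => ((- (f x).1.1, - (f x).1.2), - (f x).2) : R3 R) by [].
by measurable_tac.
Qed.

Lemma measurable_invr d (T : measurableType d) (f : T -> R) :
  (forall x, 0 <= f x) ->
  measurable_fun setT f -> measurable_fun setT (fun x => (f x)^-1).
Proof.
move=> f0 mf; under eq_fun do rewrite -powR_inv1//.
exact: (measurableT_comp (measurable_powR (-1))).
Qed.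

Lemma measurable_direction : measurable_fun setT direction.
Proof.
apply: measurable_scale3 => //; apply: measurable_invr.
  by move=> x; exact: norm3_ge0.
exact: measurable_norm3.
Qed.

Lemma measurable_sphere_point : measurable_fun setT (@sphere_point R).
Proof. by rewrite /sphere_point; measurable_tac. Qed.

(** If a point of the sphere lies in [A], the whole open ray through it lies in the cone over [A],
    so in spherical coordinates its section contains all radii of ]0, 1[. By Fubini a null cone can
    do this for almost no direction. The lemma carries null sets from R^3, where the linear maps
    act, to the sphere. *)
Lemma sphere_null_cone (A : set (R3 R)) : measurable A ->
  leb3 R (direction @^-1` A) = 0%E -> sphere_measure R A = 0%E.
Proof.
move=> mA A0.
have mpre (f : R3 R -> R3 R) M : measurable_fun setT f -> measurable M -> measurable (f @^-1` M).
  by move=> mf mM; rewrite -[X in measurable X]setTI; exact: mf.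
have mspherical : measurable_fun setT spherical.
  apply: measurable_scale3; first by measurable_tac.
  by apply: (measurableT_comp measurable_sphere_point); measurable_tac.
have mdA : measurable (direction @^-1` A) by apply: (mpre) => //; exact: measurable_direction.
(* [unrot] moves the radius to the last coordinate, where the product structure of [leb3] separates
   it from the two angles. *)
have := unrot_null (mpre _ _ mspherical mdA) (spherical_null mdA A0).
set M := _ @^-1` _.
have mM : measurable M.
  by apply: (mpre); [rewrite /unrot; measurable_tac|exact: (mpre _ _ mspherical mdA)].
move=> /(@product_null_xsection _ _ _ _ R (leb2 R) (leb1 R)) => /(_ mM) h.
have msA : measurable (@sphere_angles R `&` @sphere_point R @^-1` A).
  apply: measurableI; first by apply: measurableX; exact: measurable_itv.
  by rewrite -[X in measurable X]setTI; apply: measurable_sphere_point.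
have {}h : {ae leb2 R, forall a, ~ A (sphere_point a)}.
  apply: ae_imp h => -[t u] /= + At.
  move/eqP; rewrite gt_eqF//.
  apply: (@lt_le_trans _ _ (leb1 R `]0, 1[%classic)).
    by rewrite /leb1/= lebesgue_measure_itv/= lte_fin ltr01 -EFinB lte_fin subr0.
  apply: le_measure; rewrite ?inE//.
    exact: measurable_xsection.
  move=> r /=; rewrite in_itv/= => /andP[r0 _].
  by rewrite /xsection/= inE /M/unrot/= direction_spherical.
have sA0 : leb2 R (@sphere_angles R `&` @sphere_point R @^-1` A) = 0%E.
  case: h => N [mN N0 AN]; apply: (subset_measure0 msA mN _ N0) => //.
  by move=> a /= [_ Aa]; apply: AN => /=; exact.
rewrite /sphere_measure; apply: null_set_integral => //.
apply/measurable_EFinP; apply: measurable_funTS; measurable_tac.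
Qed.

End spherical.

(** * Quaternions and the nonsingularity of the collision maps *)

Section quaternions.
Variable R : realType.
Notation R4 := (R2 R * R2 R)%type.

(** The product of quaternions, with [((a, b), (c, d))] standing for a + b i + c j + d k. *)
Definition hmul (h k : R4) : R4 :=
  ((h.1.1 * k.1.1 - h.1.2 * k.1.2 - h.2.1 * k.2.1 - h.2.2 * k.2.2,
    h.1.1 * k.1.2 + h.1.2 * k.1.1 + h.2.1 * k.2.2 - h.2.2 * k.2.1),
   (h.1.1 * k.2.1 - h.1.2 * k.2.2 + h.2.1 * k.1.1 + h.2.2 * k.1.2,
    h.1.1 * k.2.2 + h.1.2 * k.2.1 - h.2.1 * k.1.2 + h.2.2 * k.1.1)).

Definition hnorm2 (h : R4) : R :=
  h.1.1 ^+ 2 + h.1.2 ^+ 2 + h.2.1 ^+ 2 + h.2.2 ^+ 2.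

(* The similarity v |-> h v h^* of the imaginary quaternions. *)
Definition hact (h : R4) (v : R3 R) : R3 R :=
  let a := h.1.1 in let b := h.1.2 in let c := h.2.1 in let d := h.2.2 in
  let x := v.1.1 in let y := v.1.2 in let z := v.2 in
  (((a * a + b * b - c * c - d * d) * x + 2 * (b * c - a * d) * y
     + 2 * (b * d + a * c) * z,
    2 * (b * c + a * d) * x + (a * a - b * b + c * c - d * d) * y
     + 2 * (c * d - a * b) * z),
   2 * (b * d - a * c) * x + 2 * (c * d + a * b) * y
     + (a * a - b * b - c * c + d * d) * z).

Definition hconj (h : R4) : R4 := ((h.1.1, - h.1.2), (- h.2.1, - h.2.2)).

Let pair3 (a b c a' b' c' : R) : a = a' -> b = b' -> c = c' ->
  (((a, b), c) : R3 R) = ((a', b'), c').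
Proof. by move=> -> -> ->. Qed.

Lemma hactM h k v : hact (hmul h k) v = hact h (hact k v).
Proof. by rewrite /hact/hmul/=; apply: pair3; ring. Qed.

Lemma hactD h u v : hact h (u + v) = hact h u + hact h v.
Proof. by rewrite [hact h u + _]add3E [u + v]add3E /hact/=; apply: pair3; ring. Qed.

Lemma hactZ h (c : R) v : hact h (c *: v) = c *: hact h v.
Proof. by rewrite [c *: hact h v]scale3E [c *: v]scale3E /hact/=; apply: pair3; ring. Qed.

Lemma dot3_hact h u v : dot3 (hact h u) (hact h v) = hnorm2 h ^+ 2 * dot3 u v.
Proof. by rewrite /dot3/hact/hnorm2/=; ring. Qed.

Lemma hactK h v : hact h (hact (hconj h) v) = hnorm2 h ^+ 2 *: v.
Proof. by rewrite [_ *: v]scale3E /hact/hconj/hnorm2/=; apply: pair3; ring. Qed.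

Lemma hact_scale (t : R) h v :
  hact ((t * h.1.1, t * h.1.2), (t * h.2.1, t * h.2.2)) v = t ^+ 2 *: hact h v.
Proof. by rewrite [_ *: _]scale3E /hact/=; apply: pair3; ring. Qed.

Lemma hnorm2_ge0 h : 0 <= hnorm2 h.
Proof. by rewrite /hnorm2 !addr_ge0// sqr_ge0. Qed.

Lemma norm3_hact h v : norm3 (hact h v) = hnorm2 h * norm3 v.
Proof.
rewrite /norm3 dot3_hact sqrtrM ?sqr_ge0// sqrtr_sqr ger0_norm//.
exact: hnorm2_ge0.
Qed.

Lemma norm3_eq0 (v : R3 R) : norm3 v = 0 -> v = 0.
Proof.
move/eqP; rewrite -sqrf_eq0 norm3_sqr /dot3 -!expr2; case: v => [[x y] z]/=.
rewrite paddr_eq0 ?addr_ge0 ?sqr_ge0// paddr_eq0 ?sqr_ge0// !sqrf_eq0.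
by move=> /andP[/andP[/eqP-> /eqP->] /eqP->].
Qed.

Lemma norm3_gt0 (v : R3 R) : v != 0 -> 0 < norm3 v.
Proof.
move=> v0; rewrite lt_neqAle norm3_ge0 andbT eq_sym.
by apply: contra_neq v0; exact: norm3_eq0.
Qed.

Lemma norm30 : norm3 (0 : R3 R) = 0.
Proof. by rewrite /norm3 /dot3/= !mul0r !addr0 sqrtr0. Qed.

(** The quaternion with real part |u| |v| + u.v and imaginary part u x v represents half the angle
    between the vectors, hence turns [u] into the direction of [v]. It vanishes when they are
    opposite, which the last hypothesis excludes. *)
Lemma hact_transitive (u v : R3 R) : 0 < norm3 u -> 0 < norm3 v ->
  0 < norm3 u * norm3 v + dot3 u v ->
  exists2 k, hact k u = v & 0 < hnorm2 k.
Proof.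
move=> u0 v0; set m := _ + _ => m0.
pose k : R4 := ((m, u.1.2 * v.2 - u.2 * v.1.2),
  (u.2 * v.1.1 - u.1.1 * v.2, u.1.1 * v.1.2 - u.1.2 * v.1.1)).
(* [hact k] scales lengths by |k|^2 = 2 m |u| |v|, whence this factor. A quaternion multiplied by
   [t] acts with t^2, so [t] below is a square root. *)
pose c := 2 * m * norm3 u ^+ 2.
have c0 : 0 < c by rewrite /c !mulr_gt0// exprn_gt0.
have kE : hact k u = c *: v.
  have eu := norm3_sqr u; have ev := norm3_sqr v.
  rewrite [_ *: v]scale3E /c; move: eu ev; rewrite /k /hact /m.
  move: (norm3 u) (norm3 v) => nu nv; rewrite /dot3.
  case: u v {u0 v0 m m0 k c c0} => [[x y] z] [[x' y'] z'] /= eu ev.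
  apply: pair3.
  - ring: eu ev.
  - ring: eu ev.
  - ring: eu ev.
have k0 : 0 < hnorm2 k.
  by rewrite /hnorm2 /k/= -!addrA ltr_wpDr ?addr_ge0 ?sqr_ge0// exprn_gt0.
pose t := Num.sqrt c^-1.
have t2 : t ^+ 2 = c^-1 by rewrite sqr_sqrtr// invr_ge0 ltW.
exists ((t * k.1.1, t * k.1.2), (t * k.2.1, t * k.2.2)).
  by rewrite hact_scale kE t2 scalerA mulVf ?scale1r// gt_eqF.
rewrite [X in 0 < X](_ : _ = t ^+ 2 * hnorm2 k); last by rewrite /hnorm2/=; ring.
by rewrite mulr_gt0// t2 invr_gt0.
Qed.

End quaternions.

Section post_nonsingular.
Variable R : realType.
Notation R4 := (R2 R * R2 R)%type.

Definition leb4 : set R4 -> \bar R := (leb2 R \x leb2 R)%E.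
HB.instance Definition _ := Measure.on leb4.
HB.instance Definition _ := Measure_isSigmaFinite.Build _ _ _ leb4
  (sigma_finite_product (leb2 R) (leb2 R)).

Notation R6 := (R3 R * R3 R)%type.

Definition leb6 : set R6 -> \bar R := (leb3 R \x leb3 R)%E.
HB.instance Definition _ := Measure.on leb6.
HB.instance Definition _ := Measure_isSigmaFinite.Build _ _ _ leb6
  (sigma_finite_product (leb3 R) (leb3 R)).

Notation R9 := (R6 * R3 R)%type.

Definition leb9 : set R9 -> \bar R := (leb6 \x leb3 R)%E.
HB.instance Definition _ := Measure.on leb9.
HB.instance Definition _ := Measure_isSigmaFinite.Build _ _ _ leb9
  (sigma_finite_product leb6 (leb3 R)).

Lemma leb4_setT : leb4 setT = +oo%E.
Proof.
rewrite -setXTT; transitivity (leb2 R setT * leb2 R setT)%E; first exact: product_measure1E.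
by rewrite leb2_setT mulyy.
Qed.

Lemma leb4_null_linear (L : R4 -> R4) N :
  measurable_fun setT L -> {morph L : x y / x + y} ->
  (forall y, exists x, L x = y) ->
  measurable N -> leb4 N = 0%E -> leb4 (L @^-1` N) = 0%E.
Proof.
move=> mL Ladd Lsurj mN N0.
have shift (a : R4) (A : set R4) : measurable A -> leb4 A = 0%E ->
    leb4 ((fun x => x + a) @^-1` A) = 0%E.
  move=> mA A0; apply: (@product_null_map _ _ _ _ R (leb2 R) (leb2 R)
     (fun x => x + a.1) (fun x => x + a.2)) => //.
  - by apply: measurable_fun_pair => /=; measurable_tac.
  - by apply: measurable_fun_pair => /=; measurable_tac.
  - by move=> *; exact: leb2_null_shift.
  - by move=> *; exact: leb2_null_shift.
apply: (@null_preimage_linear _ _ R leb4 (fun x y : R4 => x + y) L N).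
- by rewrite [X in X != _]leb4_setT.
- by apply: measurable_fun_pair => /=; apply: measurable_fun_pair => /=; measurable_tac.
- move=> a A mA A0; have -> : (fun y : R4 => a + y) = (fun x => x + a).
    by apply/funext => x; rewrite addrC.
  exact: shift.
- exact: shift.
- by move=> a; exists (- a) => x; rewrite addrA subrr add0r.
- exact: mL.
- exact: Ladd.
- exact: Lsurj.
- exact: mN.
- exact: N0.
Qed.

Lemma measurable_hact d (T : measurableType d) (h : T -> R4) (v : T -> R3 R) :
  measurable_fun setT h -> measurable_fun setT v ->
  measurable_fun setT (fun x => hact (h x) (v x)).
Proof. by move=> mh mv; rewrite /hact; measurable_tac. Qed.

Lemma hact_null (h : R4) N : 0 < hnorm2 h -> measurable N -> leb3 R N = 0%E ->
  leb3 R (hact h @^-1` N) = 0%E.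
Proof.
move=> h0; apply: leb3_null_linear.
- exact: measurable_hact.
- by move=> x y; rewrite hactD.
- move=> y; exists ((hnorm2 h ^+ 2)^-1 *: hact (hconj h) y).
  by rewrite hactZ hactK scalerA mulVf ?scale1r// expf_neq0// gt_eqF.
Qed.

Lemma leb4_ae_hnorm2 : {ae leb4, forall h, 0 < hnorm2 h}.
Proof.
exists (([set 0%R] `*` setT) `*` setT); split => //.
- by apply: measurableX => //; exact: measurableX.
- transitivity (leb2 R ([set 0%R] `*` setT) * leb2 R setT)%E.
    by apply: product_measure1E => //; exact: measurableX.
  rewrite (_ : leb2 R ([set 0%R] `*` setT) = (leb1 R [set 0%R] * leb1 R setT)%E).
    by rewrite leb1_set1 !mul0e.
  exact: product_measure1E.
- move=> h /= h0; split => //; split => //; apply: contrapT => /eqP h1; apply: h0.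
  by rewrite /hnorm2 -!addrA ltr_wpDr ?addr_ge0 ?sqr_ge0// exprn_even_gt0.
Qed.

Lemma leb3_ae_neq0 : {ae leb3 R, forall v, v != 0}.
Proof.
exists (setT `*` [set 0%R]); split => //.
- exact: measurableX.
- transitivity (leb2 R setT * leb1 R [set 0%R])%E.
    exact: product_measure1E.
  by rewrite leb1_set1 mule0.
- by move=> v /= /negP; rewrite negbK => /eqP ->.
Qed.

Lemma measurable_hmulr k : measurable_fun setT (hmul (R := R) ^~ k).
Proof. by rewrite /hmul; measurable_tac. Qed.

Lemma hmulr_null (k : R4) N : 0 < hnorm2 k -> measurable N -> leb4 N = 0%E ->
  leb4 ((fun h => hmul h k) @^-1` N) = 0%E.
Proof.
move=> k0; apply: leb4_null_linear.
- exact: measurable_hmulr.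
- by move=> x y; rewrite /hmul/=; congr ((_, _), (_, _)); rewrite /=; ring.
- move: k0; case: k => [[a b] [c d]]; rewrite /hnorm2/= => k0.
  move=> [[x y] [z t]].
  exists (hmul ((x, y), (z, t)) ((a / (a ^+ 2 + b ^+ 2 + c ^+ 2 + d ^+ 2), - b / (a ^+ 2 + b ^+ 2 + c ^+ 2 + d ^+ 2)),
    (- c / (a ^+ 2 + b ^+ 2 + c ^+ 2 + d ^+ 2), - d / (a ^+ 2 + b ^+ 2 + c ^+ 2 + d ^+ 2)))).
  have {}k0 : a ^+ 2 + b ^+ 2 + c ^+ 2 + d ^+ 2 != 0 by rewrite gt_eqF.
  by rewrite /hmul/=; congr ((_, _), (_, _)); field.
Qed.

End post_nonsingular.
Arguments leb4 : clear implicits.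
Arguments leb6 : clear implicits.
Arguments leb9 : clear implicits.

Section post_nonsingular.
Variable R : realType.
Notation R4 := (R2 R * R2 R)%type.
Notation R6 := (R3 R * R3 R)%type.
Notation R9 := (R6 * R3 R)%type.
Notation leb4 := (leb4 R).
Notation leb6 := (leb6 R).
Notation leb9 := (leb9 R).

Let measurable_hact_l (w : R3 R) : measurable_fun setT (fun h : R4 => hact h w).
Proof. by apply: measurable_hact; measurable_tac. Qed.

(* Quaternions act transitively on the nonzero vectors, so that the null
   preimage obtained by Fubini for one vector is transported to all. *)
Lemma hact_orbit_null (v : R3 R) N : v != 0 -> measurable N -> leb3 R N = 0%E ->
  leb4 ((fun h => hact h v) @^-1` N) = 0%E.
Proof.
move=> v0 mN N0.
(* [hact_transitive] excludes opposite vectors. With a symmetric set the vector [w] found by Fubini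
   may be replaced by [- w], and one of the two is admissible for [v]. *)
pose N' := N `|` -%R @^-1` N.
have mopp : measurable_fun setT (-%R : R3 R -> R3 R) by exact: measurable_opp3.
have mN' : measurable (-%R @^-1` N : set (R3 R)) by exact: measurable_preimage.
have N'0 : leb3 R N' = 0%E.
  apply/eqP; rewrite -measure_le0; apply: (le_trans (measureU2 _ mN mN')).
  rewrite [X in (X + _)%E]N0 add0e measure_le0; apply/eqP.
  apply: leb3_null_linear => //.
  - by move=> x y; rewrite opprD.
  - by move=> y; exists (- y); rewrite opprK.
have mN'' : measurable N' by exact: measurableU.
pose S : set (R4 * R3 R) := (fun z => hact z.1 z.2) @^-1` N'.
have mS : measurable S.
  by apply: measurable_preimage => //; apply: measurable_hact; measurable_tac.
have : (leb4 \x leb3 R)%E S = 0%E.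
  apply/(@product_null_xsection _ _ _ _ R leb4 (leb3 R)) => //.
  apply: ae_imp (leb4_ae_hnorm2 R) => h h0.
  rewrite (_ : xsection _ _ = hact h @^-1` N'); last first.
    by rewrite /xsection; apply/seteqP; split=> x /=; rewrite inE.
  exact: hact_null.
move=> /(@product_null_ysection _ _ _ _ R leb4 (leb3 R)) => /(_ mS) h.
have hT : leb3 R setT != 0%E by rewrite leb3_setT.
have [w [wS w0]] := ae_exists hT (ae_and h (leb3_ae_neq0 R)).
have {wS} wN : leb4 ((fun h => hact h w) @^-1` N') = 0%E.
  by rewrite -wS; congr (leb4 _); rewrite /ysection; apply/seteqP; split=> x /=; rewrite inE.
have wpm (u : R3 R) : (u = w \/ u = - w) -> leb4 ((fun h => hact h u) @^-1` N) = 0%E.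
  move=> uw; apply: (subset_measure0 _ _ _ wN); try exact: measurable_preimage.
  move=> x /= Nx; case: uw Nx => ->; first by left.
  by rewrite -scaleN1r hactZ scaleN1r; right.
have [u [uw u0 uv]] : exists u : R3 R, [/\ u = w \/ u = - w, 0 < norm3 u &
    0 < norm3 u * norm3 v + dot3 u v].
  have nN : norm3 (- w) = norm3 w by rewrite -scaleN1r norm3Z normrN1 mul1r.
  have p : 0 < norm3 w * norm3 v by rewrite mulr_gt0// norm3_gt0.
  have [dp|dn] := leP 0 (dot3 w v).
    by exists w; split; [left|exact: norm3_gt0|rewrite ltr_wpDr].
  exists (- w); split; [by right|by rewrite nN norm3_gt0|].
  by rewrite nN -scaleN1r dot3Z mulN1r ltr_wpDr// oppr_ge0 ltW.
have [k ku k0] := hact_transitive u0 (norm3_gt0 v0) uv.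
rewrite (_ : _ @^-1` N = (fun h => hmul h k) @^-1` ((fun h => hact h u) @^-1` N)); last first.
  by apply/seteqP; split=> h0 /=; rewrite hactM ku.
have mu : measurable ((fun h => hact h u) @^-1` N).
  exact: (measurable_preimage (measurable_hact_l u) mN).
exact: (hmulr_null k0 mu (wpm u uw)).
Qed.

End post_nonsingular.

Section post_nonsingular.
Variable R : realType.
Notation R4 := (R2 R * R2 R)%type.
Notation R6 := (R3 R * R3 R)%type.
Notation R9 := (R6 * R3 R)%type.
Notation leb4 := (leb4 R).
Notation leb6 := (leb6 R).
Notation leb9 := (leb9 R).

Let hact9 (h : R4) (z : R9) : R9 := ((hact h z.1.1, hact h z.1.2), hact h z.2).

Let mhact9 h : measurable_fun setT (hact9 h).
Proof.
have m d (T : measurableType d) (f : T -> R3 R) : measurable_fun setT f ->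
    measurable_fun setT (fun x => hact h (f x)).
  by move=> mf; apply: measurable_hact => //; exact: measurable_cst.
by rewrite /hact9; measurable_tac; apply: (m); measurable_tac.
Qed.

Let hact9_null h N : 0 < hnorm2 h -> measurable N -> leb9 N = 0%E ->
  leb9 (hact9 h @^-1` N) = 0%E.
Proof.
move=> h0.
have m : measurable_fun setT (hact h) by apply: measurable_hact; measurable_tac.
have m2 : measurable_fun setT (fun z : R6 => (hact h z.1, hact h z.2)).
  by apply: measurable_fun_pair => /=; apply: measurableT_comp.
have nul B : measurable B -> leb3 R B = 0%E -> leb3 R (hact h @^-1` B) = 0%E.
  by move=> *; exact: hact_null.
have nul6 B : measurable B -> leb6 B = 0%E ->
    leb6 ((fun z : R6 => (hact h z.1, hact h z.2)) @^-1` B) = 0%E.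
  exact: (@product_null_map _ _ _ _ R (leb3 R) (leb3 R) (hact h) (hact h) B m m nul nul).
exact: (@product_null_map _ _ _ _ R leb6 (leb3 R)
   (fun z : R6 => (hact h z.1, hact h z.2)) (hact h) N m2 m nul6 nul).
Qed.

(** For fixed [z] the orbit of [F z] meets [N] for almost no quaternion, unless [F z = 0]: the
    origin is fixed by every similarity and has to be removed from [N]. Fubini then gives one
    invertible quaternion for which the claim holds after a change of variables, and its inverse
    removes that change. *)
Lemma equivariant_nonsingular (F : R9 -> R3 R) N : measurable_fun setT F ->
  (forall h p q x, 0 < hnorm2 h ->
    F ((hact h p, hact h q), hact h x) = hact h (F ((p, q), x))) ->
  measurable N -> leb3 R N = 0%E -> leb9 (F @^-1` (N `\ 0)) = 0%E.
Proof.
move=> mF Fh' mN N0.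
have Fh h z : 0 < hnorm2 h -> F (hact9 h z) = hact h (F z).
  by case: z => [[p q] x]; exact: Fh'.
have m0 : measurable [set (0 : R3 R)].
  have -> : [set (0 : R3 R)] = ([set 0%R] `*` [set 0%R]) `*` [set 0%R].
    by apply/seteqP; split => [z /= -> //|[[x y] z] /= [[-> ->] ->]].
  by apply: measurableX => //; apply: measurableX.
have mN0 : measurable (N `\ 0) by exact: measurableD.
have mA : measurable (F @^-1` (N `\ 0)) by exact: measurable_preimage.
pose S : set (R4 * R9) := (fun z => hact z.1 (F z.2)) @^-1` (N `\ 0).
have mS : measurable S.
  apply: measurable_preimage => //; apply: measurable_hact; first by measurable_tac.
  by apply: (measurableT_comp mF); measurable_tac.
have : (leb4 \x leb9)%E S = 0%E.
  apply/(@product_null_ysection _ _ _ _ R leb4 leb9) => //; apply: aeT => z.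
  rewrite (_ : ysection _ _ = (fun h => hact h (F z)) @^-1` (N `\ 0)); last first.
    by rewrite /ysection; apply/seteqP; split=> x /=; rewrite inE.
  have [z0|z0] := eqVneq (F z) 0.
    rewrite z0 (_ : _ @^-1` _ = set0) ?measure0// -subset0 => h /= [_]; apply.
    by rewrite -(scale0r (0 : R3 R)) hactZ !scale0r.
  apply: hact_orbit_null => //.
  by apply: (subset_measure0 mN0 mN _ N0) => x [].
move=> /(@product_null_xsection _ _ _ _ R leb4 leb9) => /(_ mS) h.
have hT : leb4 setT != 0%E by rewrite (leb4_setT R).
have [k [kS k0]] := ae_exists hT (ae_and h (leb4_ae_hnorm2 R)).
have {kS} : leb9 ((hact9 k) @^-1` (F @^-1` (N `\ 0))) = 0%E.
  by rewrite -kS; congr (leb9 _); rewrite /xsection; apply/seteqP; split=> x; rewrite /= inE /S/= Fh.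
pose t := (hnorm2 k)^-1.
(* The inverse quaternion, that is, the conjugate divided by the squared norm. *)
pose k' : R4 := ((t * k.1.1, t * - k.1.2), (t * - k.2.1, t * - k.2.2)).
have t0 : t != 0 by rewrite invr_neq0// gt_eqF.
have k'0 : 0 < hnorm2 k'.
  rewrite (_ : hnorm2 k' = t ^+ 2 * hnorm2 k); last by rewrite /hnorm2/=; ring.
  by rewrite mulr_gt0// exprn_even_gt0.
have k'K x : hact k (hact k' x) = x.
  rewrite /k' (hact_scale t (hconj k)) hactZ hactK scalerA -exprMn mulVf ?gt_eqF//.
  by rewrite expr1n scale1r.
have mkA : measurable (hact9 k @^-1` (F @^-1` (N `\ 0))) by exact: measurable_preimage.
move=> /(hact9_null k'0 mkA).
rewrite -comp_preimage (_ : hact9 k \o hact9 k' = id)//.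
by apply/funext => -[[x y] z]; rewrite /hact9/= !k'K.
Qed.

End post_nonsingular.

Lemma ae_xsection d1 d2 (T1 : measurableType d1) (T2 : measurableType d2)
    (R : realType) (m1 : {sigma_finite_measure set T1 -> \bar R})
    (m2 : {sigma_finite_measure set T2 -> \bar R}) (P : T1 * T2 -> Prop) :
  {ae (m1 \x m2)%E, forall z, P z} ->
  {ae m1, forall x, {ae m2, forall y, P (x, y)}}.
Proof.
move=> [N [mN /(product_null_xsection m1 m2 mN) N0 PN]].
apply: ae_imp N0 => x Nx0; exists (xsection N x); split => //.
  exact: measurable_xsection.
by move=> y /= nP; rewrite /xsection/= inE; apply: PN.
Qed.

(** * Equivariance of the collision maps *)

Section post_momenta.
Variable R : realType.
Implicit Types (p q w : R3 R) (h : R2 R * R2 R).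

Lemma measurable_rho d (T : measurableType d) (f g : T -> R3 R) :
  measurable_fun setT f -> measurable_fun setT g ->
  measurable_fun setT (fun x => rho (f x) (g x)).
Proof.
move=> mf mg; apply: measurable_sqrtr; measurable_tac.
- exact: measurable_norm3.
- exact: measurable_norm3.
- exact: measurable_dot3.
Qed.

Lemma rho_ge0 p q : 0 <= rho p q.
Proof. exact: sqrtr_ge0. Qed.

Lemma measurable_post_half d (T : measurableType d) (f g k : T -> R3 R) :
  measurable_fun setT f -> measurable_fun setT g -> measurable_fun setT k ->
  measurable_fun setT (fun x => post_half (f x) (g x) (k x) : R3 R).
Proof.
move=> mf mg mk; apply: measurable_scale3; first exact: measurable_cst.
have mfg := measurable_add3 mf mg.
apply: measurable_add3; apply: measurable_scale3 => //; first exact: measurable_rho.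
apply: measurable_funM; first exact: measurable_dot3.
apply: measurable_invr; first by move=> x; rewrite !addr_ge0// ?norm3_ge0 ?rho_ge0.
by measurable_tac; [exact: measurable_norm3|exact: measurable_norm3|exact: measurable_rho].
Qed.

Lemma measurable_post_p d (T : measurableType d) (f g k : T -> R3 R) :
  measurable_fun setT f -> measurable_fun setT g -> measurable_fun setT k ->
  measurable_fun setT (fun x => post_p (f x) (g x) (k x) : R3 R).
Proof.
move=> mf mg mk; apply: measurable_add3; last exact: measurable_post_half.
by apply: measurable_scale3; [exact: measurable_cst|exact: measurable_add3].
Qed.

Lemma measurable_post_q d (T : measurableType d) (f g k : T -> R3 R) :
  measurable_fun setT f -> measurable_fun setT g -> measurable_fun setT k ->
  measurable_fun setT (fun x => post_q (f x) (g x) (k x) : R3 R).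
Proof.
move=> mf mg mk; apply: measurable_add3.
  by apply: measurable_scale3; [exact: measurable_cst|exact: measurable_add3].
by apply: measurable_opp3; exact: measurable_post_half.
Qed.

Lemma rho_hact h p q : rho (hact h p) (hact h q) = hnorm2 h * rho p q.
Proof.
rewrite /rho !norm3_hact dot3_hact.
have -> : 2 * (hnorm2 h * norm3 p * (hnorm2 h * norm3 q) - hnorm2 h ^+ 2 * dot3 p q)
  = hnorm2 h ^+ 2 * (2 * (norm3 p * norm3 q - dot3 p q)) by ring.
by rewrite sqrtrM ?sqr_ge0// sqrtr_sqr ger0_norm// hnorm2_ge0.
Qed.

Lemma direction_hact h (x : R3 R) : 0 < hnorm2 h ->
  direction (hact h x) = (hnorm2 h)^-1 *: hact h (direction x).
Proof.
move=> h0; rewrite /direction norm3_hact hactZ scalerA invfM.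
by rewrite mulrC.
Qed.

(** Momenta are scaled by [hnorm2 h], whereas a scattering vector on the unit sphere must remain
    there; hence the normalization of [hact h w], which keeps only the rotation in the
    similarity. *)
Lemma post_half_hact h p q w : 0 < hnorm2 h ->
  post_half (hact h p) (hact h q) ((hnorm2 h)^-1 *: hact h w) =
  hact h (post_half p q w).
Proof.
move=> h0; rewrite /post_half rho_hact !norm3_hact -!mulrDr -hactD dot3C dot3Z dot3C dot3_hact.
rewrite [in RHS]hactZ [in RHS]hactD ![in RHS]hactZ scalerA.
have hn : hnorm2 h != 0 by rewrite gt_eqF.
rewrite (_ : hnorm2 h * rho p q / hnorm2 h = rho p q); last by field.
congr (_ *: (_ + _ *: _)).
rewrite invfM.
rewrite (_ : (hnorm2 h)^-1 * (hnorm2 h ^+ 2 * dot3 (p + q) w) = hnorm2 h * dot3 (p + q) w).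
  by rewrite mulrACA divff// mul1r.
by field.
Qed.

Lemma post_p_hact h p q w : 0 < hnorm2 h ->
  post_p (hact h p) (hact h q) ((hnorm2 h)^-1 *: hact h w) = hact h (post_p p q w).
Proof. by move=> h0; rewrite /post_p post_half_hact// hactD hactZ hactD. Qed.

Let pair_eq3 p q : p.1.1 = q.1.1 -> p.1.2 = q.1.2 -> p.2 = q.2 -> p = q.
Proof. by case: p q => [[? ?] ?] [[? ?] ?] /= -> -> ->. Qed.

Lemma post_q_hact h p q w : 0 < hnorm2 h ->
  post_q (hact h p) (hact h q) ((hnorm2 h)^-1 *: hact h w) = hact h (post_q p q w).
Proof.
move=> h0; rewrite /post_q post_half_hact// hactD hactZ hactD.
congr (_ + _); apply: pair_eq3 => /=; rewrite /hact/=; ring.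
Qed.

(** The parameter on the sphere is first replaced by the direction of a vector of R^3, so that
    similarities act on all three arguments and [equivariant_nonsingular] applies;
    [sphere_null_cone] then returns to the surface measure. *)
Let nonsingular (F : R3 R -> R3 R -> R3 R -> R3 R) N :
  (forall d (T : measurableType d) (f g k : T -> R3 R),
    measurable_fun setT f -> measurable_fun setT g -> measurable_fun setT k ->
    measurable_fun setT (fun x => F (f x) (g x) (k x))) ->
  (forall h p q w, 0 < hnorm2 h ->
    F (hact h p) (hact h q) ((hnorm2 h)^-1 *: hact h w) = hact h (F p q w)) ->
  measurable N -> leb3 R N = 0%E ->
  {ae leb3 R, forall p, {ae (leb3 R \x sphere_measure R)%E, forall z,
     ~ (N `\ 0) (F p z.1 z.2)}}.
Proof.
move=> mF Fh mN N0.
pose G (z : R3 R * R3 R * R3 R) := F z.1.1 z.1.2 (direction z.2).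
have m0 : measurable [set (0 : R3 R)].
  have -> : [set (0 : R3 R)] = ([set 0%R] `*` [set 0%R]) `*` [set 0%R].
    by apply/seteqP; split => [z /= -> //|[[x y] z] /= [[-> ->] ->]].
  by apply: measurableX => //; apply: measurableX.
have mN0 : measurable (N `\ 0) by exact: measurableD.
have mG : measurable_fun setT G.
  apply: mF; [by measurable_tac|by measurable_tac|].
  by apply: (measurableT_comp (@measurable_direction R)); measurable_tac.
have mGN := measurable_preimage mG mN0.
have GN0 : leb9 R (G @^-1` (N `\ 0)) = 0%E.
  apply: equivariant_nonsingular => // h p q x h0.
  by rewrite /G/= direction_hact// Fh.
have /(_ mGN) [+ _] := @product_null_xsection _ _ _ _ R (leb6 R) (leb3 R) (G @^-1` (N `\ 0)).
move=> /(_ GN0) h.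
have mS p q : measurable ((fun w => F p q w) @^-1` (N `\ 0)).
  by apply: measurable_preimage => //; apply: mF; measurable_tac.
have {}h : {ae leb6 R, forall z, sphere_measure R ((fun w => F z.1 z.2 w) @^-1` (N `\ 0)) = 0%E}.
  apply: ae_imp h => -[p q] h; apply: sphere_null_cone => //.
  by rewrite -h; congr (leb3 R _); rewrite /xsection; apply/seteqP; split=> x /=; rewrite inE.
have := @ae_xsection _ _ _ _ R (leb3 R) (leb3 R) _ h.
apply: ae_imp => p hp.
pose U : set (R3 R * R3 R) := (fun z => F p z.1 z.2) @^-1` (N `\ 0).
have mU : measurable U by apply: measurable_preimage => //; apply: mF; measurable_tac.
exists U; split => //.
  apply/product_null_xsection => //; apply: ae_imp hp => q /= hq.
  by rewrite -hq; congr (sphere_measure R _); rewrite /xsection; apply/seteqP; split=> x /=; rewrite inE.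
by move=> z /= /contrapT.
Qed.

Lemma post_p_nonsingular N : measurable N -> leb3 R N = 0%E ->
  {ae leb3 R, forall p, {ae (leb3 R \x sphere_measure R)%E, forall z,
     ~ (N `\ 0) (post_p p z.1 z.2)}}.
Proof.
apply: nonsingular; last by move=> *; exact: post_p_hact.
by move=> *; exact: measurable_post_p.
Qed.

Lemma post_q_nonsingular N : measurable N -> leb3 R N = 0%E ->
  {ae leb3 R, forall p, {ae (leb3 R \x sphere_measure R)%E, forall z,
     ~ (N `\ 0) (post_q p z.1 z.2)}}.
Proof.
apply: nonsingular; last by move=> *; exact: post_q_hact.
by move=> *; exact: measurable_post_q.
Qed.

End post_momenta.

(** * Integrals of singular exponential weights *)

Section one_dimensional_integrals.
Variable R : realType.
Notation mR := (measurableTypeR R).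

Lemma ge0_integral_shift (a : R) (f : R -> \bar R) :
  measurable_fun [set: mR] f -> (forall x, 0 <= f x)%E ->
  (\int[leb1 R]_x f (x + a)%R = \int[leb1 R]_x f x)%E.
Proof.
move=> mf f0.
have ma : measurable_fun [set: mR] (fun x : mR => x + a : mR) by exact: measurable_funD.
have := @ge0_integral_pushforward _ _ mR mR _ _ ma (leb1 R) setT f measurableT.
rewrite preimage_setT /= => <-//.
by apply: eq_measure_integral => //= A mA _; rewrite /pushforward leb1_shift.
Qed.

Lemma ge0_integral_opp (f : R -> \bar R) :
  measurable_fun [set: mR] f -> (forall x, 0 <= f x)%E ->
  (\int[leb1 R]_x f (- x)%R = \int[leb1 R]_x f x)%E.
Proof.
move=> mf f0.
have ma : measurable_fun [set: mR] (fun x : mR => - x : mR) by measurable_tac.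
have := @ge0_integral_pushforward _ _ mR mR _ _ ma (leb1 R) setT f measurableT.
rewrite preimage_setT /= => <-//.
by apply: eq_measure_integral => //= A mA _; exact: lebesgue_measureN.
Qed.

Lemma measurable_powRT d (T : measurableType d) (s : R) (f : T -> R) :
  measurable_fun setT f -> measurable_fun setT (fun x => f x `^ s).
Proof. exact: (measurableT_comp (measurable_powR s)). Qed.

Lemma measurable_expRT d (T : measurableType d) (f : T -> R) :
  measurable_fun setT f -> measurable_fun setT (fun x => expR (f x)).
Proof. exact: (measurableT_comp (@measurable_expR R)). Qed.

Lemma measurable_normrT d (T : measurableType d) (f : T -> R) :
  measurable_fun setT f -> measurable_fun setT (fun x => `|f x|).
Proof. exact: (measurableT_comp (@normr_measurable R setT)). Qed.

Lemma integral_powR01 (s : R) : s < 1 ->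
  (\int[leb1 R]_(x in `]0%R, 1%R]) (x `^ (- s))%:E <= ((1 - s)^-1)%:E)%E.
Proof.
move=> s1.
have t0 : 0 < 1 - s by rewrite subr_gt0.
(* The lower ends start at 1/2 and not at 1, so that every interval is nondegenerate for the
   fundamental theorem of calculus. *)
pose F (n : nat) : set mR := `[n.+2%:R^-1, 1]%classic.
have UF : \bigcup_n F n = `]0%R, 1%R]%classic.
  apply/seteqP; split => x /=.
    case=> n _; rewrite /F/= !in_itv/= => /andP[nx ->]; rewrite andbT.
    by apply: lt_le_trans nx; rewrite invr_gt0.
  rewrite in_itv/= => /andP[x0 x1].
  exists (Num.trunc x^-1) => //; rewrite /F/= in_itv/= x1 andbT.
  rewrite -[leRHS]invrK lef_pV2 ?posrE ?invr_gt0//.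
  apply: ltW; apply: lt_le_trans (_ : (Num.trunc x^-1).+1%:R <= _).
    by rewrite Num.Theory.truncnS_gt.
  by rewrite ler_nat.
have mf : measurable_fun [set: mR] (fun x : mR => (x `^ (- s))%:E).
  by apply/measurable_EFinP; apply: measurable_powRT; exact: measurable_id.
rewrite -UF.
have := @ge0_nondecreasing_set_cvg_integral _ _ R F (fun x => (x `^ (- s))%:E) (leb1 R).
have ndF : nondecreasing_seq F.
  move=> m n mn; apply/subsetPset => x /=; rewrite /F/= !in_itv/= => /andP[mx ->].
  by rewrite andbT (le_trans _ mx)// lef_pV2 ?posrE// ler_nat.
move=> /(_ ndF) H.
have {}H := H (fun i => measurable_itv _) (fun i => measurable_funTS mf) (fun i x _ => powR_ge0 x (- s)).
rewrite -(cvg_lim _ H)//.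
apply: lime_le; first by apply/cvg_ex; eexists; exact: H.
apply: nearW => n.
have n0 : 0 < n.+2%:R^-1 :> R by rewrite invr_gt0.
have n1 : n.+2%:R^-1 < 1 :> R by rewrite invf_lt1// ltr1n.
pose G (x : R) := (1 - s)^-1 * x `^ (1 - s).
have dG (x : R) : 0 < x -> is_derive x 1 G (x `^ (- s)).
  move=> x0; have D := is_derive1_powR (1 - s) x0.
  rewrite (_ : x `^ (- s) = (1 - s)^-1 * ((1 - s) * x `^ (1 - s - 1))); first exact: is_deriveZ.
  by rewrite mulrA mulVf ?gt_eqF// mul1r; congr (_ `^ _); ring.
have cG (x : R) : 0 < x -> {for x, continuous G}.
  by move=> x0; apply: differentiable_continuous; apply/derivable1_diffP; have [] := dG x x0.
have cf (x : R) : 0 < x -> {for x, continuous (fun y : R => y `^ (- s))}.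
  move=> x0; apply: differentiable_continuous; apply/derivable1_diffP.
  by apply: derivable_powR; rewrite in_itv/= x0.
rewrite (@continuous_FTC2 R (fun x => x `^ (- s)) G)//.
- rewrite /G powR1 mulr1 -EFinB lee_fin gerBl mulr_ge0 ?powR_ge0// invr_ge0 ltW//.
- apply: continuous_in_subspaceT => x; rewrite inE/= in_itv/= => /andP[nx _].
  by apply: cf; exact: lt_le_trans nx.
- split.
  + by move=> x; rewrite in_itv/= => /andP[nx _]; have [] := dG x (lt_trans n0 nx).
  + by apply: cvg_at_right_filter; exact: cG.
  + by apply: cvg_at_left_filter; apply: cG.
- move=> x; rewrite in_itv/= => /andP[nx _].
  have [dx dv] := dG x (lt_trans n0 nx).
  by rewrite derive1E dv.
Qed.

Definition powR_exp (s k x : R) : R := `|x| `^ (- s) * expR (- k * `|x|).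

Lemma measurable_powR_exp s k : measurable_fun [set: mR] (powR_exp s k : mR -> mR).
Proof.
have m : measurable_fun [set: mR] (fun x : mR => `|x|).
  by apply: measurable_normrT; exact: measurable_id.
apply: measurable_funM; first exact: measurable_powRT.
by apply: measurable_expRT; measurable_tac.
Qed.

Lemma powR_exp_ge0 s k x : 0 <= powR_exp s k x.
Proof. by rewrite mulr_ge0 ?powR_ge0 ?expR_ge0. Qed.

(** On the positive half-line the majorant is x^(-s) on ]0, 1] plus a multiple of the exponential
    density; the other half-line is reached by reflection. *)
Lemma integral_powR_exp_lty (s k : R) : 0 <= s -> s < 1 -> 0 < k ->
  (\int[leb1 R]_x (powR_exp s k x)%:E < +oo)%E.
Proof.
move=> s0 s1 k0.
pose g1 (x : R) : \bar R := ((fun y => (y `^ (- s))%:E) \_ `]0%R, 1%R]) x.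
pose g2 (x : R) : \bar R := (k^-1 * exponential_pdf k x)%:E.
pose g x := (g1 x + g2 x)%E.
have g10 x : (0 <= g1 x)%E.
  by rewrite /g1 patchE; case: ifPn => // _; rewrite lee_fin powR_ge0.
have g20 x : (0 <= g2 x)%E.
  by rewrite lee_fin mulr_ge0 ?invr_ge0 ?exponential_pdf_ge0// ltW.
have g0 x : (0 <= g x)%E by rewrite adde_ge0.
have mg1 : measurable_fun [set: mR] g1.
  have mh : measurable_fun [set: mR] (fun y : mR => (y `^ (- s))%:E).
    by apply/measurable_EFinP; apply: measurable_powRT; exact: measurable_id.
  have := @measurable_restrictT _ _ mR (\bar R) `]0%R, 1%R]%classic (fun y : mR => (y `^ (- s))%:E) (measurable_itv _).
  by case=> + _; apply; exact: measurable_funTS mh.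
have mg2 : measurable_fun [set: mR] g2.
  apply/measurable_EFinP; apply: measurable_funM; first exact: measurable_cst.
  exact: measurable_exponential_pdf.
have mg : measurable_fun [set: mR] g by exact: emeasurable_funD.
have mgN : measurable_fun [set: mR] (fun x : mR => g (- x)).
  have mN : measurable_fun [set: mR] (fun x : mR => - x : mR) by measurable_tac.
  exact: (measurableT_comp mg mN).
apply: (@le_lt_trans _ _ (\int[leb1 R]_x (g x + g (- x)%R))%E).
  apply: ge0_le_integral => //.
  - by move=> x _; rewrite lee_fin powR_exp_ge0.
  - by apply/measurable_EFinP; exact: measurable_powR_exp.
  - exact: emeasurable_funD.
  - have pos (x : R) : 0 <= x -> ((powR_exp s k x)%:E <= g x)%E.
      move=> x0; rewrite /g /g1 /g2 /powR_exp (ger0_norm x0) exponential_pdfE// mulrA mulVf ?gt_eqF// mul1r.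
      rewrite patchE; case: ifPn => [|]; rewrite ?inE ?notin_setE/= in_itv/= => xI.
        rewrite -EFinD lee_fin ler_wpDr ?expR_ge0// ler_piMr ?powR_ge0//.
        by rewrite -expR0 ler_expR mulNr oppr_le0 mulr_ge0// ltW.
      rewrite add0e lee_fin ler_piMl ?expR_ge0//.
      have [->|xn0] := eqVneq x 0.
        by have [->|sn0] := eqVneq s 0; [rewrite oppr0 powRr0|rewrite powR0 ?oppr_eq0].
      have x1 : 1 <= x.
        rewrite leNgt; apply/negP => x1; apply: xI; rewrite lt_neqAle x0 eq_sym xn0/=.
        exact: ltW.
      by rewrite powRN invf_le1 ?powR_gt0// ?lt_neqAle ?x0 1?eq_sym ?xn0// -(powRr0 x) ler_powR.
    move=> x _; have [x0|x0] := leP 0 x.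
      by apply: (le_trans (pos _ x0)); rewrite leeDl.
    have -> : powR_exp s k x = powR_exp s k (- x) by rewrite /powR_exp normrN.
    by apply: le_trans (pos _ _) _; [rewrite oppr_ge0 ltW|rewrite leeDr].
rewrite ge0_integralD// (ge0_integral_opp mg)//.
suff H : (\int[leb1 R]_x g x < +oo)%E by rewrite lte_add_pinfty.
rewrite ge0_integralD//; apply: lte_add_pinfty.
  rewrite -integral_mkcond; apply: le_lt_trans (integral_powR01 s1) _.
  by rewrite ltry.
under eq_integral do rewrite /g2 EFinM.
rewrite ge0_integralZl//; last 3 first.
- by apply/measurable_EFinP; exact: measurable_exponential_pdf.
- by move=> x _; rewrite lee_fin exponential_pdf_ge0// ltW.
- by rewrite lee_fin invr_ge0 ltW.
have := integral_exponential_pdf k0; rewrite -[lebesgue_measure]/(leb1 R : set mR -> _) => ->.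
by rewrite mule1 ltry.
Qed.

End one_dimensional_integrals.

Section three_dimensional_integrals.
Variable R : realType.

Lemma ae_fst d1 d2 (T1 : measurableType d1) (T2 : measurableType d2)
    (m1 : {sigma_finite_measure set T1 -> \bar R})
    (m2 : {sigma_finite_measure set T2 -> \bar R}) (P : T1 -> Prop) :
  {ae m1, forall x, P x} -> {ae (m1 \x m2)%E, forall z, P z.1}.
Proof.
move=> [N [mN N0 PN]]; exists (N `*` setT); split.
- exact: measurableX.
- by transitivity (m1 N * m2 setT)%E; [exact: product_measure1E|rewrite N0 mul0e].
- by move=> z /= nP; split => //; exact: PN.
Qed.

Lemma ae_snd d1 d2 (T1 : measurableType d1) (T2 : measurableType d2)
    (m1 : {sigma_finite_measure set T1 -> \bar R})
    (m2 : {sigma_finite_measure set T2 -> \bar R}) (P : T2 -> Prop) :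
  {ae m2, forall x, P x} -> {ae (m1 \x m2)%E, forall z, P z.2}.
Proof.
move=> [N [mN N0 PN]]; exists (setT `*` N); split.
- exact: measurableX.
- by transitivity (m1 setT * m2 N)%E; [exact: product_measure1E|rewrite N0 mule0].
- by move=> z /= nP; split => //; exact: PN.
Qed.

Lemma integral_prodM d1 d2 (T1 : measurableType d1) (T2 : measurableType d2)
    (m1 : {sigma_finite_measure set T1 -> \bar R})
    (m2 : {sigma_finite_measure set T2 -> \bar R}) (f : T1 -> R) (g : T2 -> R) :
  measurable_fun setT f -> measurable_fun setT g ->
  (forall x, 0 <= f x) -> (forall y, 0 <= g y) ->
  (\int[(m1 \x m2)%E]_z (f z.1 * g z.2)%:E =
   \int[m1]_x (f x)%:E * \int[m2]_y (g y)%:E)%E.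
Proof.
move=> mf mg f0 g0.
have mf1 : measurable_fun setT (fun z : T1 * T2 => f z.1).
  by apply: (measurableT_comp mf); exact: measurable_fst.
have mg2 : measurable_fun setT (fun z : T1 * T2 => g z.2).
  by apply: (measurableT_comp mg); exact: measurable_snd.
rewrite fubini_tonelli1//=; last 2 first.
- by apply/measurable_EFinP; exact: measurable_funM.
- by move=> z; rewrite lee_fin mulr_ge0.
have mg' : measurable_fun setT (EFin \o g) by exact/measurable_EFinP.
have mf' : measurable_fun setT (EFin \o f) by exact/measurable_EFinP.
transitivity (\int[m1]_x ((f x)%:E * \int[m2]_y (g y)%:E))%E.
  apply: eq_integral => x _; rewrite /fubini_F/=.
  under eq_integral do rewrite EFinM.
  by rewrite ge0_integralZl ?lee_fin//; move=> y _; rewrite lee_fin.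
rewrite ge0_integralZr//; first by move=> x _; rewrite lee_fin.
by apply: integral_ge0 => y _; rewrite lee_fin.
Qed.

Definition powR_exp3 (s k : R) (q : R3 R) : R := norm3 q `^ (- s) * expR (- k * norm3 q).

Lemma powR_exp3_ge0 s k q : 0 <= powR_exp3 s k q.
Proof. by rewrite mulr_ge0 ?powR_ge0 ?expR_ge0. Qed.

Lemma measurable_powR_exp3 s k : measurable_fun setT (powR_exp3 s k).
Proof.
apply: measurable_funM; first by apply: measurable_powRT; exact: measurable_norm3.
by apply: measurable_expRT; apply: measurable_funM => //; exact: measurable_norm3.
Qed.

Let coord_le (x n : R) (s k : R) : 0 <= s -> 0 < k -> x != 0 -> `|x| <= n ->
  n `^ (- s) * expR (- k * n) <= powR_exp s k x.
Proof.
move=> s0 k0 x0 xn; have x0' : 0 < `|x| by rewrite normr_gt0.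
have n0 : 0 < n by exact: lt_le_trans xn.
rewrite /powR_exp ler_pM ?powR_ge0 ?expR_ge0//.
  by rewrite !powRN lef_pV2 ?posrE ?powR_gt0// ge0_ler_powR// ?nnegrE ltW.
by rewrite ler_expR !mulNr lerN2 ler_wpM2l// ltW.
Qed.

Lemma norm3_ge_coord (q : R3 R) :
  [/\ `|q.1.1| <= norm3 q, `|q.1.2| <= norm3 q & `|q.2| <= norm3 q].
Proof.
have H (x y z : R) : `|x| <= Num.sqrt (x * x + y * y + z * z).
  rewrite -sqrtr_sqr ler_wsqrtr// -!expr2 -addrA lerDl addr_ge0// sqr_ge0//.
case: q => [[x y] z]; rewrite /norm3 /dot3/=; split; first exact: H.
  by rewrite [x * x + _]addrC; exact: H.
by rewrite addrC addrA; exact: H.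
Qed.

(** The norm dominates each coordinate, so a third of the exponent and of the decay can be given to
    each of them: the weight lies below a product of three one-dimensional weights, and s < 3 makes
    each exponent less than 1. *)
Lemma integral_powR_exp3_lty (s k : R) : 0 <= s -> s < 3 -> 0 < k ->
  (\int[leb3 R]_q (powR_exp3 s k q)%:E < +oo)%E.
Proof.
move=> s0 s3 k0; pose g := powR_exp (s / 3) (k / 3).
have g0 x : 0 <= g x by exact: powR_exp_ge0.
have mg : measurable_fun setT (g : measurableTypeR R -> measurableTypeR R).
  exact: measurable_powR_exp.
have k3 : 0 < k / 3 by rewrite divr_gt0.
have s3' : 0 <= s / 3 by rewrite divr_ge0.
have gI : (\int[leb1 R]_x (g x)%:E < +oo)%E.
  by apply: integral_powR_exp_lty => //; rewrite ltr_pdivrMr// mul1r.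
have gI0 : (0 <= \int[leb1 R]_x (g x)%:E)%E.
  by apply: integral_ge0 => y _; rewrite lee_fin.
pose g2 (z : R2 R) := g z.1 * g z.2.
have mg2 : measurable_fun setT g2.
  apply: measurable_funM; apply: (measurableT_comp mg); [exact: measurable_fst|exact: measurable_snd].
have g20 z : 0 <= g2 z by rewrite mulr_ge0.
apply: (@le_lt_trans _ _ (\int[leb3 R]_q (g2 q.1 * g q.2)%:E)%E).
  apply: ae_ge0_le_integral => //.
  - by move=> q _; rewrite lee_fin powR_exp3_ge0.
  - by apply/measurable_EFinP; exact: measurable_powR_exp3.
  - by move=> q _; rewrite lee_fin mulr_ge0.
  - apply/measurable_EFinP; apply: measurable_funM.
      by apply: (measurableT_comp mg2); exact: measurable_fst.
    by apply: (measurableT_comp mg); exact: measurable_snd.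
  (* The coordinate planes are discarded because a negative power of base 0 is 0, so that the
     majorant may vanish there. *)
  - have ae1 : {ae leb1 R, forall x : measurableTypeR R, x != 0}.
      exists [set 0%R]; split => //; first exact: leb1_set1.
      by move=> x /= /negP; rewrite negbK => /eqP.
    have aeq : {ae leb3 R, forall q, (q.1.1 != 0 /\ q.1.2 != 0) /\ q.2 != 0}.
      apply: ae_and; last exact: (ae_snd (leb2 R) ae1).
      apply: (@ae_fst _ _ _ _ (leb2 R) (leb1 R) (fun z => z.1 != 0 /\ z.2 != 0)).
      by apply: ae_and; [exact: (ae_fst (leb1 R) ae1)|exact: (ae_snd (leb1 R) ae1)].
    apply: ae_imp aeq => q [[q1 q2] q3] _; rewrite lee_fin.
    have [c1 c2 c3] := norm3_ge_coord q.
    have n0 : 0 < norm3 q by apply: lt_le_trans c1; rewrite normr_gt0.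
    have -> : powR_exp3 s k q = (norm3 q `^ (- (s / 3)) * expR (- (k / 3) * norm3 q))
       * (norm3 q `^ (- (s / 3)) * expR (- (k / 3) * norm3 q))
       * (norm3 q `^ (- (s / 3)) * expR (- (k / 3) * norm3 q)).
      have E (A B : R) : A * B * (A * B) * (A * B) = (A * A * A) * (B * B * B) by ring.
      rewrite E -!expRD -!powRD ?(gt_eqF n0) ?implybT//.
      by congr (_ `^ _ * expR _); field.
    have p x : 0 <= norm3 q `^ x * expR (- (k / 3) * norm3 q).
      by rewrite mulr_ge0 ?powR_ge0 ?expR_ge0.
    have cl x : x != 0 -> `|x| <= norm3 q ->
        norm3 q `^ (- (s / 3)) * expR (- (k / 3) * norm3 q) <= g x.
      exact: coord_le.
    apply: ler_pM; [by rewrite mulr_ge0|exact: p| |exact: cl].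
    by apply: ler_pM; [exact: p|exact: p|exact: cl|exact: cl].
rewrite [X in (X < _)%E](@integral_prodM _ _ _ _ (leb2 R) (leb1 R) g2 g)//.
rewrite (@integral_prodM _ _ _ _ (leb1 R) (leb1 R) g g)//.
have If : (\int[leb1 R]_x (g x)%:E)%E \is a fin_num by rewrite ge0_fin_numE.
by rewrite -(fineK If) -!EFinM ltry.
Qed.

End three_dimensional_integrals.

(** * Integration over the sphere *)

Section sphere_integral.
Variable R : realType.
Import HBNNSimple.

Let mangles : measurable (@sphere_angles R).
Proof. by apply: measurableX; exact: measurable_itv. Qed.

Let msin : measurable_fun setT (fun a : R2 R => (sin a.1)%:E).
Proof. by apply/measurable_EFinP; measurable_tac. Qed.

Let sin_ge0 (a : R2 R) : sphere_angles a -> (0 <= (sin a.1)%:E)%E.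
Proof.
case=> /=; rewrite in_itv/= => /andP[a0 api] _.
by rewrite lee_fin sin_ge0_pi// a0.
Qed.

Let sphere_integral_nnsfun (h : {nnsfun R3 R >-> R}) :
  (\int[sphere_measure R]_w (h w)%:E =
   \int[leb2 R]_(a in @sphere_angles R) ((h (sphere_point a))%:E * (sin a.1)%:E))%E.
Proof.
have msp A : measurable A -> measurable (@sphere_point R @^-1` A).
  by move=> mA; apply: measurable_preimage => //; exact: measurable_sphere_point.
transitivity (\int[sphere_measure R]_w
   (\sum_(y \in range h) (y * \1_(h @^-1` [set y]) w)%:E))%E.
  by apply: eq_integral => t tE; rewrite /= fimfunE -fsumEFin.
rewrite ge0_integral_fsum//; last 2 first.
- by move=> y; apply/measurable_EFinP; apply: measurable_funM.
- by move=> m y Ey; exact: nnfun_muleindic_ge0.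
transitivity (\int[leb2 R]_(a in @sphere_angles R) (\sum_(y \in range h)
    (y * \1_(h @^-1` [set y]) (sphere_point a))%:E * (sin a.1)%:E))%E; last first.
  apply: eq_integral => a aE.
  rewrite -ge0_mule_fsuml => [|y]; last exact: nnfun_muleindic_ge0.
  by rewrite fsumEFin // -(fimfunE _ (sphere_point a)).
have mI y : measurable_fun setT (fun a : R2 R => (\1_(h @^-1` [set y]) (sphere_point a) : R)%:E).
  apply/measurable_EFinP.
  rewrite (_ : (fun _ => _) = \1_(@sphere_point R @^-1` (h @^-1` [set y]))) //.
  by apply: measurable_indic; apply: msp; exact: (measurable_funPTI h (measurable_set1 y)).
rewrite ge0_integral_fsum//; last 2 first.
- move=> y; apply: measurable_funTS; apply: emeasurable_funM => //.
  under eq_fun do rewrite EFinM.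
  by apply: emeasurable_funM.
- by move=> m y Ey; rewrite mule_ge0 ?sin_ge0// nnfun_muleindic_ge0.
apply: eq_fsbigr => r; rewrite inE => -[t _ <-].
under eq_integral do rewrite EFinM.
rewrite integralZl_indic_nnsfun => //.
under [RHS]eq_integral do rewrite EFinM -muleA.
rewrite ge0_integralZl//; last 3 first.
- by apply: measurable_funTS; apply: emeasurable_funM.
- by move=> a Ea; apply: mule_ge0; [rewrite lee_fin|exact: sin_ge0].
- by rewrite lee_fin.
congr (_ * _)%E; rewrite integral_indic// setIT.
transitivity (\int[leb2 R]_(a in @sphere_angles R `&` @sphere_point R @^-1` (h @^-1` [set h t])) (sin a.1)%:E)%E.
  by [].
rewrite integral_mkcondr.
apply: eq_integral => a _; rewrite patchE/= indicE.
rewrite (_ : (sphere_point a \in h @^-1` [set h t]) = (a \in @sphere_point R @^-1` (h @^-1` [set h t]))); last first.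
  by apply/idP/idP; rewrite !inE.
by case: ifP => _; rewrite ?mul1e ?mul0e.
Qed.

(** [sphere_measure] is known by its values on sets; the density formula is checked on simple
    functions and extended by monotone convergence, the area element being nonnegative on the
    angles. *)
Lemma sphere_integralE (f : R3 R -> \bar R) : measurable_fun setT f ->
  (forall w, 0 <= f w)%E ->
  (\int[sphere_measure R]_w f w =
   \int[leb2 R]_(a in @sphere_angles R) (f (sphere_point a) * (sin a.1)%:E))%E.
Proof.
move=> mf f0; pose h := nnsfun_approx measurableT mf.
have fE x : f x = lim ((EFin \o h n) x @[n --> \oo]).
  by apply/esym/cvg_lim => //; exact: cvg_nnsfun_approx.
have mh n : measurable_fun setT (EFin \o h n) by exact/measurable_EFinP.
have -> : (\int[sphere_measure R]_w f w =
    lim (\int[sphere_measure R]_w (EFin \o h n) w @[n --> \oo]))%E.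
  under eq_integral do rewrite fE.
  apply: monotone_convergence => //.
  - by move=> n x Ex //=; rewrite lee_fin.
  - by move=> x Ex a b ab; rewrite lee_fin; exact/lefP/nd_nnsfun_approx.
have -> : (\int[leb2 R]_(a in @sphere_angles R) (f (sphere_point a) * (sin a.1)%:E) =
    lim (\int[leb2 R]_(a in @sphere_angles R) ((h n (sphere_point a))%:E * (sin a.1)%:E) @[n --> \oo]))%E.
  have fg a : (f (sphere_point a) * (sin a.1)%:E = lim (((h n (sphere_point a))%:E * (sin a.1)%:E)%E @[n --> \oo]))%E.
    by apply/esym/cvg_lim => //; apply: cvgeZr => //; exact: cvg_nnsfun_approx.
  under eq_integral do rewrite fg.
  apply: monotone_convergence => //.
  - move=> n; apply: measurable_funTS; apply: emeasurable_funM => //.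
    exact: (measurableT_comp (mh n) (@measurable_sphere_point R)).
  - by move=> n x Ex /=; rewrite mule_ge0//; [rewrite lee_fin|exact: sin_ge0].
  - by move=> x Ex a b ab/=; rewrite lee_wpmul2r ?sin_ge0// lee_fin; exact/lefP/nd_nnsfun_approx.
by under eq_fun do rewrite sphere_integral_nnsfun.
Qed.

End sphere_integral.

Section sine_powers.
Variable R : realType.
Notation mR := (measurableTypeR R).

(** The cosine is at least 1/2 up to pi / 4. Beyond, sin y >= sin (pi / 4) >= 1/2, while y / 4 < 1/2
    since pi / 2 < 2. *)
Lemma sin_ge_quarter (y : R) : 0 <= y <= pi / 2 -> y / 4 <= sin y.
Proof.
move=> /andP[y0 ypi].
have p1 := pihalf_ge1 R; have p2 := pihalf_lt2 R.
have s4 : sin (pi / 4 : R) = cos (pi / 4).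
  have -> : pi / 4 = - (pi / 4) + pi / 2 :> R by field.
  by rewrite sinDpihalf cosN; congr cos; field.
have c4 : 1 / 2 <= cos (pi / 4 : R).
  have p4 : (pi / 4 : R) *+ 2 = pi / 2 by rewrite mulr2n; field.
  have c0 : 0 <= cos (pi / 4 : R) by apply: cos_ge0_pihalf; lra.
  have := cos_mulr2n (pi / 4 : R); rewrite p4 cos_pihalf => /esym/eqP.
  rewrite subr_eq0 mulr2n => /eqP h.
  by nra.
have [y4|y4] := leP y (pi / 4).
  have [->|yn0] := eqVneq y 0; first by rewrite sin0 mul0r.
  have y0' : 0 < y by rewrite lt_neqAle eq_sym yn0.
  have cs : {within `[0, y], continuous (@sin R)}.
    by apply: continuous_subspaceT; exact: continuous_sin.
  have [xi xi0y] := @MVT R (@sin R) (@cos R) 0 y y0' (fun x _ => is_derive_sin x) cs.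
  rewrite sin0 !subr0 => ->.
  have cx : 1 / 2 <= cos xi.
    apply: (le_trans c4); move: xi0y; rewrite in_itv/= => /andP[x0 xy].
    by apply: ltW; rewrite ltr_cos ?in_itv/=; [lra|apply/andP; split; lra|apply/andP; split; lra].
  by nra.
have : sin (pi / 4) <= sin y.
  by apply: ltW; rewrite ltr_sin ?in_itv/=; [lra|apply/andP; split; lra|apply/andP; split; lra].
rewrite s4; lra.
Qed.

Lemma sinDpin (n : nat) (x : R) : `|sin (x + n%:R * pi)| = `|sin x|.
Proof.
rewrite mulr_natl (alternatingn (@sinDpi R)) normrM normrX normrN1 expr1n mul1r//.
Qed.

(** One of the eleven multiples of pi from -5 pi to 5 pi lies within pi / 2 of [x]. The range 4 pi
    leaves room for the sum of an angle and a shift. *)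
Lemma norm_sin_lower (x : R) : `|x| <= 4 * pi ->
  exists2 j : 'I_11, `|x - (j%:R - 5) * pi| <= pi / 2 &
    `|x - (j%:R - 5) * pi| / 4 <= `|sin x|.
Proof.
move=> x4; have p0 := pi_gt0 R.
pose y := x + 5 * pi + pi / 2.
have y0 : 0 <= y / pi.
  by apply: divr_ge0; [move: x4; rewrite ler_norml /y => /andP[? ?]; lra|exact: ltW].
pose n := Num.truncn (y / pi).
have /andP[n1 n2] := Num.Theory.truncn_itv y0; rewrite -/n in n1 n2.
rewrite ler_pdivlMr// in n1; rewrite ltr_pdivrMr// in n2.
have n11 : (n < 11)%N.
  rewrite Num.Theory.truncn_lt_nat// ltr_pdivrMr//.
  by move: x4; rewrite ler_norml /y => /andP[? ?]; lra.
set j := Ordinal n11; have e : `|x - (n%:R - 5) * pi| <= pi / 2.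
  by rewrite ler_norml; apply/andP; split; move: n1 n2; rewrite /y -natr1; lra.
exists j => //=.
have -> : `|sin x| = `|sin (x - (n%:R - 5) * pi)|.
  by rewrite -(sinDpin n (x - _)) -(sinDpin 5 x); congr (`|sin _|); ring.
have : `|sin (x - (n%:R - 5) * pi)| = `|sin `|x - (n%:R - 5) * pi| |.
  by have [h|h] := ger0P (x - (n%:R - 5) * pi) => //; rewrite sinN normrN.
move=> ->; rewrite [X in _ <= X]ger0_norm; last first.
  by apply: sin_ge0_pi; rewrite normr_ge0/=; lra.
by apply: sin_ge_quarter; rewrite normr_ge0.
Qed.

(** One integrable spike at each zero of the sine in the range. Since the sum is integrable over the
    whole line, no shift changes its integral, which makes the spherical bounds uniform in the
    axis. *)
Definition sin_majorant (b x : R) : R :=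
  \sum_(j < 11) powR_exp b 1 (x - (j%:R - 5) * pi).

Lemma sin_majorant_ge0 b x : 0 <= sin_majorant b x.
Proof. by apply: sumr_ge0 => j _; exact: powR_exp_ge0. Qed.

Lemma measurable_sin_majorant b : measurable_fun setT (sin_majorant b : mR -> mR).
Proof.
apply: measurable_sum => j.
have m : measurable_fun setT (fun x : mR => x - (j%:R - 5) * pi : mR) by measurable_tac.
exact: (measurableT_comp (measurable_powR_exp b 1) m).
Qed.

Lemma powR_sin_le (b x : R) : 0 <= b -> `|x| <= 4 * pi -> sin x != 0 ->
  `|sin x| `^ (- b) <= 4 `^ b * expR (pi / 2) * sin_majorant b x.
Proof.
move=> b0 x4 sx0; have [j e1 e2] := norm_sin_lower x4.
set y := x - (j%:R - 5) * pi in e1 e2.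
have y0 : 0 < `|y|.
  rewrite normr_gt0; apply: contra_neq sx0 => yE.
  have -> : x = (j%:R - 5) * pi by apply/eqP; rewrite -subr_eq0 -/y yE.
  apply/eqP; rewrite -normr_eq0 -(sinDpin 5) -mulrDl subrK.
  by rewrite -[X in sin X]add0r sinDpin sin0 normr0.
have s0 : 0 < `|sin x| by rewrite normr_gt0.
apply: (@le_trans _ _ (4 `^ b * expR (pi / 2) * powR_exp b 1 y)); last first.
  rewrite ler_wpM2l ?mulr_ge0 ?powR_ge0 ?expR_ge0//.
  by rewrite /sin_majorant (bigD1 j)//= lerDl sumr_ge0// => i _; exact: powR_exp_ge0.
(* As |y| <= pi / 2, the factor [expR (pi / 2)] compensates the decay built into [powR_exp]. *)
have -> : 4 `^ b * expR (pi / 2) * powR_exp b 1 y =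
  (`|y| / 4) `^ (- b) * expR (pi / 2 - `|y|).
  have -> : (`|y| / 4) `^ (- b) = `|y| `^ (- b) * 4 `^ b.
    by rewrite powRM ?invr_ge0// -[4^-1]powR_inv1// -powRrM mulN1r opprK.
  by rewrite /powR_exp expRD mulN1r; ring.
apply: (@le_trans _ _ ((`|y| / 4) `^ (- b))).
  rewrite !powRN lef_pV2 ?posrE ?powR_gt0 ?divr_gt0//.
  by rewrite ge0_ler_powR ?nnegrE ?divr_ge0// ltW.
by rewrite ler_peMr ?powR_ge0//; rewrite -[X in X <= _]expR0 ler_expR subr_ge0.
Qed.

Lemma ae_sin_neq0 (c : R) :
  {ae leb1 R, forall x : mR, `|x + c| <= 4 * pi -> sin (x + c) != 0}.
Proof.
have H : {ae leb1 R, forall x : mR, forall n : nat, x != (n%:R - 5) * pi - c}.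
  apply: ae_nat => n; exists [set (n%:R - 5) * pi - c]; split => //; first exact: leb1_set1.
  by move=> x /= /negP; rewrite negbK => /eqP.
apply: ae_imp H => x H x4; apply/negP => /eqP s0.
have [j _] := norm_sin_lower x4; rewrite s0 normr0 => h.
have /eqP : `|x + c - (j%:R - 5) * pi| = 0.
  by apply/eqP; rewrite eq_le normr_ge0 andbT; move: h; rewrite ler_pdivrMr// mul0r.
rewrite normr_eq0 subr_eq0 => /eqP h'.
by move/eqP : (H j); apply; rewrite -h' addrK.
Qed.

Let powR_shift_fin (b a : R) : 0 <= b < 1 ->
  (\int[leb1 R]_x (powR_exp b 1 (x + a))%:E = \int[leb1 R]_x (powR_exp b 1 x)%:E)%E.
Proof.
move=> b01; apply: (@ge0_integral_shift R a (fun x => (powR_exp b 1 x)%:E)).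
  by apply/measurable_EFinP; exact: measurable_powR_exp.
by move=> x; rewrite lee_fin powR_exp_ge0.
Qed.

Lemma integral_sin_majorant_shift (b c : R) :
  (\int[leb1 R]_x (sin_majorant b (x + c))%:E =
   \int[leb1 R]_x (sin_majorant b x)%:E)%E.
Proof.
apply: (@ge0_integral_shift R c (fun x => (sin_majorant b x)%:E)).
  by apply/measurable_EFinP; exact: measurable_sin_majorant.
by move=> x; rewrite lee_fin sin_majorant_ge0.
Qed.

Lemma integral_sin_majorant_lty (b : R) : 0 <= b < 1 ->
  (\int[leb1 R]_x (sin_majorant b x)%:E < +oo)%E.
Proof.
move=> b01; rewrite /sin_majorant.
under eq_integral do rewrite -sumEFin.
rewrite ge0_integral_sum//; last 2 first.
- move=> j; apply/measurable_EFinP.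
  have m : measurable_fun setT (fun x : mR => x - (j%:R - 5) * pi : mR) by measurable_tac.
  exact: (measurableT_comp (measurable_powR_exp b 1) m).
- by move=> j x _; rewrite lee_fin powR_exp_ge0.
apply: lte_sum_pinfty => j _; rewrite powR_shift_fin//.
by case/andP: b01 => b0 b1; apply: integral_powR_exp_lty.
Qed.

End sine_powers.

Ltac le_ring := rewrite le_eqVlt; apply/orP; left; apply/eqP; ring.

Section sphere_bound.
Variable R : realType.

(** Bessel's inequality for the orthonormal pair (n1, n2, n3), (c, s, 0): the gap is the squared
    length of the part of the unit vector (a1, a2, a3) orthogonal to both. *)
Let bessel (a1 a2 a3 n1 n2 n3 c s : R) :
  a1 ^+ 2 + a2 ^+ 2 + a3 ^+ 2 = 1 -> n1 ^+ 2 + n2 ^+ 2 + n3 ^+ 2 = 1 ->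
  c ^+ 2 + s ^+ 2 = 1 -> n1 * c + n2 * s = 0 ->
  (a1 * c + a2 * s) ^+ 2 <= 1 - (n1 * a1 + n2 * a2 + n3 * a3) ^+ 2.
Proof.
move=> ea en ec e0.
set m := n1 * a1 + n2 * a2 + n3 * a3; set k := a1 * c + a2 * s.
rewrite -subr_ge0.
have -> : 1 - m ^+ 2 - k ^+ 2 = (a1 - m * n1 - k * c) ^+ 2 +
    (a2 - m * n2 - k * s) ^+ 2 + (a3 - m * n3) ^+ 2.
  transitivity ((a1 ^+ 2 + a2 ^+ 2 + a3 ^+ 2) + m ^+ 2 * (n1 ^+ 2 + n2 ^+ 2 + n3 ^+ 2)
    + k ^+ 2 * (c ^+ 2 + s ^+ 2) - 2 * m * (n1 * a1 + n2 * a2 + n3 * a3)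
    - 2 * k * (a1 * c + a2 * s) + 2 * m * k * (n1 * c + n2 * s)).
    by rewrite ea en ec e0 -/m -/k; ring.
  by ring.
by rewrite !addr_ge0// sqr_ge0.
Qed.

Let between_sqr (x l u : R) : l <= x -> x <= u -> x ^+ 2 <= l ^+ 2 \/ x ^+ 2 <= u ^+ 2.
Proof.
move=> lx xu; have [x0|x0] := leP 0 x.
  by right; rewrite ler_pXn2r// nnegrE (le_trans x0).
by left; rewrite -(sqrrN x) -(sqrrN l) ler_pXn2r ?nnegrE ?lerN2// oppr_ge0 ltW// (le_lt_trans lx).
Qed.

(* With [n] at polar angle [t], both factors of the majorant are integrable
   in one angle: the sine of the angle between [n] and [w] dominates the sines
   of [a.1 - t] or [a.1 + t], and also [sin a.1 * |sin (a.2 + c)|]. *)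
Lemma sphere_point_angle (n : R3 R) : norm3 n = 1 -> exists t c : R,
  [/\ 0 <= t <= pi, 0 <= c <= pi &
    forall a : R2 R, sphere_angles a ->
    [/\ sin (a.1 - t) ^+ 2 <= 1 - dot3 n (sphere_point a) ^+ 2 \/
        sin (a.1 + t) ^+ 2 <= 1 - dot3 n (sphere_point a) ^+ 2 &
        (sin a.1 * sin (a.2 + c)) ^+ 2 <= 1 - dot3 n (sphere_point a) ^+ 2]].
Proof.
move=> n1.
have en : n.1.1 ^+ 2 + n.1.2 ^+ 2 + n.2 ^+ 2 = 1.
  by rewrite -[RHS](expr1n _ 2) -n1 norm3_sqr /dot3 -!expr2.
case: n n1 en => [[x y] z] /= n1 en.
have [p1 p2] := (pihalf_ge1 R, pihalf_lt2 R).
have z1 : -1 <= z <= 1.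
  rewrite -ler_norml -(@ler_pXn2r _ 2)// ?nnegrE// expr1n real_normK ?num_real//.
  by rewrite -en lerDr addr_ge0// sqr_ge0.
have ct : cos (acos z) = z by rewrite acosK// in_itv.
have st : 0 <= sin (acos z) by rewrite sin_acos// sqrtr_ge0.
have st2 : sin (acos z) ^+ 2 = x ^+ 2 + y ^+ 2 by rewrite sin2cos2 ct -en; ring.
(* (cos u, sin u, 0) is a horizontal unit vector orthogonal to [n]; Bessel's inequality with it
   yields the bound by sin a.1 sin (a.2 + c), where c = pi / 2 - u. *)
have [u [u1 u2]] : exists u : R, -(pi / 2) <= u <= pi / 2 /\ x * cos u + y * sin u = 0.
  have [y0|y0] := eqVneq y 0.
    by exists (pi / 2); rewrite cos_pihalf y0 mulr0 mul0r add0r; split => //; lra.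
  exists (atan (- x / y)); split.
    by rewrite (ltW (atan_gtNpi2 _)) (ltW (atan_ltpi2 _)).
  have ca : cos (atan (- x / y)) != 0 by rewrite gt_eqF// cos_atan invr_gt0 sqrtr_gt0 ltr_pwDl// sqr_ge0.
  have := atanK (- x / y); rewrite /tan => /(congr1 (fun r => r * cos (atan (- x / y)))).
  by rewrite divfK// => ->; field.
exists (acos z), (pi / 2 - u); split.
- by rewrite acos_ge0// acos_lepi.
- by lra.
move=> [th ph]; rewrite /sphere_angles/= !in_itv/= => -[/andP[th0 thp] _].
have sth : 0 <= sin th by rewrite sin_ge0_pi// th0.
set w := sphere_point _; rewrite [dot3 _ w](_ : _ = sin th * (x * cos ph + y * sin ph) + z * cos th); last first.
  by rewrite /dot3/w/sphere_point/=; ring.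
split; last first.
  have -> : sin (ph + (pi / 2 - u)) = cos ph * cos u + sin ph * sin u.
    by rewrite -cosB addrCA addrC sinDpihalf.
  have -> : sin th * (cos ph * cos u + sin ph * sin u) =
    (sin th * cos ph) * cos u + (sin th * sin ph) * sin u by ring.
  have -> : sin th * (x * cos ph + y * sin ph) + z * cos th =
    x * (sin th * cos ph) + y * (sin th * sin ph) + z * cos th by ring.
  apply: bessel => //; last by rewrite cos2Dsin2.
  have := cos2Dsin2 th; have := cos2Dsin2 ph.
  by rewrite !exprMn -mulrDr => -> ; rewrite mulr1 addrC.
have mb : `|x * cos ph + y * sin ph| <= sin (acos z).
  rewrite -(@ler_pXn2r _ 2)// ?nnegrE// real_normK ?num_real// st2.
  have -> : x ^+ 2 + y ^+ 2 = (x * cos ph + y * sin ph) ^+ 2 + (x * sin ph - y * cos ph) ^+ 2.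
    transitivity ((x ^+ 2 + y ^+ 2) * (cos ph ^+ 2 + sin ph ^+ 2)); last by ring.
    by rewrite cos2Dsin2 mulr1.
  by rewrite lerDl sqr_ge0.
move: mb; rewrite ler_norml => /andP[m1 m2].
set m := x * cos ph + y * sin ph in m1 m2 *.
(* The inner product lies between the cosines of the sum and of the difference of the two polar
   angles, so its square is at most one of their squares. *)
have lo : cos (th + acos z) <= sin th * m + z * cos th.
  by rewrite cosD ct; nra.
have hi : sin th * m + z * cos th <= cos (th - acos z).
  by rewrite cosB ct; nra.
by case: (between_sqr lo hi) => h; [right|left]; rewrite sin2cos2 lerD2l lerN2.
Qed.

Let powRN_sqr_le (b s X : R) : 0 <= b -> s != 0 -> s ^+ 2 <= X ->
  X `^ (- (b / 2)) <= `|s| `^ (- b).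
Proof.
move=> b0 s0 sX; have s2 : 0 < s ^+ 2 by rewrite exprn_even_gt0.
have -> : `|s| `^ (- b) = (s ^+ 2) `^ (- (b / 2)).
  rewrite -(real_normK (num_real s)) -powR_mulrn// -powRrM; congr (_ `^ _).
  by field.
rewrite !powRN lef_pV2 ?posrE ?powR_gt0//; last exact: lt_le_trans sX.
by apply: ge0_ler_powR; rewrite ?nnegrE ?divr_ge0// ?(ltW s2)// (le_trans (ltW s2)).
Qed.

(** The constant must not depend on the axis [n], which will be the direction of p + q. Half of the
    singular power is bounded by a function of the polar angle and half by a function of the
    azimuth; this leaves a product of one-dimensional integrals. *)
Lemma sphere_integral_bound (b : R) : 0 <= b < 1 ->
  exists2 S : R, 0 <= S & forall (n : R3 R) (h : R3 R -> R) (C : R),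
    norm3 n = 1 -> measurable_fun setT h -> (forall w, 0 <= h w) -> 0 <= C ->
    (forall w, norm3 w = 1 -> 0 < 1 - dot3 n w ^+ 2 ->
      h w <= C * (1 - dot3 n w ^+ 2) `^ (- b)) ->
    (\int[sphere_measure R]_w (h w)%:E <= (C * S)%:E)%E.
Proof.
move=> b01; have /andP[b0 b1] := b01.
pose U := @sin_majorant R b.
have U0 x : 0 <= U x by exact: sin_majorant_ge0.
have IU c : (\int[leb1 R]_x (U (x + c))%:E = \int[leb1 R]_x (U x)%:E)%E.
  exact: integral_sin_majorant_shift.
have IUoo : (\int[leb1 R]_x (U x)%:E < +oo)%E by exact: integral_sin_majorant_lty.
have IU0 : (0 <= \int[leb1 R]_x (U x)%:E)%E.
  by apply: integral_ge0 => x _; rewrite lee_fin.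
have IUfin : (\int[leb1 R]_x (U x)%:E)%E \is a fin_num by rewrite ge0_fin_numE.
set I := (\int[leb1 R]_x (U x)%:E)%E in IU IUoo IU0 IUfin.
have mU c : measurable_fun setT (fun x : measurableTypeR R => U (x + c)).
  have m : measurable_fun setT (fun x : measurableTypeR R => x + c : measurableTypeR R) by measurable_tac.
  exact: (measurableT_comp (@measurable_sin_majorant R b) m).
pose K := 4 `^ b * expR (pi / 2 : R).
have K0 : 0 <= K by rewrite mulr_ge0 ?powR_ge0 ?expR_ge0.
exists (K ^+ 2 * (fine I + fine I) * fine I).
  by rewrite !mulr_ge0 ?sqr_ge0 ?addr_ge0 ?fine_ge0.
move=> n h C n1 mh h0 C0 hC; have [t [c [t0 c0 H]]] := sphere_point_angle n1.
rewrite sphere_integralE; last 2 first.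
- exact/measurable_EFinP.
- by move=> w; rewrite lee_fin.
pose f (x : measurableTypeR R) := C * K * (U (x + - t) + U (x + t)).
pose g (x : measurableTypeR R) := K * U (x + c).
have CK0 : 0 <= C * K by rewrite mulr_ge0.
have f0 x : 0 <= f x by rewrite mulr_ge0// addr_ge0.
have g0 x : 0 <= g x by rewrite mulr_ge0.
have mf : measurable_fun setT f by apply: measurable_funM => //; apply: measurable_funD.
have mg : measurable_fun setT g by exact: measurable_funM.
have mangles : measurable (@sphere_angles R) by apply: measurableX; exact: measurable_itv.
apply: (@le_trans _ _ (\int[leb2 R]_(a in @sphere_angles R) (f a.1 * g a.2)%:E)%E); last first.
  apply: (@le_trans _ _ (\int[leb2 R]_a (f a.1 * g a.2)%:E)%E).
    apply: ge0_subset_integral => //.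
    - apply/measurable_EFinP; apply: measurable_funM.
        exact: (measurableT_comp mf measurable_fst).
      exact: (measurableT_comp mg measurable_snd).
    - by move=> a _; rewrite lee_fin mulr_ge0.
  rewrite [leLHS](@integral_prodM _ _ _ _ _ (leb1 R) (leb1 R) f g)//.
  have -> : (\int[leb1 R]_x (f x)%:E = (C * K)%:E * (I + I))%E.
    rewrite /f; under eq_integral do rewrite EFinM EFinD.
    rewrite ge0_integralZl ?lee_fin//; last 2 first.
    - by apply: emeasurable_funD; apply/measurable_EFinP.
    - by move=> x _; rewrite adde_ge0// lee_fin.
    rewrite ge0_integralD ?IU//; try by move=> x _; rewrite lee_fin.
    - exact/measurable_EFinP.
    - exact/measurable_EFinP.
  have -> : (\int[leb1 R]_x (g x)%:E = K%:E * I)%E.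
    rewrite /g; under eq_integral do rewrite EFinM.
    rewrite ge0_integralZl ?IU ?lee_fin//; first exact/measurable_EFinP.
    by move=> x _; rewrite lee_fin.
  rewrite -(fineK IUfin) -EFinD -!EFinM lee_fin expr2.
  by le_ring.
have aes : {ae leb2 R, forall a : R2 R, ((`|a.1 + - t| <= 4 * pi -> sin (a.1 + - t) != 0) /\
    (`|a.1 + t| <= 4 * pi -> sin (a.1 + t) != 0)) /\ (`|a.2 + c| <= 4 * pi -> sin (a.2 + c) != 0)}.
  apply: ae_and; last exact: (ae_snd (leb1 R) (ae_sin_neq0 c)).
  by apply: ae_and; [exact: (ae_fst (leb1 R) (ae_sin_neq0 (- t)))|exact: (ae_fst (leb1 R) (ae_sin_neq0 t))].
apply: ae_ge0_le_integral => //.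
- move=> a [/=]; rewrite in_itv/= => /andP[h1 h2] _.
  by rewrite mule_ge0 ?lee_fin ?sin_ge0_pi// h1.
- apply: measurable_funTS; apply: emeasurable_funM; apply/measurable_EFinP; last by measurable_tac.
  by apply: (measurableT_comp mh); exact: measurable_sphere_point.
- by move=> a _; rewrite lee_fin mulr_ge0.
- apply: measurable_funTS; apply/measurable_EFinP; apply: measurable_funM.
    exact: (measurableT_comp mf measurable_fst).
  exact: (measurableT_comp mg measurable_snd).
have p0 := pi_gt0 R.
apply: ae_imp aes => -[th ph] /= [[s1 s2] s3] Sa.
have [A B] := H _ Sa.
move: (Sa); rewrite /sphere_angles/= !in_itv/= => -[/andP[th0 thp] /andP[ph0 php]].
have tb : `|th + - t| <= 4 * pi by rewrite ler_norml; lra.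
have tb' : `|th + t| <= 4 * pi by rewrite ler_norml; lra.
have pb : `|ph + c| <= 4 * pi by rewrite ler_norml; lra.
move: s1 s2 s3 => /(_ tb) s1 /(_ tb') s2 /(_ pb) s3.
have sth : 0 <= sin th by rewrite sin_ge0_pi// th0.
rewrite -EFinM lee_fin.
set X := 1 - _ in A B *.
have [->|sth0] := eqVneq (sin th) 0; first by rewrite mulr0 mulr_ge0.
have sthp : 0 < sin th by rewrite lt_neqAle eq_sym sth0.
have X0 : 0 < X by apply: lt_le_trans B; rewrite exprn_even_gt0// mulf_neq0.
apply: (@le_trans _ _ (C * X `^ (- b) * sin th)).
  by rewrite ler_wpM2r// hC// norm3_sphere_point.
have -> : X `^ (- b) = X `^ (- (b / 2)) * X `^ (- (b / 2)).
  by rewrite -powRD ?(gt_eqF X0) ?implybT//; congr (_ `^ _); field.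
have fA : C * X `^ (- (b / 2)) <= f th.
  have h' s : s != 0 -> s ^+ 2 <= X -> X `^ (- (b / 2)) <= `|s| `^ (- b).
    by move=> *; exact: powRN_sqr_le.
  rewrite /f -mulrA ler_wpM2l// mulrDr; case: A => A.
    apply: (le_trans (h' _ s1 A)); apply: (le_trans (powR_sin_le b0 tb s1)).
    by rewrite lerDl mulr_ge0.
  apply: (le_trans (h' _ s2 A)); apply: (le_trans (powR_sin_le b0 tb' s2)).
  by rewrite lerDr mulr_ge0.
rewrite mulrA -mulrA ler_pM ?powR_ge0 ?mulr_ge0 ?powR_ge0//.
(* The area element absorbs the power -b of sin a.1 that comes with the second factor, because 1 - b
   >= 0. *)
apply: (@le_trans _ _ (`|sin th * sin (ph + c)| `^ (- b) * sin th)).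
  by rewrite ler_wpM2r// powRN_sqr_le// mulf_neq0.
rewrite normrM powRM// (gtr0_norm sthp) mulrAC.
apply: (@le_trans _ _ (`|sin (ph + c)| `^ (- b))); last exact: powR_sin_le.
rewrite ler_piMl ?powR_ge0//.
rewrite -{2}(powRr1 sth) -powRD ?(gt_eqF sthp) ?implybT//.
rewrite -[X in _ <= X](powRr0 (sin th)) ger_powR ?sthp ?sin_le1//.
by rewrite addrC subr_ge0 ltW.
Qed.

End sphere_bound.

(** * Collision geometry and bounds on the collision kernel *)

Section collision_geometry.
Variable R : realType.
Implicit Types p q w : R3 R.

Lemma cauchy_schwarz3 p q : dot3 p q ^+ 2 <= dot3 p p * dot3 q q.
Proof.
rewrite -subr_ge0 [X in 0 <= X](_ : _ = (p.1.1 * q.1.2 - p.1.2 * q.1.1) ^+ 2 +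
  (p.1.1 * q.2 - p.2 * q.1.1) ^+ 2 + (p.1.2 * q.2 - p.2 * q.1.2) ^+ 2).
  by rewrite !addr_ge0// sqr_ge0.
by rewrite /dot3; ring.
Qed.

Lemma norm_dot3_le p q : `|dot3 p q| <= norm3 p * norm3 q.
Proof.
rewrite -(@ler_pXn2r _ 2)// ?nnegrE ?mulr_ge0 ?norm3_ge0//.
by rewrite real_normK ?num_real// exprMn !norm3_sqr cauchy_schwarz3.
Qed.

Lemma rho_sqr p q : rho p q ^+ 2 = 2 * (norm3 p * norm3 q - dot3 p q).
Proof.
rewrite sqr_sqrtr// mulr_ge0// subr_ge0.
by apply: le_trans (norm_dot3_le p q); exact: ler_norm.
Qed.

Lemma rho_sqr_le p q : rho p q ^+ 2 <= 4 * (norm3 p * norm3 q).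
Proof.
have := norm_dot3_le p q; rewrite ler_norml rho_sqr => /andP[h _]; lra.
Qed.

Lemma norm3D_sqr p q : norm3 (p + q) ^+ 2 = (norm3 p + norm3 q) ^+ 2 - rho p q ^+ 2.
Proof.
rewrite sqrrD !norm3_sqr rho_sqr dot3D ![dot3 _ (p + q)]dot3C !dot3D.
by rewrite (dot3C q p); ring.
Qed.

Lemma norm3_eq p (x : R) : 0 <= x -> dot3 p p = x ^+ 2 -> norm3 p = x.
Proof. by move=> x0 e; rewrite /norm3 e sqrtr_sqr ger0_norm. Qed.

Lemma dot3_unit_le p q w : norm3 w = 1 -> `|dot3 (p + q) w| <= norm3 p + norm3 q.
Proof.
move=> w1; apply: (le_trans (norm_dot3_le _ _)); rewrite w1 mulr1.
rewrite -(@ler_pXn2r _ 2)// ?nnegrE ?addr_ge0 ?norm3_ge0//.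
by rewrite norm3D_sqr gerBl sqr_ge0.
Qed.

(** For n = p + q, D = |p| + |q| + rho and k = n.w the vector is p' or q' according to the sign [e].
    The denominator D of the collision map is what makes its squared length a perfect square; energy
    conservation follows, as the two signs of k cancel. *)
Let dot3_post (n w : R3 R) (r k D e : R) : e = 1 \/ e = - 1 ->
  dot3 w w = 1 -> dot3 n w = k -> D != 0 -> dot3 n n = (D - r) ^+ 2 - r ^+ 2 ->
  let v := (2^-1 : R) *: n + e *: ((2^-1 : R) *: (r *: w + (k / D) *: n)) in
  dot3 v v = ((D - r + e * k) / 2) ^+ 2.
Proof.
move=> e1 w1 nw D0 nn /=.
have -> : dot3 ((2^-1 : R) *: n + e *: ((2^-1 : R) *: (r *: w + (k / D) *: n)))
    ((2^-1 : R) *: n + e *: ((2^-1 : R) *: (r *: w + (k / D) *: n))) =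
    4^-1 * (dot3 n n * (1 + e * (k / D)) ^+ 2 + e ^+ 2 * r ^+ 2 * dot3 w w
     + 2 * e * r * (1 + e * (k / D)) * dot3 n w).
  by rewrite /dot3 !(add3E, scale3E)/=; field.
rewrite w1 nw nn.
have e2 : e ^+ 2 = 1 by case: e1 => ->; ring.
have -> : (1 + e * (k / D)) ^+ 2 = 1 + 2 * e * (k / D) + e ^+ 2 * (k / D) ^+ 2 by ring.
have -> : ((D - r + e * k) / 2) ^+ 2 = 4^-1 * ((D - r) ^+ 2 + 2 * e * k * (D - r) + e ^+ 2 * k ^+ 2).
  by field.
have -> : 2 * e * r * (1 + e * (k / D)) * k = 2 * e * r * k + 2 * e ^+ 2 * r * (k / D) * k by ring.
by rewrite e2; field.
Qed.

Let rho0 p q : norm3 p + norm3 q + rho p q = 0 -> [/\ p = 0, q = 0 & rho p q = 0].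
Proof.
move=> /eqP; rewrite paddr_eq0 ?addr_ge0 ?norm3_ge0 ?rho_ge0//.
rewrite paddr_eq0 ?norm3_ge0// => /andP[/andP[/eqP p0 /eqP q0] /eqP ->].
by rewrite (norm3_eq0 p0) (norm3_eq0 q0).
Qed.

Lemma norm3_post p q w : norm3 w = 1 ->
  norm3 (post_p p q w) = (norm3 p + norm3 q + dot3 (p + q) w) / 2 /\
  norm3 (post_q p q w) = (norm3 p + norm3 q - dot3 (p + q) w) / 2.
Proof.
move=> w1; have w1' : dot3 w w = 1 by rewrite -norm3_sqr w1 expr1n.
have := dot3_unit_le p q w1; rewrite ler_norml => /andP[k1 k2].
have [D0|D0] := eqVneq (norm3 p + norm3 q + rho p q) 0.
  have [-> -> r0] := rho0 D0; rewrite /post_p /post_q /post_half r0.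
  have z : dot3 (0 + 0 : R3 R) w = 0 by rewrite /dot3/= !addr0 !mul0r !addr0.
  rewrite z !addr0 !scaler0 ?mul0r ?scale0r ?addr0 ?scaler0 ?subr0 ?addr0 norm30.
  by rewrite !addr0 ?subr0 mul0r.
have nn : dot3 (p + q) (p + q) = (norm3 p + norm3 q + rho p q - rho p q) ^+ 2 - rho p q ^+ 2.
  by rewrite -norm3_sqr norm3D_sqr addrK.
split; apply: norm3_eq; rewrite ?divr_ge0//; [lra|idtac|lra|idtac].
  have := dot3_post (or_introl erefl) w1' erefl D0 nn.
  by rewrite /= scale1r mul1r addrK => <-.
have := dot3_post (or_intror erefl) w1' erefl D0 nn.
by rewrite /= scaleN1r mulN1r addrK => <-.
Qed.

Lemma exists_axis (n : R3 R) : exists2 u : R3 R, norm3 u = 1 & n = norm3 n *: u.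
Proof.
have [->|n0] := eqVneq n 0.
  exists ((1, 0), 0); last by rewrite norm30 scale0r.
  by rewrite /norm3 /dot3/= !mulr0 mulr1 !addr0 sqrtr1.
exists (direction n).
  rewrite /direction norm3Z normfV ger0_norm ?norm3_ge0// mulVf// gt_eqF//.
  exact: norm3_gt0.
by rewrite /direction scalerA divff ?scale1r// gt_eqF// norm3_gt0.
Qed.

(** E, P and c stand for |p| + |q|, |p + q| and the cosine between p + q and w. The product is (E^2
    - P^2 c^2) / 4, bounded below through c^2 <= 1 or through P <= E. For the single factors, 1 -
    c^2 = (1 - |c|) (1 + |c|) <= 2 (1 - |c|). *)
Let product_bounds (E P r c k : R) : 0 <= P -> P ^+ 2 = E ^+ 2 - r ^+ 2 -> k = P * c ->
  0 <= 1 - c ^+ 2 -> 0 <= E ->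
  [/\ r ^+ 2 / 4 <= (E + k) / 2 * ((E - k) / 2),
      E ^+ 2 * (1 - c ^+ 2) / 4 <= (E + k) / 2 * ((E - k) / 2),
      E * (1 - c ^+ 2) / 4 <= (E + k) / 2 & E * (1 - c ^+ 2) / 4 <= (E - k) / 2].
Proof.
move=> P0 PE kE c1 E0.
have c2 : c ^+ 2 <= 1 by rewrite -subr_ge0.
have c3 : `|c| <= 1 by rewrite -(@ler_pXn2r _ 2)// ?nnegrE// expr1n real_normK ?num_real.
have PE' : P <= E by rewrite -(@ler_pXn2r _ 2)// ?nnegrE// PE gerBl sqr_ge0.
have e : (E + k) / 2 * ((E - k) / 2) = (E ^+ 2 - P ^+ 2 * c ^+ 2) / 4 by rewrite kE; field.
have P2 : P ^+ 2 <= E ^+ 2 by rewrite PE gerBl sqr_ge0.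
move: c3; rewrite ler_norml => /andP[c4 c5].
have Pk : P * (1 - c ^+ 2) <= E * (1 - c ^+ 2) by rewrite ler_wpM2r.
split.
- rewrite e ler_wpM2r// PE; have := sqr_ge0 r; have := sqr_ge0 P; rewrite PE; nra.
- by rewrite e ler_wpM2r//; nra.
- have h1 : 0 <= E * (1 + c) ^+ 2 by rewrite mulr_ge0// sqr_ge0.
  have [h|h] := leP 0 c; rewrite kE.
    have h2 : 0 <= P * c by rewrite mulr_ge0.
    have h3 : 0 <= E * c ^+ 2 by rewrite mulr_ge0// sqr_ge0.
    by lra.
  have h2 : E * c <= P * c by rewrite ler_wnM2r// ltW.
  by lra.
- have h1 : 0 <= E * (1 - c) ^+ 2 by rewrite mulr_ge0// sqr_ge0.
  have [h|h] := leP 0 c; rewrite kE.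
    have h2 : P * c <= E * c by rewrite ler_wpM2r.
    by lra.
  have h2 : P * c <= 0 by rewrite mulr_ge0_le0// ltW.
  have h3 : 0 <= E * c ^+ 2 by rewrite mulr_ge0// sqr_ge0.
  by lra.
Qed.

Lemma post_momenta_bounds p q w u : norm3 w = 1 -> norm3 u = 1 ->
  p + q = norm3 (p + q) *: u ->
  let E := norm3 p + norm3 q in let s := 1 - dot3 u w ^+ 2 in
  let x := norm3 (post_p p q w) in let y := norm3 (post_q p q w) in
  [/\ rho p q ^+ 2 / 4 <= x * y, E ^+ 2 * s / 4 <= x * y,
      E * s / 4 <= x, E * s / 4 <= y & x + y = E].
Proof.
move=> w1 u1 nu /=; have [-> ->] := norm3_post p q w1.
have k : dot3 (p + q) w = norm3 (p + q) * dot3 u w by rewrite {1}nu dot3Z.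
have c1 : 0 <= 1 - dot3 u w ^+ 2.
  have := cauchy_schwarz3 u w.
  by rewrite -!norm3_sqr w1 u1 !expr1n mulr1 subr_ge0.
have [] := product_bounds (norm3_ge0 (p + q)) (norm3D_sqr p q) k c1
  (addr_ge0 (norm3_ge0 p) (norm3_ge0 q)).
by move=> *; split => //; field.
Qed.

End collision_geometry.

Section kernel_bounds.
Variable R : realType.
Variable b : R.
Hypotheses (b0 : 0 < b) (b1 : b < 1).
Ltac lra_b := move: (b0) (b1) => ? ?; lra.
Implicit Types p q w : R3 R.

Definition kern p q : R := rho p q `^ (2 - b) / (norm3 p * norm3 q).

Lemma kern_ge0 p q : 0 <= kern p q.
Proof. by rewrite divr_ge0 ?powR_ge0// mulr_ge0// norm3_ge0. Qed.

Lemma measurable_kern d (T : measurableType d) (f g : T -> R3 R) :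
  measurable_fun setT f -> measurable_fun setT g ->
  measurable_fun setT (fun x => kern (f x) (g x)).
Proof.
move=> mf mg; apply: measurable_funM.
  by apply: measurable_powRT; exact: measurable_rho.
apply: measurable_invr; first by move=> x; rewrite mulr_ge0 ?norm3_ge0.
by apply: measurable_funM; exact: measurable_norm3.
Qed.

Lemma kern_eq0 p q : [\/ norm3 p = 0, norm3 q = 0 | rho p q = 0] -> kern p q = 0.
Proof.
rewrite /kern => -[->|->|->]; rewrite ?mul0r ?mulr0 ?invr0 ?mulr0//.
by rewrite powR0 ?mul0r// gt_eqF// subr_gt0; lra_b.
Qed.

Lemma powRN_le (s x y : R) : 0 <= s -> 0 < x -> x <= y -> y `^ (- s) <= x `^ (- s).
Proof.
move=> s0 x0 xy; have y0 : 0 < y by exact: lt_le_trans xy.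
rewrite !powRN lef_pV2 ?posrE ?powR_gt0//.
by rewrite ge0_ler_powR// ?nnegrE ltW.
Qed.

(** The negative powers of x and y are split in three. The part (x y)^(-(1 - b/2)) cancels r^(2 - b)
    by the first bound; (x y)^(-b/2) gives (a + c)^(-b) s^(-b/2); the rest gives (a + c)^(-(b1' +
    b2')) s^(-b/2). Finally a + c is weakened to c in the second part, which will be integrated over
    q, and to a in the third, which stays as a weight in p. *)
Let gain_scalar (b1' b2' a c r s x y : R) : 0 <= b1' -> 0 <= b2' -> b1' + b2' <= b / 2 ->
  0 < a -> 0 < c -> 0 < r -> 0 < s -> s <= 1 -> 0 <= x -> 0 <= y ->
  r ^+ 2 / 4 <= x * y -> (a + c) ^+ 2 * s / 4 <= x * y ->
  (a + c) * s / 4 <= x -> (a + c) * s / 4 <= y ->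
  r `^ (2 - b) / (a * c) * (x `^ (- (1 + b1')) * y `^ (- (1 + b2'))) <=
  16 * (a `^ (- (1 + (b1' + b2'))) * c `^ (- (1 + b))) * s `^ (- b).
Proof.
move=> B1 B2 B a0 c0 r0 s0 s1 x0 y0 xy1 xy2 xs ys.
have E0 : 0 < a + c by rewrite addr_gt0.
have Es : 0 < (a + c) * s / 4 by rewrite divr_gt0// mulr_gt0.
have {}x0 : 0 < x by exact: lt_le_trans xs.
have {}y0 : 0 < y by exact: lt_le_trans ys.
have xy0 : 0 < x * y by rewrite mulr_gt0.
have pD (z u v : R) : 0 < z -> z `^ (u + v) = z `^ u * z `^ v.
  by move=> z0; rewrite powRD// (gt_eqF z0) implybT.
have pM (z u v : R) : 0 < z -> 0 < u -> (z * u) `^ v = z `^ v * u `^ v.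
  by move=> *; rewrite powRM// ltW.
have -> : x `^ (- (1 + b1')) * y `^ (- (1 + b2')) =
   (x * y) `^ (- (1 - b / 2)) * (x * y) `^ (- (b / 2)) * (x `^ (- b1') * y `^ (- b2')).
  rewrite -(pD (x * y))// (_ : - (1 - b / 2) + - (b / 2) = -1); last by field.
  by rewrite !opprD !pD// pM//; ring.
have e1 : (x * y) `^ (- (1 - b / 2)) <= 4 `^ (1 - b / 2) * r `^ (- (2 - b)).
  apply: le_trans (powRN_le _ _ xy1) _; [lra_b|by rewrite divr_gt0// exprn_gt0|].
  rewrite pM ?exprn_gt0 ?invr_gt0// -[4^-1]powR_inv1// -powRrM mulN1r opprK mulrC.
  rewrite -powR_mulrn ?(ltW r0)// -powRrM (_ : 2%:R * _ = - (2 - b))//; by field.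
have e2 : (x * y) `^ (- (b / 2)) <= 4 `^ (b / 2) * (a + c) `^ (- b) * s `^ (- (b / 2)).
  apply: le_trans (powRN_le _ _ xy2) _; [lra_b|by rewrite divr_gt0// mulr_gt0// exprn_gt0|].
  rewrite pM ?mulr_gt0 ?exprn_gt0 ?invr_gt0// -[4^-1]powR_inv1// -powRrM mulN1r opprK mulrC.
  rewrite pM ?exprn_gt0// mulrA -powR_mulrn ?(ltW E0)// -powRrM (_ : 2%:R * _ = - b)//; by field.
have e3 : x `^ (- b1') * y `^ (- b2') <= 4 `^ (b1' + b2') * (a + c) `^ (- (b1' + b2')) * s `^ (- (b / 2)).
  apply: (@le_trans _ _ (((a + c) * s / 4) `^ (- (b1' + b2')))).
    by rewrite opprD pD// ler_pM ?powR_ge0// powRN_le.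
  rewrite pM ?mulr_gt0 ?invr_gt0// -[4^-1]powR_inv1// -powRrM mulN1r opprK mulrC pM// mulrA.
  rewrite ler_wpM2l ?mulr_ge0 ?powR_ge0// ger_powR ?s0//; lra_b.
have E1 : (a + c) `^ (- b) <= c `^ (- b) by apply: powRN_le; lra_b.
have E2 : (a + c) `^ (- (b1' + b2')) <= a `^ (- (b1' + b2')) by apply: powRN_le; lra_b.
(* The powers of 4 multiply to 4^(1 + b1' + b2'), and b1' + b2' <= b / 2 < 1. *)
have four : 4 `^ (1 - b / 2) * 4 `^ (b / 2) * 4 `^ (b1' + b2') <= 16 :> R.
  rewrite -!pD// (_ : 16 = 4 `^ 2%:R); last by rewrite powR_mulrn//; ring.
  by apply: ler_powR; lra_b.
have e4 := ler_pM (mulr_ge0 (powR_ge0 _ _) (powR_ge0 _ _)) (mulr_ge0 (powR_ge0 x _) (powR_ge0 y _))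
  (ler_pM (powR_ge0 _ _) (powR_ge0 _ _) e1 e2) e3.
apply: (le_trans (ler_wpM2l _ e4)).
  by rewrite divr_ge0 ?powR_ge0 ?mulr_ge0// ltW.
have -> : r `^ (2 - b) / (a * c) *
  (4 `^ (1 - b / 2) * r `^ (- (2 - b)) * (4 `^ (b / 2) * (a + c) `^ (- b) * s `^ (- (b / 2))) *
   (4 `^ (b1' + b2') * (a + c) `^ (- (b1' + b2')) * s `^ (- (b / 2)))) =
  (4 `^ (1 - b / 2) * 4 `^ (b / 2) * 4 `^ (b1' + b2')) *
  ((a * c)^-1 * ((a + c) `^ (- (b1' + b2')) * (a + c) `^ (- b))) *
  ((r `^ (2 - b) * r `^ (- (2 - b))) * (s `^ (- (b / 2)) * s `^ (- (b / 2)))) by ring.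
rewrite -(pD r)// subrr powRr0 mul1r -(pD s)// (_ : - (b / 2) + - (b / 2) = - b); last by field.
rewrite ler_wpM2r ?powR_ge0//.
have -> : a `^ (- (1 + (b1' + b2'))) * c `^ (- (1 + b)) =
  (a * c)^-1 * (a `^ (- (b1' + b2')) * c `^ (- b)).
  have eD (z u : R) : 0 < z -> z `^ (- (1 + u)) = z^-1 * z `^ (- u).
    by move=> z0; rewrite opprD pD// powR_inv1// ltW.
  by rewrite !eD// invfM; ring.
have ac0 : 0 <= (a * c)^-1 by rewrite invr_ge0 mulr_ge0// ltW.
by rewrite ler_pM ?mulr_ge0 ?powR_ge0// ler_wpM2l// ler_pM ?powR_ge0.
Qed.

(** Energy conservation makes the product of the exponentials invariant, so only the powers matter.
    In degenerate configurations the kernel itself is 0, since division by 0 gives 0. *)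
Lemma gain_kernel_le (b1' b2' k : R) p q w u : 0 <= b1' -> 0 <= b2' -> b1' + b2' <= b / 2 ->
  norm3 w = 1 -> norm3 u = 1 -> p + q = norm3 (p + q) *: u -> 0 < 1 - dot3 u w ^+ 2 ->
  kern p q * (powR_exp3 (1 + b1') k (post_p p q w) * powR_exp3 (1 + b2') k (post_q p q w)) <=
  16 * (powR_exp3 (1 + (b1' + b2')) k p * powR_exp3 (1 + b) k q) * (1 - dot3 u w ^+ 2) `^ (- b).
Proof.
move=> B1 B2 B w1 u1 nu s0.
have rhs0 : 0 <= 16 * (powR_exp3 (1 + (b1' + b2')) k p * powR_exp3 (1 + b) k q) *
    (1 - dot3 u w ^+ 2) `^ (- b).
  by rewrite !mulr_ge0 ?powR_exp3_ge0 ?powR_ge0.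
have [a0|a0] := eqVneq (norm3 p) 0; first by rewrite kern_eq0 ?mul0r//; constructor 1.
have [c0|c0] := eqVneq (norm3 q) 0; first by rewrite kern_eq0 ?mul0r//; constructor 2.
have [r0|r0] := eqVneq (rho p q) 0; first by rewrite kern_eq0 ?mul0r//; constructor 3.
have pos (x : R) : 0 <= x -> x != 0 -> 0 < x by move=> ? ?; rewrite lt_neqAle eq_sym; apply/andP.
have [h1 h2 h3 h4 h5] := post_momenta_bounds w1 u1 nu.
have s1 : 1 - dot3 u w ^+ 2 <= 1 by rewrite gerBl sqr_ge0.
have H := gain_scalar B1 B2 B (pos _ (norm3_ge0 p) a0) (pos _ (norm3_ge0 q) c0)
  (pos _ (rho_ge0 p q) r0) s0 s1 (norm3_ge0 _) (norm3_ge0 _) h1 h2 h3 h4.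
have e : expR (- k * norm3 (post_p p q w)) * expR (- k * norm3 (post_q p q w)) =
   expR (- k * norm3 p) * expR (- k * norm3 q).
  by rewrite -!expRD -!mulrDr h5.
rewrite /powR_exp3 /kern.
set A := norm3 (post_p p q w) `^ _ in H *; set C := norm3 (post_q p q w) `^ _ in H *.
set ep := expR (- k * norm3 (post_p p q w)) in e *.
set eq := expR (- k * norm3 (post_q p q w)) in e *.
set K := rho p q `^ (2 - b) / (norm3 p * norm3 q) in H *.
have -> : K * (A * ep * (C * eq)) = (ep * eq) * (K * (A * C)) by ring.
rewrite e.
set P := norm3 p `^ _ in H *; set Q := norm3 q `^ _ in H *; set S := _ `^ (- b) in H *.
have -> : 16 * (P * expR (- k * norm3 p) * (Q * expR (- k * norm3 q))) * S =
  (expR (- k * norm3 p) * expR (- k * norm3 q)) * (16 * (P * Q) * S) by ring.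
by rewrite ler_wpM2l// mulr_ge0 ?expR_ge0.
Qed.

(** From rho^2 <= 4 |p| |q| the kernel is at most 4 (|p| |q|)^(-b/2); the power of |q| joins the
    weight. *)
Lemma loss_kernel_le (s k : R) p q :
  kern p q * powR_exp3 s k q <= 4 * norm3 p `^ (- (b / 2)) * powR_exp3 (s + b / 2) k q.
Proof.
have rhs0 : 0 <= 4 * norm3 p `^ (- (b / 2)) * powR_exp3 (s + b / 2) k q.
  by rewrite !mulr_ge0 ?powR_exp3_ge0 ?powR_ge0.
have [a0|a0] := eqVneq (norm3 p) 0; first by rewrite kern_eq0 ?mul0r//; constructor 1.
have [c0|c0] := eqVneq (norm3 q) 0; first by rewrite kern_eq0 ?mul0r//; constructor 2.
have pos (x : R) : 0 <= x -> x != 0 -> 0 < x by move=> ? ?; rewrite lt_neqAle eq_sym; apply/andP.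
have {}a0 := pos _ (norm3_ge0 p) a0; have {}c0 := pos _ (norm3_ge0 q) c0.
have rle := rho_sqr_le p q; have r0 := rho_ge0 p q.
rewrite /powR_exp3 mulrA mulrA ler_wpM2r ?expR_ge0//.
have kle : kern p q <= 4 * (norm3 p `^ (- (b / 2)) * norm3 q `^ (- (b / 2))).
  rewrite /kern ler_pdivrMr ?mulr_gt0//.
  have -> : rho p q `^ (2 - b) = (rho p q ^+ 2) `^ (1 - b / 2).
    by rewrite -powR_mulrn// -powRrM; congr (_ `^ _); field.
  apply: (@le_trans _ _ ((4 * (norm3 p * norm3 q)) `^ (1 - b / 2))).
    by apply: ge0_ler_powR; rewrite ?nnegrE ?sqr_ge0 ?mulr_ge0 ?(ltW a0) ?(ltW c0)//; lra_b.
  have ac : 0 < norm3 p * norm3 q by rewrite mulr_gt0.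
  rewrite -powRM ?(ltW a0) ?(ltW c0)//.
  have eac : (norm3 p * norm3 q) `^ (1 - b / 2) = (norm3 p * norm3 q) `^ (- (b / 2)) * (norm3 p * norm3 q).
    by rewrite -[X in _ = _ * X]powRr1 ?(ltW ac)// -powRD ?(gt_eqF ac) ?implybT// addrC.
  rewrite (powRM _ (ler0n _ 4) (ltW ac)) -mulrA -eac ler_wpM2r ?powR_ge0//.
  rewrite -[X in _ <= X]powRr1// ler_powR//; lra_b.
apply: (le_trans (ler_wpM2r (powR_ge0 _ _) kle)).
have -> : norm3 q `^ (- (s + b / 2)) = norm3 q `^ (- s) * norm3 q `^ (- (b / 2)).
  by rewrite opprD powRD// (gt_eqF c0) implybT.
by le_ring.
Qed.

Notation mu := (leb3 R \x sphere_measure R)%E.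

Lemma measurable_post_pz p : measurable_fun setT (fun z : R3 R * R3 R => post_p p z.1 z.2).
Proof. by apply: measurable_post_p; measurable_tac. Qed.

Lemma measurable_post_qz p : measurable_fun setT (fun z : R3 R * R3 R => post_q p z.1 z.2).
Proof. by apply: measurable_post_q; measurable_tac. Qed.

Lemma measurable_kernz p : measurable_fun setT (fun z : R3 R * R3 R => kern p z.1).
Proof. by apply: measurable_kern; measurable_tac. Qed.

(** For each [q] the sphere is integrated first, with the direction of p + q as axis. Uniformity of
    [sphere_integral_bound] in the axis leaves an integral over [q] that no longer depends on
    [p]. *)
Lemma gain_integral_le (b1' b2' k : R) : 0 <= b1' -> 0 <= b2' -> b1' + b2' <= b / 2 -> 0 < k ->
  exists2 K : R, 0 <= K & forall p,
  (\int[mu]_z (kern p z.1 * (powR_exp3 (1 + b1') k (post_p p z.1 z.2) *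
     powR_exp3 (1 + b2') k (post_q p z.1 z.2)))%:E <=
   (K * powR_exp3 (1 + (b1' + b2')) k p)%:E)%E.
Proof.
move=> B1 B2 B k0.
have [S S0 HS] := @sphere_integral_bound R b ltac:(by rewrite ltW).
have Ioo : (\int[leb3 R]_q (powR_exp3 (1 + b) k q)%:E < +oo)%E.
  by apply: integral_powR_exp3_lty => //; [rewrite addr_ge0// ltW|lra_b].
have I0 : (0 <= \int[leb3 R]_q (powR_exp3 (1 + b) k q)%:E)%E.
  by apply: integral_ge0 => q _; rewrite lee_fin powR_exp3_ge0.
have Ifin : (\int[leb3 R]_q (powR_exp3 (1 + b) k q)%:E)%E \is a fin_num by rewrite ge0_fin_numE.
set I := (\int[leb3 R]_q _)%E in Ioo I0 Ifin.
exists (16 * S * fine I); first by rewrite !mulr_ge0// fine_ge0.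
move=> p.
have mz (s : R) (F : R3 R * R3 R -> R3 R) : measurable_fun setT F ->
    measurable_fun setT (fun z => powR_exp3 s k (F z)).
  by move=> mF; apply: (measurableT_comp (measurable_powR_exp3 s k) mF).
have mall : measurable_fun setT (fun z : R3 R * R3 R =>
    (kern p z.1 * (powR_exp3 (1 + b1') k (post_p p z.1 z.2) *
     powR_exp3 (1 + b2') k (post_q p z.1 z.2)))%:E).
  apply/measurable_EFinP; apply: measurable_funM; first exact: measurable_kernz.
  apply: measurable_funM; apply: mz; [exact: measurable_post_pz|exact: measurable_post_qz].
have pos3 q w : 0 <= kern p q * (powR_exp3 (1 + b1') k (post_p p q w) *
    powR_exp3 (1 + b2') k (post_q p q w)).
  by apply: mulr_ge0; [exact: kern_ge0|apply: mulr_ge0; exact: powR_exp3_ge0].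
rewrite fubini_tonelli1//; last first.
  by move=> z; rewrite lee_fin; exact: pos3.
pose c := 16 * powR_exp3 (1 + (b1' + b2')) k p * S.
have c0 : 0 <= c by rewrite !mulr_ge0 ?powR_ge0 ?expR_ge0.
have mI : measurable_fun setT (fun q => (powR_exp3 (1 + b) k q)%:E).
  by apply/measurable_EFinP; exact: measurable_powR_exp3.
apply: (@le_trans _ _ (\int[leb3 R]_q (c%:E * (powR_exp3 (1 + b) k q)%:E))%E); last first.
  rewrite ge0_integralZl//; last by move=> q _; rewrite lee_fin powR_exp3_ge0.
  rewrite -/I -(fineK Ifin) -EFinM lee_fin /c.
  by le_ring.
apply: ge0_le_integral.
- exact: measurableT.
- by move=> q _; apply: integral_ge0 => w _; rewrite lee_fin; exact: pos3.
- by apply: measurable_fun_fubini_tonelli_F => // z; rewrite lee_fin; exact: pos3.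
- by apply: emeasurable_funM => //; exact: measurable_cst.
move=> q _; rewrite /fubini_F/= -EFinM.
have [u u1 nu] := exists_axis (p + q).
have := HS u (fun w => kern p q * (powR_exp3 (1 + b1') k (post_p p q w) *
     powR_exp3 (1 + b2') k (post_q p q w)))
  (16 * (powR_exp3 (1 + (b1' + b2')) k p * powR_exp3 (1 + b) k q)) u1.
have -> : c * powR_exp3 (1 + b) k q = 16 * (powR_exp3 (1 + (b1' + b2')) k p * powR_exp3 (1 + b) k q) * S.
  by rewrite /c; ring.
apply.
- have mw (s : R) (F : R3 R -> R3 R) : measurable_fun setT F ->
    measurable_fun setT (fun z => powR_exp3 s k (F z)).
    by move=> mF; apply: (measurableT_comp (measurable_powR_exp3 s k) mF).
  apply: measurable_funM; first exact: measurable_cst.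
  apply: measurable_funM; apply: mw; [apply: measurable_post_p|apply: measurable_post_q]; measurable_tac.
- by move=> w; exact: pos3.
- by rewrite !mulr_ge0 ?powR_ge0 ?expR_ge0.
- by move=> w w1 s0; apply: gain_kernel_le.
Qed.

Lemma loss_integral_le (s k : R) : 0 <= s -> s + b / 2 < 3 -> 0 < k ->
  exists2 K : R, 0 <= K & forall p,
  (\int[mu]_z (kern p z.1 * powR_exp3 s k z.1)%:E <= (K * norm3 p `^ (- (b / 2)))%:E)%E.
Proof.
move=> s0 s3 k0.
have Ioo : (\int[leb3 R]_q (powR_exp3 (s + b / 2) k q)%:E < +oo)%E.
  by apply: integral_powR_exp3_lty => //; lra_b.
have I0 : (0 <= \int[leb3 R]_q (powR_exp3 (s + b / 2) k q)%:E)%E.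
  by apply: integral_ge0 => q _; rewrite lee_fin powR_exp3_ge0.
have Ifin : (\int[leb3 R]_q (powR_exp3 (s + b / 2) k q)%:E)%E \is a fin_num by rewrite ge0_fin_numE.
set I := (\int[leb3 R]_q _)%E in Ioo I0 Ifin.
have Sfin : sphere_measure R setT \is a fin_num by exact: fin_num_measure.
exists (4 * fine I * fine (sphere_measure R setT)); first by rewrite !mulr_ge0 ?fine_ge0.
move=> p; pose c := 4 * norm3 p `^ (- (b / 2)).
have c0 : 0 <= c by rewrite mulr_ge0 ?powR_ge0.
have mI : measurable_fun setT (fun q => c * powR_exp3 (s + b / 2) k q).
  by apply: measurable_funM => //; exact: measurable_powR_exp3.
apply: (@le_trans _ _ (\int[mu]_z (c * powR_exp3 (s + b / 2) k z.1 * 1)%:E)%E).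
  apply: ge0_le_integral => //.
  - by move=> z _; rewrite lee_fin mulr_ge0 ?kern_ge0 ?powR_exp3_ge0.
  - apply/measurable_EFinP; apply: measurable_funM; first exact: measurable_kernz.
    by apply: (measurableT_comp (measurable_powR_exp3 s k)); exact: measurable_fst.
  - apply/measurable_EFinP; apply: measurable_funM => //.
    by apply: (measurableT_comp mI); exact: measurable_fst.
  - by move=> z _; rewrite lee_fin mulr1; exact: loss_kernel_le.
rewrite [leLHS](@integral_prodM _ _ _ _ _ (leb3 R) (sphere_measure R)
  (fun q => c * powR_exp3 (s + b / 2) k q) (fun=> 1))//; last first.
  by move=> q; rewrite mulr_ge0 ?powR_exp3_ge0.
under eq_integral do rewrite EFinM.
rewrite ge0_integralZl//; last 2 first.
- by apply/measurable_EFinP; exact: measurable_powR_exp3.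
- by move=> q _; rewrite lee_fin powR_exp3_ge0.
have -> : (\int[sphere_measure R]_y (1%R)%:E = sphere_measure R setT)%E.
  by rewrite integral_cst// mul1e.
rewrite -/I -(fineK Ifin) -(fineK Sfin) -!EFinM lee_fin /c.
by rewrite le_eqVlt; apply/orP; left; apply/eqP; rewrite /=; ring.
Qed.

End kernel_bounds.

Section dominated.
Context d (T : measurableType d) (R : realType).
Variable mu : {measure set T -> \bar R}.

Lemma integrable_dominated (h H : T -> R) (M : R) :
  measurable_fun setT h -> measurable_fun setT H ->
  {ae mu, forall z, `|h z| <= H z} -> (\int[mu]_z `|(H z)%:E| <= M%:E)%E ->
  mu.-integrable setT (EFin \o h) /\ `|(\int[mu]_z h z)%R| <= M.
Proof.
move=> mh mH hH HM.
have mh' : measurable_fun setT (EFin \o h) by exact/measurable_EFinP.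
have le : (\int[mu]_z `|(h z)%:E| <= M%:E)%E.
  apply: le_trans HM; apply: ae_ge0_le_integral => //.
  - exact: measurableT_comp.
  - by apply: measurableT_comp => //; exact/measurable_EFinP.
  - by apply: ae_imp hH => z hz _; rewrite lee_fin (le_trans hz)// ler_norm.
have ih : mu.-integrable setT (EFin \o h).
  by apply/integrableP; split => //; apply: le_lt_trans le _; rewrite ltry.
split => //; apply: (le_trans (le_normr_Rintegral measurableT ih)).
rewrite -lee_fin; apply: le_trans le; rewrite /Rintegral fineK//.
apply: integrable_fin_num => //.
by have := integrable_abse ih.
Qed.

End dominated.

(** * Gain and loss operators in the weights W and B *)

Section collision_operators.
Variable R : realType.
Notation Z := (R3 R * R3 R)%type.

Definition colm : set Z -> \bar R := (leb3 R \x sphere_measure R)%E.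
HB.instance Definition _ := Measure.on colm.
HB.instance Definition _ := Measure_isSigmaFinite.Build _ _ _ colm
  (sigma_finite_product (leb3 R) (sphere_measure R)).

Variable b : R.
Hypotheses (b0 : 0 < b) (b1 : b < 1).
Implicit Types (p : R3 R) (f g : R3 R -> R).

(** Away from the origin, the reciprocal of the weight in [Linfw_norm]: bounds in that norm are
    bounds by multiples of [wgt]. *)
Definition wgt p : R := powR_exp3 1 1 p.
Definition bgt p : R := powR_exp3 (1 + b / 2) 2^-1 p.

Lemma wgt_ge0 p : 0 <= wgt p. Proof. exact: powR_exp3_ge0. Qed.
Lemma bgt_ge0 p : 0 <= bgt p. Proof. exact: powR_exp3_ge0. Qed.

Lemma measurable_wgt : measurable_fun setT wgt.
Proof. exact: measurable_powR_exp3. Qed.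
Lemma measurable_bgt : measurable_fun setT bgt.
Proof. exact: measurable_powR_exp3. Qed.

Definition gain_fun f g p (z : Z) : R :=
  kern b p z.1 * (f (post_p p z.1 z.2) * g (post_q p z.1 z.2)).

Definition loss_fun f p (z : Z) : R := kern b p z.1 * f z.1.

Definition gain f g p : R := (\int[colm]_z gain_fun f g p z)%R.
Definition loss f p : R := (\int[colm]_z loss_fun f p z)%R.

Lemma measurable_gain_fun f g p : measurable_fun setT f -> measurable_fun setT g ->
  measurable_fun setT (gain_fun f g p).
Proof.
move=> mf mg; apply: measurable_funM; first exact: measurable_kernz.
apply: measurable_funM.
  exact: (measurableT_comp mf (measurable_post_pz p)).
exact: (measurableT_comp mg (measurable_post_qz p)).
Qed.

Lemma measurable_loss_fun f p : measurable_fun setT f ->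
  measurable_fun setT (loss_fun f p).
Proof.
move=> mf; apply: measurable_funM; first exact: measurable_kernz.
by apply: (measurableT_comp mf); exact: measurable_fst.
Qed.

Let expR_half (k : R) (s : R) p : 0 <= k -> powR_exp3 s (2^-1 + k) p <= powR_exp3 s 2^-1 p.
Proof.
move=> k0; rewrite /powR_exp3 ler_wpM2l ?powR_ge0// ler_expR ler_wpM2r ?norm3_ge0//.
by rewrite lerN2 lerDl.
Qed.

Definition collision_bounded (K : R) : Prop := forall p,
  [/\ (\int[colm]_z (gain_fun wgt wgt p z)%:E <= (K * wgt p)%:E)%E,
      (\int[colm]_z (gain_fun bgt wgt p z)%:E <= (K * bgt p)%:E)%E,
      (\int[colm]_z (gain_fun wgt bgt p z)%:E <= (K * bgt p)%:E)%E,
      (\int[colm]_z (loss_fun wgt p z)%:E <= (K * norm3 p `^ (- (b / 2)))%:E)%E &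
      (\int[colm]_z (loss_fun bgt p z)%:E <= (K * norm3 p `^ (- (b / 2)))%:E)%E].

Lemma collision_bounds : exists2 K : R, 0 < K & collision_bounded K.
Proof.
have bb0 : 0 <= b / 2 by rewrite divr_ge0// ltW.
have b00 : 0 + 0 <= b / 2 by rewrite addr0.
have bb1 : b / 2 + 0 <= b / 2 by rewrite addr0.
have bb2 : 0 + b / 2 <= b / 2 by rewrite add0r.
have h0 : 0 < 2^-1 :> R by rewrite invr_gt0.
have [K1 K10 H1] := gain_integral_le b0 b1 (lexx 0) (lexx 0) b00 (@ltr01 R).
have [K2 K20 H2] := gain_integral_le b0 b1 bb0 (lexx 0) bb1 h0.
have [K3 K30 H3] := gain_integral_le b0 b1 (lexx 0) bb0 bb2 h0.
have e1 : 1 + b / 2 < 3 by move: (b1) => ?; lra.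
have e2 : 1 + b / 2 + b / 2 < 3 by move: (b1) => ?; lra.
have e3 : 0 <= 1 + b / 2 by rewrite addr_ge0.
have [K4 K40 H4] := loss_integral_le b0 b1 (@ler01 R) e1 (@ltr01 R).
have [K5 K50 H5] := loss_integral_le b0 b1 e3 e2 h0.
pose K := K1 + K2 + K3 + K4 + K5 + 1.
have KK : [/\ K1 <= K, K2 <= K, K3 <= K, K4 <= K & K5 <= K] by rewrite /K; clear H1 H2 H3 H4 H5; split; lra.
case: KK => k1 k2 k3 k4 k5.
(* The gain estimate needs one exponential rate for both factors, so in the mixed terms [wgt] is
   weakened to the rate 1/2 of [bgt]. *)
have wle p : powR_exp3 1 1 p <= powR_exp3 (1 + 0) 2^-1 p.
  have e : 2^-1 + 2^-1 = 1 :> R by field.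
  by rewrite addr0 -{2}e; apply: expR_half; rewrite invr_ge0.
exists K; first by rewrite /K; clear H1 H2 H3 H4 H5 k1 k2 k3 k4 k5; lra.
move=> p; have m1 := measurable_wgt; have m2 := measurable_bgt.
have mgf f g : measurable_fun setT f -> measurable_fun setT g ->
    measurable_fun setT (fun z => (gain_fun f g p z)%:E).
  by move=> mf mg; apply/measurable_EFinP; exact: measurable_gain_fun.
have mE s k := @measurable_powR_exp3 R s k.
split.
- apply: (@le_trans _ _ (K1 * wgt p)%:E); last by rewrite lee_fin ler_wpM2r ?wgt_ge0.
  by have := H1 p; rewrite !addr0.
- apply: (@le_trans _ _ (K2 * bgt p)%:E); last by rewrite lee_fin ler_wpM2r ?bgt_ge0.
  have := H2 p; rewrite [b / 2 + 0]addr0; apply: le_trans.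
  apply: ge0_le_integral.
  + exact: measurableT.
  + by move=> z _; rewrite lee_fin; apply: mulr_ge0; [exact: kern_ge0|apply: mulr_ge0; exact: powR_exp3_ge0].
  + exact: mgf.
  + exact: (mgf (powR_exp3 (1 + b / 2) 2^-1) (powR_exp3 (1 + 0) 2^-1)).
  + by move=> z _; rewrite lee_fin; apply: ler_wpM2l; [exact: kern_ge0|apply: ler_wpM2l; [exact: powR_exp3_ge0|exact: wle]].
- apply: (@le_trans _ _ (K3 * bgt p)%:E); last by rewrite lee_fin ler_wpM2r ?bgt_ge0.
  have := H3 p; rewrite [0 + b / 2]add0r; apply: le_trans.
  apply: ge0_le_integral.
  + exact: measurableT.
  + by move=> z _; rewrite lee_fin; apply: mulr_ge0; [exact: kern_ge0|apply: mulr_ge0; exact: powR_exp3_ge0].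
  + exact: mgf.
  + exact: (mgf (powR_exp3 (1 + 0) 2^-1) (powR_exp3 (1 + b / 2) 2^-1)).
  + by move=> z _; rewrite lee_fin; apply: ler_wpM2l; [exact: kern_ge0|apply: ler_wpM2r; [exact: powR_exp3_ge0|exact: wle]].
- apply: (le_trans (H4 p)); rewrite lee_fin ler_wpM2r ?powR_ge0//.
- apply: (le_trans (H5 p)); rewrite lee_fin ler_wpM2r ?powR_ge0//.
Qed.

End collision_operators.
Arguments colm : clear implicits.

Section collision_estimates.
Variable R : realType.
Notation Z := (R3 R * R3 R)%type.
Variables (b K : R).
Hypotheses (b0 : 0 < b) (b1 : b < 1) (K0 : 0 < K).
Hypothesis HK : collision_bounded b K.
Implicit Types (p : R3 R) (f g : R3 R -> R).

Lemma gain_fun_ge0 f g p z : (forall v, 0 <= f v) -> (forall v, 0 <= g v) ->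
  0 <= gain_fun b f g p z.
Proof. by move=> f0 g0; apply: mulr_ge0; [exact: kern_ge0|exact: mulr_ge0]. Qed.

Lemma loss_fun_ge0 f p z : (forall v, 0 <= f v) -> 0 <= loss_fun b f p z.
Proof. by move=> f0; apply: mulr_ge0; [exact: kern_ge0|]. Qed.

Let int_scale (H : Z -> R) (c M : R) : measurable_fun setT H -> (forall z, 0 <= H z) ->
  0 <= c -> (\int[colm R]_z (H z)%:E <= M%:E)%E ->
  (\int[colm R]_z `|(c * H z)%:E| <= (c * M)%:E)%E.
Proof.
move=> mH H0 c0 HM.
under eq_integral => z _.
  rewrite gee0_abs ?lee_fin ?mulr_ge0// EFinM; over.
rewrite ge0_integralZl//; last 2 first.
- exact/measurable_EFinP.
- by move=> z _; rewrite lee_fin.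
by rewrite EFinM lee_wpmul2l// lee_fin.
Qed.

Lemma gain_dominated f g p (c : R) : measurable_fun setT f -> measurable_fun setT g ->
  0 <= c -> {ae colm R, forall z, `|gain_fun b f g p z| <= c * gain_fun b (@wgt R) (@wgt R) p z} ->
  (colm R).-integrable setT (EFin \o gain_fun b f g p) /\ `|gain b f g p| <= c * (K * wgt p).
Proof.
move=> mf mg c0 H; have [h1 _ _ _ _] := HK p.
have mw := @measurable_wgt R.
have mgw : measurable_fun setT (gain_fun b (@wgt R) (@wgt R) p) by exact: measurable_gain_fun.
apply: (integrable_dominated (H := fun z => c * gain_fun b (@wgt R) (@wgt R) p z)) => //.
- exact: measurable_gain_fun.
- exact: measurable_funM.
- by apply: int_scale => // z; apply: gain_fun_ge0 => v; exact: wgt_ge0.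
Qed.

Lemma loss_dominated f p (c : R) : measurable_fun setT f ->
  0 <= c -> {ae colm R, forall z, `|loss_fun b f p z| <= c * loss_fun b (@wgt R) p z} ->
  (colm R).-integrable setT (EFin \o loss_fun b f p) /\
  `|loss b f p| <= c * (K * norm3 p `^ (- (b / 2))).
Proof.
move=> mf c0 H; have [_ _ _ h4 _] := HK p.
have mw := @measurable_wgt R.
have mgw : measurable_fun setT (loss_fun b (@wgt R) p) by exact: measurable_loss_fun.
apply: (integrable_dominated (H := fun z => c * loss_fun b (@wgt R) p z)) => //.
- exact: measurable_loss_fun.
- exact: measurable_funM.
- by apply: int_scale => // z; apply: loss_fun_ge0 => v; exact: wgt_ge0.
Qed.

(* The gain operator loses nothing in the weight [bgt b], which is more
   singular at the origin than [wgt] by exactly the factor lost in [loss]. *)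
Lemma gain_diff_dominated (h : Z -> R) p (c : R) : measurable_fun setT h -> 0 <= c ->
  {ae colm R, forall z, `|h z| <= c * (gain_fun b (bgt b) (@wgt R) p z + gain_fun b (@wgt R) (bgt b) p z)} ->
  (colm R).-integrable setT (EFin \o h) /\ `|(\int[colm R]_z h z)%R| <= c * (2 * K * bgt b p).
Proof.
move=> mh c0 H; have [_ h2 h3 _ _] := HK p.
have mw := @measurable_wgt R; have mb := @measurable_bgt R b.
pose H1 := gain_fun b (bgt b) (@wgt R) p; pose H2 := gain_fun b (@wgt R) (bgt b) p.
have mH1 : measurable_fun setT H1 by exact: measurable_gain_fun.
have mH2 : measurable_fun setT H2 by exact: measurable_gain_fun.
have H10 z : 0 <= H1 z by apply: gain_fun_ge0 => v; [exact: bgt_ge0|exact: wgt_ge0].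
have H20 z : 0 <= H2 z by apply: gain_fun_ge0 => v; [exact: wgt_ge0|exact: bgt_ge0].
apply: (integrable_dominated (H := fun z => c * (H1 z + H2 z))) => //.
- by apply: measurable_funM => //; exact: measurable_funD.
- apply: int_scale => //; first exact: measurable_funD.
    by move=> z; rewrite addr_ge0.
  under eq_integral do rewrite EFinD.
  rewrite ge0_integralD//; try by move=> z _; rewrite lee_fin.
  + by apply: (le_trans (leeD h2 h3)); rewrite -EFinD lee_fin; lra.
  + exact/measurable_EFinP.
  + exact/measurable_EFinP.
Qed.

Lemma loss_diff_dominated f p (c : R) : measurable_fun setT f -> 0 <= c ->
  {ae colm R, forall z, `|loss_fun b f p z| <= c * loss_fun b (bgt b) p z} ->
  (colm R).-integrable setT (EFin \o loss_fun b f p) /\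
  `|loss b f p| <= c * (K * norm3 p `^ (- (b / 2))).
Proof.
move=> mf c0 H; have [_ _ _ _ h5] := HK p.
have mb := @measurable_bgt R b.
have mgw : measurable_fun setT (loss_fun b (bgt b) p) by exact: measurable_loss_fun.
apply: (integrable_dominated (H := fun z => c * loss_fun b (bgt b) p z)) => //.
- exact: measurable_loss_fun.
- exact: measurable_funM.
- by apply: int_scale => // z; apply: loss_fun_ge0 => v; exact: bgt_ge0.
Qed.

End collision_estimates.

(** * Linear differential equations and the Picard iteration *)

Section linear_ode.
Variable R : realType.
Notation mR := (measurableTypeR R).
Implicit Types (h l r : R -> R) (x y : R).

(** Integration starts at -1 to make 0 an interior point, so that ordinary two-sided derivatives are
    available at every nonnegative time. *)
Definition prim h x : R :=
  (\int[leb1 R]_(t in `[(-1)%R, x]) h t - \int[leb1 R]_(t in `[(-1)%R, 0%R]) h t)%R.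

Lemma prim0 h : prim h 0 = 0.
Proof. by rewrite /prim subrr. Qed.

Lemma prim_derive h x : continuous h -> -1 < x -> is_derive x 1 (prim h) (h x).
Proof.
move=> ch x1.
have hi : (leb1 R).-integrable `[(-1)%R, x + 1] (EFin \o h).
  apply: continuous_compact_integrable; first exact: segment_compact.
  exact: continuous_subspaceT.
have xx : x < x + 1 by rewrite ltrDl.
have [d e] := continuous_FTC1_closed xx hi x1 (ch x).
pose F y : R := (\int[leb1 R]_(t in `[(-1)%R, y]) h t)%R.
have dF : is_derive x 1 F (h x).
  by apply: DeriveDef; [exact: d|rewrite -derive1E; exact: e].
rewrite -[h x]subr0; apply: is_deriveB.
Qed.

Lemma prim_continuous h x : continuous h -> -1 < x -> {for x, continuous (prim h)}.
Proof.
move=> ch x1; apply: differentiable_continuous; apply/derivable1_diffP.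
by have [] := prim_derive ch x1.
Qed.

Lemma mean_value_ge0 (f df : R -> R) : (forall x : R, 0 <= x -> is_derive x 1 f (df x)) ->
  forall s t, 0 <= s -> 0 <= t ->
  exists c, [/\ Num.min s t <= c, c <= Num.max s t & f s - f t = df c * (s - t)].
Proof.
move=> fdf.
have main (s t : R) : 0 <= s -> s < t -> exists c, [/\ s <= c, c <= t & f t - f s = df c * (t - s)].
  move=> s0 st.
  have dv (x : R) : x \in `]s, t[%R -> is_derive x 1 f (df x).
    by rewrite in_itv/= => /andP[sx _]; apply: fdf; rewrite (le_trans s0)// ltW.
  have cv : {within `[s, t], continuous f}.
    apply: derivable_within_continuous => x; rewrite in_itv/= => /andP[sx _].
    by have [] := fdf x (le_trans s0 sx).
  have [c] := MVT st dv cv; rewrite in_itv/= => /andP[sc ct] e.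
  by exists c; split => //; exact: ltW.
move=> s t s0 t0; have [st|ts|->] := ltgtP s t.
- have [c [h1 h2 h3]] := main s t s0 st; exists c.
  by split => //; rewrite -(opprB (f t)) -(opprB t) h3 mulrN.
- by have [c [h1 h2 h3]] := main t s t0 ts; exists c; split.
- by exists t; split => //; rewrite !subrr mulr0.
Qed.

(** Variation of constants. [Num.max] keeps the argument of [prim l] where it is known to be
    continuous, and changes nothing at nonnegative times. *)
Definition linear_sol y0 l r x : R :=
  expR (- prim l x) * (y0 + prim (fun s : R => expR (prim l (Num.max s 0)) * r s) x).

Let max_continuous : continuous (fun s : R => Num.max s 0).
Proof. by move=> s; apply: continuous_max; [exact: cvg_id|exact: cvg_cst]. Qed.

Lemma factor_continuous l r : continuous l -> continuous r ->
  continuous (fun s : R => expR (prim l (Num.max s 0)) * r s).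
Proof.
move=> cl cr s; apply: cvgM; last exact: cr.
apply: (@continuous_comp _ _ _ (fun s : R => prim l (Num.max s 0)) expR); last exact: continuous_expR.
apply: (@continuous_comp _ _ _ (fun s : R => Num.max s 0) (prim l)); first exact: max_continuous.
by apply: prim_continuous => //; rewrite lt_max ltrN10 orbT.
Qed.

Lemma linear_sol0 y0 l r : linear_sol y0 l r 0 = y0.
Proof. by rewrite /linear_sol !prim0 oppr0 expR0 mul1r addr0. Qed.

Lemma linear_sol_derive y0 l r x : continuous l -> continuous r -> 0 <= x ->
  is_derive x 1 (linear_sol y0 l r) (r x - l x * linear_sol y0 l r x).
Proof.
move=> cl cr x0; have x1 : -1 < x by exact: lt_le_trans x0.
have d1 := prim_derive cl x1.
have d2 := prim_derive (factor_continuous cl cr) x1.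
rewrite (max_l x0) in d2.
set G := prim (fun s : R => expR (prim l (Num.max s 0)) * r s) in d2 *.
have dN : is_derive x 1 (fun y => - prim l y) (- l x) by exact: is_deriveN.
have dE : is_derive x 1 (fun y => expR (- prim l y)) (- l x * expR (- prim l x)).
  by apply: (is_derive_eq (@is_derive1_comp _ expR (fun y => - prim l y) x _ _ (is_derive_expR _) dN)); rewrite mulrC.
have dG : is_derive x 1 (fun y => y0 + G y) (expR (prim l x) * r x).
  by rewrite -[X in is_derive _ _ _ X]add0r; apply: is_deriveD.
apply: (is_derive_eq (is_deriveM dE dG)); rewrite /linear_sol -/G /GRing.scale/=.
have e : expR (- prim l x) * expR (prim l x) = 1 by rewrite -expRD addNr expR0.
by rewrite -[X in _ = X - _]mul1r -e; ring.
Qed.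

(** After multiplication by the integrating factor, the gap between [z] and the line z0 + rho x is
    nonincreasing, because the damping [l] only helps. The bound is independent of the size of [l],
    which matters as the loss frequency is unbounded in p. *)
Lemma linear_ode_le l r (z : R -> R) (z0 rho : R) : continuous l ->
  (forall x, 0 <= x -> 0 <= l x) -> 0 <= z0 -> 0 <= rho -> z 0 <= z0 ->
  (forall x, 0 <= x -> is_derive x 1 z (r x - l x * z x)) ->
  forall T, 0 <= T -> (forall x, 0 <= x -> x <= T -> r x <= rho) -> z T <= z0 + rho * T.
Proof.
move=> cl l0 z00 rho0 z0z dz T T0 rrho.
pose u x := expR (prim l x) * (z x - (z0 + rho * x)).
have du x : 0 <= x -> is_derive x 1 u
    (expR (prim l x) * (r x - rho - l x * (z0 + rho * x))).
  move=> x0; have d1 := prim_derive cl (lt_le_trans (ltrN10 R) x0).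
  have dE : is_derive x 1 (fun y => expR (prim l y)) (l x * expR (prim l x)).
    by apply: (is_derive_eq (@is_derive1_comp _ expR (prim l) x _ _ (is_derive_expR _) d1)); rewrite mulrC.
  have dL : is_derive x 1 (fun y => z0 + rho * y) rho.
    rewrite -[X in is_derive _ _ _ X]add0r; apply: is_deriveD.
    by rewrite -[X in is_derive _ _ _ X]mulr1; apply: is_deriveZ.
  apply: (is_derive_eq (is_deriveM dE (is_deriveB (dz x x0) dL))); rewrite /GRing.scale/= !fctE; ring.
have u0 : u 0 <= 0.
  by rewrite /u prim0 expR0 mul1r mulr0 addr0 subr_le0.
have [T0'|] := ltP 0 T; last first.
  move=> T1; have -> : T = 0 by apply/eqP; rewrite eq_le T1 T0.
  by rewrite mulr0 addr0.
have du' x : x \in `]0, T[%R -> is_derive x 1 u (expR (prim l x) * (r x - rho - l x * (z0 + rho * x))).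
  by rewrite in_itv/= => /andP[x0 _]; apply: du; exact: ltW.
have cu : {within `[0, T], continuous u}.
  apply: derivable_within_continuous => x; rewrite in_itv/= => /andP[x0 _].
  by have [] := du x x0.
have [c c0T e] := MVT T0' du' cu.
move: c0T; rewrite in_itv/= => /andP[c0 cT].
have : u T <= 0.
  rewrite -[u T](subrK (u 0)) e -[X in _ <= X]addr0 lerD// mulr_le0_ge0//; last by rewrite subr0.
  rewrite mulr_ge0_le0 ?expR_ge0//.
  have h1 := rrho c (ltW c0) (ltW cT).
  have h2 : 0 <= l c * (z0 + rho * c).
    by rewrite mulr_ge0 ?l0 ?addr_ge0 ?mulr_ge0// ltW.
  by move: h1 h2; set A := l c * _; set B := r c => h1 h2; lra.
by rewrite /u pmulr_rle0 ?expR_gt0// subr_le0.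
Qed.

Lemma linear_ode_norm l r (z : R -> R) (z0 rho : R) : continuous l ->
  (forall x, 0 <= x -> 0 <= l x) -> 0 <= z0 -> 0 <= rho -> `|z 0| <= z0 ->
  (forall x, 0 <= x -> is_derive x 1 z (r x - l x * z x)) ->
  forall T, 0 <= T -> (forall x, 0 <= x -> x <= T -> `|r x| <= rho) -> `|z T| <= z0 + rho * T.
Proof.
move=> cl l0 z00 rho0 z0z dz T T0 rrho.
move: z0z; rewrite ler_norml => /andP[z1 z2].
have dz' x : 0 <= x -> is_derive x 1 (fun y => - z y) (- r x - l x * (- z x)).
  by move=> x0; apply: (is_derive_eq (is_deriveN (dz x x0))); ring.
have zN : - z 0 <= z0 by rewrite lerNl.
have rP x : 0 <= x -> x <= T -> r x <= rho.
  by move=> x0 xT; have := rrho x x0 xT; rewrite ler_norml => /andP[].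
have rN x : 0 <= x -> x <= T -> - r x <= rho.
  by move=> x0 xT; have := rrho x x0 xT; rewrite ler_norml lerNl => /andP[].
have h1 := linear_ode_le cl l0 z00 rho0 zN dz' T0 rN.
have h2 := linear_ode_le cl l0 z00 rho0 z2 dz T0 rP.
by rewrite ler_norml h2 andbT lerNl.
Qed.

Lemma linear_ode_ge0 l r (z : R -> R) : continuous l ->
  (forall x, 0 <= x -> 0 <= l x) -> 0 <= z 0 -> (forall x, 0 <= x -> 0 <= r x) ->
  (forall x, 0 <= x -> is_derive x 1 z (r x - l x * z x)) ->
  forall T, 0 <= T -> 0 <= z T.
Proof.
move=> cl l0 z00 r0 dz T T0.
have dz' x : 0 <= x -> is_derive x 1 (fun y => - z y) (- r x - l x * (- z x)).
  by move=> x0; apply: (is_derive_eq (is_deriveN (dz x x0))); ring.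
have zN : - z 0 <= 0 by rewrite oppr_le0.
have rN x : 0 <= x -> x <= T -> - r x <= 0 by move=> x0 _; rewrite oppr_le0 r0.
have := linear_ode_le cl l0 (lexx 0) (lexx 0) zN dz' T0 rN.
by rewrite mul0r addr0 oppr_le0.
Qed.

Lemma measurable_prim d (T : measurableType d) (h : T * mR -> R) (g : T -> R) :
  measurable_fun setT h -> (forall z, 0 <= h z) -> measurable_fun setT g ->
  measurable_fun setT (fun z : T => prim (fun t => h (z, t)) (g z)).
Proof.
move=> mh h0 mg.
have main (k : T -> R) : measurable_fun setT k ->
    measurable_fun setT (fun z : T => (\int[leb1 R]_(t in `[(-1)%R, k z]) h (z, t))%R).
  move=> mk.
  (* The moving endpoint is encoded by an indicator of k - t >= 0, so that the integral becomes a
     section integral of one jointly measurable function. *)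
  pose H (z : T * mR) : \bar R :=
    (\1_(`[0%R, +oo[%classic : set mR) (k z.1 - z.2) *
     (\1_(`[(-1)%R, +oo[%classic : set mR) z.2 * h z))%:E.
  have mH : measurable_fun setT H.
    apply/measurable_EFinP; apply: measurable_funM.
      have mi : measurable_fun setT (\1_(`[0%R, +oo[%classic : set mR) : mR -> R).
        by apply: measurable_indic; exact: measurable_itv.
      apply: (measurableT_comp mi).
      by apply: measurable_funB; [apply: (measurableT_comp mk); exact: measurable_fst|exact: measurable_snd].
    apply: measurable_funM => //.
    have mi : measurable_fun setT (\1_(`[(-1)%R, +oo[%classic : set mR) : mR -> R).
      by apply: measurable_indic; exact: measurable_itv.
    by apply: (measurableT_comp mi); exact: measurable_snd.
  have H0 z : (0 <= H z)%E by rewrite lee_fin !mulr_ge0.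
  have := @measurable_fun_fubini_tonelli_F _ _ T mR R (leb1 R) H mH H0.
  move=> mF; have := measurableT_comp (@fine_measurable R setT measurableT) mF.
  apply: eq_measurable_fun => z _; rewrite /fubini_F/= /Rintegral integral_mkcond.
  congr fine; apply: eq_integral => t _.
  rewrite patchE /H/= !indicE; case: ifPn; rewrite ?inE ?notin_setE/= in_itv/=.
    move=> /andP[t1 t2]; rewrite !mem_set/= ?in_itv/= ?andbT ?subr_ge0//.
    by rewrite !mul1r.
  move=> nt; case: (boolP (k z - t \in _)) => [|_]; last by rewrite mul0r.
  rewrite inE/= in_itv/= andbT subr_ge0 => tk; rewrite mul1r.
  case: (boolP (t \in _)) => [|_]; last by rewrite mul0r.
  by rewrite inE/= in_itv/= andbT => t1; exfalso; apply: nt; rewrite t1 tk.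
by apply: measurable_funB; apply: main => //.
Qed.

End linear_ode.

(** * Comparison of the weights *)

Section weights.
Variable R : realType.
Variable b : R.
Hypotheses (b0 : 0 < b) (b1 : b < 1).

Lemma powR_le_expR (x : R) : 0 < x -> x `^ (b / 2) <= expR (2^-1 * x).
Proof.
move=> x0; rewrite /powR gt_eqF// ler_expR.
have h : ln x <= x by apply: ltW; exact: ln_sublinear.
have [l0|l0] := leP 0 (ln x).
  by apply: (@le_trans _ _ (2^-1 * ln x)); [rewrite ler_wpM2r//; move: (b1) => ?; lra|rewrite ler_wpM2l// invr_ge0].
apply: (@le_trans _ _ 0); last by rewrite mulr_ge0 ?invr_ge0// ltW.
by rewrite mulr_ge0_le0 ?divr_ge0// ltW.
Qed.

Let bb : - (1 + b / 2) != 0.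
Proof. by rewrite oppr_eq0 gt_eqF// ltr_pwDl// divr_ge0// ltW. Qed.

Let one : - 1 != 0 :> R.
Proof. by rewrite oppr_eq0 oner_eq0. Qed.

Lemma wgt_le_bgt (p : R3 R) : wgt p <= bgt b p.
Proof.
rewrite /wgt /bgt /powR_exp3; have [->|p0] := eqVneq (norm3 p) 0.
  by rewrite !powR0 ?mul0r.
have n0 : 0 < norm3 p by rewrite lt_neqAle eq_sym p0 norm3_ge0.
rewrite opprD powRD ?(gt_eqF n0) ?implybT// -mulrA ler_wpM2l ?powR_ge0//.
rewrite [norm3 p `^ (- (b / 2))]powRN ler_pdivlMl ?powR_gt0//.
apply: (le_trans (ler_wpM2r (expR_ge0 _) (powR_le_expR n0))).
by rewrite -expRD ler_expR; lra.
Qed.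

(** Away from the origin the powers of |p| agree and only the exponentials are compared; at the
    origin both sides are 0. *)
Lemma wgt_powR_le_bgt (p : R3 R) : norm3 p `^ (- (b / 2)) * wgt p <= bgt b p.
Proof.
rewrite /wgt /bgt /powR_exp3; have [->|p0] := eqVneq (norm3 p) 0.
  by rewrite (powR0 one) (powR0 bb) !mul0r mulr0.
have n0 : 0 < norm3 p by rewrite lt_neqAle eq_sym p0 norm3_ge0.
rewrite opprD powRD ?(gt_eqF n0) ?implybT// mulrA [_ * norm3 p `^ (-1)]mulrC.
by rewrite ler_wpM2l ?mulr_ge0 ?powR_ge0// ler_expR !mulNr lerN2 ler_wpM2r ?norm3_ge0// invf_le1// ler1n.
Qed.

End weights.

Lemma le_geometric (R : realType) (x y c : R) : 0 <= c ->
  (forall n, x <= y + c * 2^-1 ^+ n) -> x <= y.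
Proof.
move=> c0 H; rewrite leNgt; apply/negP => yx.
have d0 : 0 < x - y by rewrite subr_gt0.
have : (fun n => c * 2^-1 ^+ n) @ \oo --> (0 : R).
  rewrite -[X in _ --> X](mulr0 c); apply: cvgMr; apply: cvg_expr.
  by rewrite ger0_norm ?invr_ge0// invf_lt1// ltr1n.
move=> /cvgrPdist_lt /(_ _ d0) [N _ /(_ N (leqnn N))] /=.
rewrite sub0r normrN ger0_norm ?mulr_ge0 ?exprn_ge0 ?invr_ge0//.
by have := H N; lra.
Qed.

Section geometric_limit.
Variable R : realType.

(** With [e] the tail of the geometric series, u - e is nondecreasing, u + e is nonincreasing, and
    they enclose the limit; this gives convergence and its rate at once. *)
Lemma geometric_cauchy (u : nat -> R) (c : R) : 0 <= c ->
  (forall n, `|u n.+1 - u n| <= c * 2^-1 ^+ n) ->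
  cvg (u @ \oo) /\ forall n, `|limn u - u n| <= 2 * c * 2^-1 ^+ n.
Proof.
move=> c0 H; pose e n := 2 * c * 2^-1 ^+ n.
have eS n : e n = e n.+1 + c * 2^-1 ^+ n by rewrite /e exprS; field.
have e0 n : 0 <= e n by rewrite !mulr_ge0 ?exprn_ge0 ?invr_ge0.
have ecvg : e @ \oo --> (0 : R).
  rewrite -[X in _ --> X](mulr0 (2 * c)); apply: cvgMr; apply: cvg_expr.
  by rewrite ger0_norm ?invr_ge0// invf_lt1// ltr1n.
pose v n := u n - e n; pose w n := u n + e n.
have Hn n : - (c * 2^-1 ^+ n) <= u n.+1 - u n <= c * 2^-1 ^+ n by rewrite -ler_norml.
have ndv : nondecreasing_seq v.
  by apply/nondecreasing_seqP => n; rewrite /v (eS n); have /andP[] := Hn n; lra.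
have niw : nonincreasing_seq w.
  by apply/nonincreasing_seqP => n; rewrite /w (eS n); have /andP[] := Hn n; lra.
have vw m n : v m <= w n.
  apply: (le_trans (ndv m (maxn m n) (leq_maxl _ _))).
  apply: le_trans (niw n (maxn m n) (leq_maxr _ _)).
  by rewrite /v /w; have := e0 (maxn m n); lra.
have cv : v @ \oo --> sup (range v).
  by apply: nondecreasing_cvgn => //; exists (w 0%N) => _ [m _ <-].
have cu : u @ \oo --> sup (range v).
  have -> : u = v \+ e by apply/funext => n; rewrite /v/= subrK.
  by rewrite -[X in _ --> X]addr0; apply: cvgD.
split; first by apply/cvg_ex; eexists; exact: cu.
move=> n; rewrite (cvg_lim _ cu)//.
have h1 : v n <= sup (range v).
  rewrite -(cvg_lim _ cv)//; apply: nondecreasing_cvgn_le => //.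
  by apply/cvg_ex; eexists; exact: cv.
have h2 : sup (range v) <= w n.
  by apply: ge_sup; [exists (v 0%N), 0%N|move=> _ [m _ <-]].
by rewrite -/(e n) ler_norml; apply/andP; split; move: h1 h2; rewrite /v /w; lra.
Qed.

End geometric_limit.

(** * The Picard map and its fixed point *)

Section picard.
Variable R : realType.
Notation mR := (measurableTypeR R).
Notation Z := (R3 R * R3 R)%type.
Variables (b K eps T : R).
Hypotheses (b0 : 0 < b) (b1 : b < 1) (K0 : 0 < K) (eps0 : 0 < eps) (T0 : 0 < T).
Hypothesis HK : collision_bounded b K.
Hypothesis small : 12 * K * eps * T <= 1.
Variable f0 : R3 R -> R.
Hypotheses (mf0 : measurable_fun setT f0)
  (f0W : forall p, 0 <= f0 p /\ f0 p <= eps * wgt p).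

Definition small_profile (f : R3 R -> R) : Prop :=
  measurable_fun setT f /\ forall p, 0 <= f p /\ f p <= 2 * eps * wgt p.

Lemma small_gain_integrable f g p : small_profile f -> small_profile g ->
  (colm R).-integrable setT (EFin \o gain_fun b f g p) /\
  `|gain b f g p| <= (2 * eps) ^+ 2 * (K * wgt p).
Proof.
move=> [mf fW] [mg gW]; apply: gain_dominated => //; first exact: sqr_ge0.
apply: aeT => z; rewrite ger0_norm; last first.
  by apply: gain_fun_ge0 => v; [exact: (fW v).1|exact: (gW v).1].
rewrite /gain_fun [leRHS]mulrCA ler_wpM2l ?kern_ge0//.
have [f1 f2] := fW (post_p p z.1 z.2); have [g1 g2] := gW (post_q p z.1 z.2).
by rewrite expr2 mulrACA ler_pM.
Qed.

Lemma small_loss_integrable f p : small_profile f ->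
  (colm R).-integrable setT (EFin \o loss_fun b f p) /\
  `|loss b f p| <= 2 * eps * (K * norm3 p `^ (- (b / 2))).
Proof.
move=> [mf fW]; have e0 : 0 <= 2 * eps by rewrite mulr_ge0// ltW.
apply: loss_dominated => //.
apply: aeT => z; rewrite ger0_norm; last by apply: loss_fun_ge0 => v; exact: (fW v).1.
rewrite /loss_fun [leRHS]mulrCA ler_wpM2l ?kern_ge0//; exact: (fW _).2.
Qed.

Lemma gain_ge0 f g p : small_profile f -> small_profile g -> 0 <= gain b f g p.
Proof.
move=> [mf fW] [mg gW]; apply: Rintegral_ge0 => z _.
by apply: gain_fun_ge0 => v; [exact: (fW v).1|exact: (gW v).1].
Qed.

Lemma loss_ge0 f p : small_profile f -> 0 <= loss b f p.
Proof.
move=> [mf fW]; apply: Rintegral_ge0 => z _.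
by apply: loss_fun_ge0 => v; exact: (fW v).1.
Qed.

Lemma small_gain_diff f g p N : small_profile f -> small_profile g -> 0 <= N ->
  (forall v, `|f v - g v| <= N * bgt b v) ->
  `|gain b f f p - gain b g g p| <= 4 * eps * K * N * bgt b p.
Proof.
move=> sf sg N0 fg; have [i1 _] := small_gain_integrable p sf sf.
have [i2 _] := small_gain_integrable p sg sg.
have [mf fW] := sf; have [mg gW] := sg.
have e0 : 0 <= 2 * eps by rewrite mulr_ge0// ltW.
rewrite /gain -RintegralB//.
have -> : 4 * eps * K * N * bgt b p = (2 * eps * N) * (2 * K * bgt b p) by ring.
apply: (gain_diff_dominated HK _ _ _).2; first by apply: measurable_funB; exact: measurable_gain_fun.
  by rewrite mulr_ge0.
apply: aeT => z; rewrite /gain_fun -!mulrBr -mulrDr mulrCA normrM (ger0_norm (kern_ge0 _ _ _)).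
rewrite ler_wpM2l ?kern_ge0//.
set x := post_p p z.1 z.2; set y := post_q p z.1 z.2.
have [f1 f2] := fW y; have [g1 g2] := gW x.
have -> : f x * f y - g x * g y = (f x - g x) * f y + g x * (f y - g y) by ring.
apply: (le_trans (ler_normD _ _)); rewrite !normrM (ger0_norm f1) (ger0_norm g1) mulrDr.
have h1 := fg x; have h2 := fg y.
have B1 := bgt_ge0 b x; have B2 := bgt_ge0 b y; have W1 := wgt_ge0 x; have W2 := wgt_ge0 y.
rewrite lerD//.
  apply: (le_trans (ler_pM (normr_ge0 _) f1 h1 f2)).
  by le_ring.
apply: (le_trans (ler_pM g1 (normr_ge0 _) g2 h2)).
by le_ring.
Qed.

Lemma small_loss_diff f g p N : small_profile f -> small_profile g -> 0 <= N ->
  (forall v, `|f v - g v| <= N * bgt b v) ->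
  `|loss b f p - loss b g p| <= N * (K * norm3 p `^ (- (b / 2))).
Proof.
move=> sf sg N0 fg; have [i1 _] := small_loss_integrable p sf.
have [i2 _] := small_loss_integrable p sg.
have [mf fW] := sf; have [mg gW] := sg.
rewrite /loss -RintegralB//.
have -> : (\int[colm R]_z (loss_fun b f p z - loss_fun b g p z))%R = loss b (fun v => f v - g v) p.
  by apply: eq_Rintegral => z _; rewrite /loss_fun -mulrBr.
apply: (loss_diff_dominated HK _ _ _).2 => //; first exact: measurable_funB.
apply: aeT => z; rewrite /loss_fun normrM (ger0_norm (kern_ge0 _ _ _)) mulrCA.
by rewrite ler_wpM2l ?kern_ge0.
Qed.

(** The bound of the time derivative against [bgt b]: 4 eps^2 K from the gain, and 2 eps K times 2
    eps from the loss. *)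
Definition lip : R := 8 * eps ^+ 2 * K.

(** The Lipschitz condition makes [rate] and [source] continuous in time at each single p, so that
    the classical formula for a linear equation applies pointwise. The bounds hold at every p and at
    all real times, which keeps null sets out of the construction. *)
Definition profile_class (F : R -> R3 R -> R) : Prop :=
  [/\ measurable_fun setT (fun z : R3 R * mR => F z.2 z.1),
      forall t, small_profile (F t) &
      forall t s p, `|F t p - F s p| <= lip * `|t - s| * bgt b p].

Definition rate (F : R -> R3 R -> R) p t : R := loss b (F t) p.
Definition source (F : R -> R3 R -> R) p t : R := gain b (F t) (F t) p.

Let lip_ge0 : 0 <= lip.
Proof. by rewrite /lip !mulr_ge0 ?sqr_ge0// ltW. Qed.

Let lipschitz_continuous (h : R -> R) (c : R) :
  (forall t s, `|h t - h s| <= c * `|t - s|) -> continuous h.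
Proof.
move=> H t; apply/cvgrPdist_le => /= e e0.
have c0 : 0 < `|c| + 1 by rewrite ltr_wpDl.
near=> s.
apply: (le_trans (H t s)); apply: (@le_trans _ _ ((`|c| + 1) * `|t - s|)).
  by rewrite ler_wpM2r// (le_trans (ler_norm c))// lerDl.
rewrite -ler_pdivlMl// mulrC; near: s.
apply/nbhs_ballP; exists (e / (`|c| + 1)) => /=; first by rewrite divr_gt0.
by move=> s /=; rewrite /ball/= => /ltW.
Unshelve. all: by end_near. Qed.

Lemma rate_continuous F p : profile_class F -> continuous (rate F p).
Proof.
move=> [_ sF lF]; apply: (@lipschitz_continuous _ (lip * (K * norm3 p `^ (- (b / 2))))) => t s.
apply: (le_trans (small_loss_diff p (sF t) (sF s) _ (lF t s))); first by rewrite mulr_ge0.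
by le_ring.
Qed.

Lemma source_continuous F p : profile_class F -> continuous (source F p).
Proof.
move=> [_ sF lF]; apply: (@lipschitz_continuous _ (4 * eps * K * lip * bgt b p)) => t s.
apply: (le_trans (small_gain_diff p (sF t) (sF s) _ (lF t s))); first by rewrite mulr_ge0.
by le_ring.
Qed.

(** Freezing time outside [0, T] keeps the iterates in [profile_class], whose conditions concern all
    real times, while the estimates of the flow are made on [0, T]. *)
Definition clip (t : R) : R := Num.max 0 (Num.min t T).

Lemma clip_itv t : 0 <= clip t /\ clip t <= T.
Proof. by rewrite /clip le_max lexx ge_max (ltW T0) ge_min lexx orbT. Qed.

Lemma clip_id t : 0 <= t <= T -> clip t = t.
Proof. by move=> /andP[t0 tT]; rewrite /clip (min_l tT) max_r. Qed.

Lemma clip_lip t s : `|clip t - clip s| <= `|t - s|.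
Proof.
rewrite /clip.
have H x y : x <= y -> 0 <= Num.max 0 (Num.min y T) - Num.max 0 (Num.min x T) <= y - x.
  move=> xy; have [xT|xT] := leP x T; have [yT|yT] := leP y T.
  - by have [h1|h1] := leP 0 x; have [h2|h2] := leP 0 y; apply/andP; split; lra.
  - by have [h1|h1] := leP 0 x; have [h2|h2] := leP 0 T; apply/andP; split; lra.
  - by lra.
  - by rewrite subrr lexx subr_ge0.
have [ts|st] := leP t s.
  by have /andP[h1 h2] := H _ _ ts; rewrite distrC ger0_norm// distrC ger0_norm ?subr_ge0.
by have /andP[h1 h2] := H _ _ (ltW st); rewrite ger0_norm// ger0_norm ?subr_ge0// ltW.
Qed.

Definition flow (F : R -> R3 R -> R) (t : R) (p : R3 R) : R :=
  linear_sol (f0 p) (rate F p) (source F p) t.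

Definition picard (F : R -> R3 R -> R) (t : R) (p : R3 R) : R := flow F (clip t) p.

Lemma flow_derive F p (t : R) : profile_class F -> 0 <= t ->
  is_derive t 1 (fun s => flow F s p) (source F p t - rate F p t * flow F t p).
Proof.
move=> cF t0; apply: linear_sol_derive => //; [exact: rate_continuous|exact: source_continuous].
Qed.

Lemma rate_ge0 F p t : profile_class F -> 0 <= rate F p t.
Proof. by move=> [_ sF _]; exact: loss_ge0. Qed.

Lemma source_ge0 F p t : profile_class F -> 0 <= source F p t.
Proof. by move=> [_ sF _]; exact: gain_ge0. Qed.

Lemma source_le F p t : profile_class F -> source F p t <= 4 * eps ^+ 2 * K * wgt p.
Proof.
move=> [_ sF _]; have [_] := small_gain_integrable p (sF t) (sF t).
move=> /(le_trans (ler_norm _)) /le_trans; apply.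
by le_ring.
Qed.

Lemma flow_bounds F p (t : R) : profile_class F -> 0 <= t -> t <= T ->
  0 <= flow F t p /\ flow F t p <= 2 * eps * wgt p.
Proof.
move=> cF t0 tT; have [f00 f01] := f0W p; have W0 := wgt_ge0 p.
have e : flow F 0 p = f0 p by exact: linear_sol0.
have rc := @rate_continuous F p cF.
have rg x : 0 <= x -> 0 <= rate F p x by move=> _; exact: rate_ge0.
have dv (x : R) : 0 <= x -> is_derive x 1 (fun s => flow F s p) (source F p x - rate F p x * flow F x p).
  exact: flow_derive.
split.
  by apply: (linear_ode_ge0 rc rg _ _ dv) => //; [rewrite e|move=> x _; exact: source_ge0].
have eW : 0 <= eps * wgt p by rewrite mulr_ge0// ltW.
have K2 : 0 <= 4 * eps ^+ 2 * K by rewrite !mulr_ge0 ?sqr_ge0// ltW.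
have r0 : 0 <= 4 * eps ^+ 2 * K * wgt p by exact: mulr_ge0.
have z0 : flow F 0 p <= eps * wgt p by rewrite e.
have := linear_ode_le rc rg eW r0 z0 dv t0 (fun x _ _ => source_le p x cF).
move=> /le_trans; apply.
apply: (@le_trans _ _ (eps * wgt p + 4 * eps ^+ 2 * K * wgt p * T)); first by rewrite lerD2l ler_wpM2l.
(* Smallness gives 4 K eps T <= 1, so the bound on the datum at most doubles. *)
have -> : eps * wgt p + 4 * eps ^+ 2 * K * wgt p * T = eps * wgt p * (1 + 4 * K * eps * T) by ring.
have -> : 2 * eps * wgt p = eps * wgt p * 2 by ring.
rewrite ler_wpM2l//; move: small.
have : 0 <= K * eps * T by rewrite !mulr_ge0// ltW.
by rewrite -!mulrA; set A := K * (eps * T) => h1 h2; lra.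
Qed.

Lemma flow_rate_le F p (t : R) : profile_class F -> 0 <= t -> t <= T ->
  `|source F p t - rate F p t * flow F t p| <= lip * bgt b p.
Proof.
move=> cF t0 tT; have [y0 yW] := flow_bounds p cF t0 tT.
have [_ sF _] := cF; have W0 := wgt_ge0 p; have B0 := bgt_ge0 b p.
have s1 := source_le p t cF; have s0 := source_ge0 p t cF; have r0 := rate_ge0 p t cF.
have [_ r1] := small_loss_integrable p (sF t).
have {}r1 : rate F p t <= 2 * eps * (K * norm3 p `^ (- (b / 2))) by apply: le_trans r1; exact: ler_norm.
have e2 : 0 <= 4 * eps ^+ 2 * K by rewrite !mulr_ge0 ?sqr_ge0// ltW.
apply: (le_trans (ler_normB _ _)); have ry0 : 0 <= rate F p t * flow F t p by exact: mulr_ge0.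
rewrite (ger0_norm s0) (ger0_norm ry0).
have -> : lip * bgt b p = 4 * eps ^+ 2 * K * bgt b p + 4 * eps ^+ 2 * K * bgt b p by rewrite /lip; ring.
apply: lerD.
  by apply: (le_trans s1); apply: ler_wpM2l => //; exact: wgt_le_bgt.
apply: (le_trans (ler_pM r0 y0 r1 yW)).
have -> : 2 * eps * (K * norm3 p `^ (- (b / 2))) * (2 * eps * wgt p) =
  4 * eps ^+ 2 * K * (norm3 p `^ (- (b / 2)) * wgt p) by ring.
by apply: ler_wpM2l => //; exact: wgt_powR_le_bgt.
Qed.

Lemma flow_lip F p (t s : R) : profile_class F -> 0 <= s -> s <= t -> t <= T ->
  `|flow F t p - flow F s p| <= lip * bgt b p * (t - s).
Proof.
move=> cF s0 st tT; have ts0 : 0 <= t - s by rewrite subr_ge0.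
have [c [+ + ->]] := mean_value_ge0 (fun x => flow_derive p cF (t := x)) (le_trans s0 st) s0.
rewrite (min_r st) (max_l st) => sc ct.
rewrite normrM (ger0_norm ts0) ler_wpM2r//.
exact: (flow_rate_le p cF (le_trans s0 sc) (le_trans ct tT)).
Qed.

Lemma measurable_rate F : profile_class F ->
  measurable_fun setT (fun z : R3 R * mR => rate F z.1 z.2).
Proof.
move=> [mF sF _].
pose H (w : (R3 R * mR) * Z) : \bar R := (loss_fun b (F w.1.2) w.1.1 w.2)%:E.
have mH : measurable_fun setT H.
  apply/measurable_EFinP; apply: measurable_funM.
    by apply: measurable_kern; measurable_tac.
  have m : measurable_fun setT (fun w : (R3 R * mR) * Z => (w.2.1, w.1.2)) by measurable_tac.
  exact: (measurableT_comp mF m).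
have H0 w : (0 <= H w)%E.
  by rewrite lee_fin; apply: loss_fun_ge0 => v; have [_ /(_ v)[]] := sF w.1.2.
have mfub := @measurable_fun_fubini_tonelli_F _ _ _ _ R (colm R) H mH H0.
exact: (measurableT_comp (@fine_measurable R setT measurableT) mfub).
Qed.

Lemma measurable_source F : profile_class F ->
  measurable_fun setT (fun z : R3 R * mR => source F z.1 z.2).
Proof.
move=> [mF sF _].
pose H (w : (R3 R * mR) * Z) : \bar R := (gain_fun b (F w.1.2) (F w.1.2) w.1.1 w.2)%:E.
have mH : measurable_fun setT H.
  apply/measurable_EFinP; apply: measurable_funM.
    by apply: measurable_kern; measurable_tac.
  apply: measurable_funM.
    have m : measurable_fun setT (fun w : (R3 R * mR) * Z => (post_p w.1.1 w.2.1 w.2.2 : R3 R, w.1.2)).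
      by apply: measurable_fun_pair; [apply: measurable_post_p; measurable_tac|measurable_tac].
    exact: (measurableT_comp mF m).
  have m : measurable_fun setT (fun w : (R3 R * mR) * Z => (post_q w.1.1 w.2.1 w.2.2 : R3 R, w.1.2)).
    by apply: measurable_fun_pair; [apply: measurable_post_q; measurable_tac|measurable_tac].
  exact: (measurableT_comp mF m).
have H0 w : (0 <= H w)%E.
  by rewrite lee_fin; apply: gain_fun_ge0 => v; have [_ /(_ v)[]] := sF w.1.2.
have mfub := @measurable_fun_fubini_tonelli_F _ _ _ _ R (colm R) H mH H0.
exact: (measurableT_comp (@fine_measurable R setT measurableT) mfub).
Qed.

Lemma measurable_flow F d (S : measurableType d) (p : S -> R3 R) (t : S -> mR) :
  profile_class F -> measurable_fun setT p -> measurable_fun setT t ->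
  measurable_fun setT (fun x => flow F (t x) (p x)).
Proof.
move=> cF mp mt; have mr := measurable_rate cF; have ms := measurable_source cF.
have mprim d' (S' : measurableType d') (q : S' -> R3 R) (u : S' -> R) :
    measurable_fun setT q -> measurable_fun setT u ->
    measurable_fun setT (fun x => prim (rate F (q x)) (u x)).
  move=> mq mu.
  apply: (@measurable_prim _ _ _ (fun w : S' * mR => rate F (q w.1) w.2) u); last exact: mu.
    have m : measurable_fun setT (fun w : S' * mR => (q w.1, w.2)).
      by apply: measurable_fun_pair; [apply: (measurableT_comp mq); exact: measurable_fst|exact: measurable_snd].
    exact: (measurableT_comp mr m).
  by move=> w; exact: rate_ge0.
apply: measurable_funM.
  by apply: measurable_expRT; apply: measurable_oppT; exact: mprim.
apply: measurable_funD; first exact: (measurableT_comp mf0 mp).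
have mp1 : measurable_fun setT (fun w : S * mR => p w.1).
  by apply: (measurableT_comp mp); exact: measurable_fst.
apply: (@measurable_prim _ _ _ (fun w : S * mR =>
    expR (prim (rate F (p w.1)) (Num.max w.2 0)) * source F (p w.1) w.2) t) => //.
  apply: measurable_funM.
    apply: measurable_expRT; apply: (mprim _ _ (fun w : S * mR => p w.1) (fun w => Num.max w.2 0)) => //.
    by apply: measurable_maxr; [exact: measurable_snd|exact: measurable_cst].
  have m : measurable_fun setT (fun w : S * mR => (p w.1, w.2)).
    by apply: measurable_fun_pair => //; exact: measurable_snd.
  exact: (measurableT_comp ms m).
by move=> w; rewrite mulr_ge0 ?expR_ge0//; exact: source_ge0.
Qed.

Lemma measurable_clip : measurable_fun setT (clip : mR -> mR).
Proof.
apply: measurable_maxr; first exact: measurable_cst.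
by apply: measurable_minr; [exact: measurable_id|exact: measurable_cst].
Qed.

Lemma picard_class F : profile_class F -> profile_class (picard F).
Proof.
move=> cF; split.
- have mc : measurable_fun setT (fun z : R3 R * mR => clip z.2 : mR).
    exact: (measurableT_comp measurable_clip measurable_snd).
  exact: (measurable_flow cF measurable_fst mc).
- move=> t; have [c0 cT] := clip_itv t; split.
    by apply: (measurable_flow (p := id) (t := cst (clip t))).
  by move=> p; exact: flow_bounds.
- move=> t s p; have [t0 tT] := clip_itv t; have [s0 sT] := clip_itv s.
  apply: (@le_trans _ _ (lip * `|clip t - clip s| * bgt b p)); last first.
    by rewrite ler_wpM2r ?bgt_ge0// ler_wpM2l// clip_lip.
  rewrite mulrAC /picard; have [st|ts] := leP (clip s) (clip t).
    by rewrite (ger0_norm (_ : 0 <= clip t - clip s)) ?subr_ge0//; exact: flow_lip.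
  rewrite distrC (distrC (clip t)) (ger0_norm (_ : 0 <= clip s - clip t)) ?subr_ge0 ?(ltW ts)//.
  by apply: flow_lip => //; exact: ltW.
Qed.

Lemma picard_contracting F G N : profile_class F -> profile_class G -> 0 <= N ->
  (forall t p, `|F t p - G t p| <= N * bgt b p) ->
  forall t p, `|picard F t p - picard G t p| <= N / 2 * bgt b p.
Proof.
move=> cF cG N0 FG t p; rewrite /picard.
have [] := clip_itv t; move: (clip t) => {}t t0 tT.
have [_ sF _] := cF; have [_ sG _] := cG; have B0 := bgt_ge0 b p.
(* In this form the difference of the flows is damped by [rate F], and the difference of the rates
   multiplies [flow G], where |p|^(-b/2) [wgt] <= [bgt b] absorbs the singularity. *)
pose r x := (source F p x - source G p x) - (rate F p x - rate G p x) * flow G x p.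
have dz (x : R) : 0 <= x -> is_derive x 1 (fun s => flow F s p - flow G s p)
    (r x - rate F p x * (flow F x p - flow G x p)).
  move=> x0; apply: (is_derive_eq (is_deriveB (flow_derive p cF x0) (flow_derive p cG x0))).
  rewrite /r; move: (flow F x p) (flow G x p) (source F p x) (source G p x) (rate F p x) (rate G p x).
  by move=> y1 y2 s1 s2 r1 r2; ring.
have rle x : 0 <= x -> x <= T -> `|r x| <= 6 * eps * K * N * bgt b p.
  move=> x0 xT; have [y0 yW] := flow_bounds p cG x0 xT.
  have h1 := small_gain_diff p (sF x) (sG x) N0 (FG x).
  have h2 := small_loss_diff p (sF x) (sG x) N0 (FG x).
  apply: (le_trans (ler_normB _ _)).
  have -> : 6 * eps * K * N * bgt b p = 4 * eps * K * N * bgt b p + 2 * eps * K * N * bgt b p by ring.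
  apply: lerD => //; rewrite normrM (ger0_norm y0).
  apply: (le_trans (ler_pM (normr_ge0 _) y0 h2 yW)).
  have -> : N * (K * norm3 p `^ (- (b / 2))) * (2 * eps * wgt p) =
    2 * eps * K * N * (norm3 p `^ (- (b / 2)) * wgt p) by ring.
  have ceK : 0 <= 2 * eps * K * N by rewrite !mulr_ge0// ltW.
  by apply: ler_wpM2l => //; exact: wgt_powR_le_bgt.
have rho0 : 0 <= 6 * eps * K * N * bgt b p.
  by apply: mulr_ge0 => //; rewrite !mulr_ge0// ltW.
have z0 : `|flow F 0 p - flow G 0 p| <= 0 by rewrite /flow !linear_sol0 subrr normr0.
have rg x : 0 <= x -> 0 <= rate F p x by move=> _; exact: rate_ge0.
have := linear_ode_norm (@rate_continuous F p cF) rg (lexx 0) rho0 z0 dz t0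
  (fun x x0 xt => rle x x0 (le_trans xt tT)).
move=> /le_trans; apply; rewrite add0r.
apply: (@le_trans _ _ (6 * eps * K * N * bgt b p * T)); first by rewrite ler_wpM2l.
have -> : 6 * eps * K * N * bgt b p * T = 12 * K * eps * T * (N / 2 * bgt b p) by field.
by rewrite ler_piMl// mulr_ge0// divr_ge0.
Qed.

Let F0 (t : R) : R3 R -> R := f0.

Let F0_class : profile_class F0.
Proof.
split.
- by apply: (measurableT_comp mf0); exact: measurable_fst.
- move=> t; split => // p; have [h1 h2] := f0W p; split => //; apply: (le_trans h2).
  by rewrite ler_wpM2r ?wgt_ge0// ler_peMl ?ler1n// ltW.
- by move=> t s p; rewrite subrr normr0; apply: mulr_ge0; [exact: mulr_ge0|exact: bgt_ge0].
Qed.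

Lemma picard_fixpoint : exists F, profile_class F /\ forall t p, picard F t p = F t p.
Proof.
pose Fn n := iter n picard F0.
have cFn n : profile_class (Fn n) by elim: n => [|n IH] //; exact: picard_class.
have e0 : 0 <= 2 * eps by rewrite mulr_ge0// ltW.
have e4 : 0 <= 4 * eps by rewrite mulr_ge0// ltW.
have e8 : 0 <= 8 * eps by rewrite mulr_ge0// ltW.
(* The first two iterates lie between 0 and 2 eps [wgt], whence the initial constant 2 eps; each
   further step halves it. *)
have step n t p : `|Fn n.+1 t p - Fn n t p| <= 2 * eps * 2^-1 ^+ n * bgt b p.
  elim: n t p => [|n IH] t p.
    rewrite expr0 mulr1; have [_ /(_ t)[_ /(_ p)[h1 h2]] _] := cFn 1%N.
    have [_ /(_ t)[_ /(_ p)[h3 h4]] _] := cFn 0%N.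
    apply: (@le_trans _ _ (2 * eps * wgt p)); last by rewrite ler_wpM2l// wgt_le_bgt.
    have dist_le (x y A : R) : 0 <= x -> x <= A -> 0 <= y -> y <= A -> `|x - y| <= A.
      by move=> x0 xA y0 yA; rewrite ler_norml; apply/andP; split; lra.
    exact: dist_le.
  have c0 : 0 <= 2 * eps * 2^-1 ^+ n by rewrite mulr_ge0// exprn_ge0// invr_ge0.
  have -> : 2 * eps * 2^-1 ^+ n.+1 = 2 * eps * 2^-1 ^+ n / 2 by rewrite exprSr mulrA.
  exact: (picard_contracting (cFn n.+1) (cFn n) c0 IH t p).
have cau t p := @geometric_cauchy R (fun n => Fn n t p) (2 * eps * bgt b p)
  (mulr_ge0 e0 (bgt_ge0 b p)).
have {}cau t p : cvg ((fun n => Fn n t p) @ \oo) /\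
    forall n, `|limn (fun n => Fn n t p) - Fn n t p| <= 2 * (2 * eps * bgt b p) * 2^-1 ^+ n.
  by apply: cau => n; rewrite mulrAC; exact: step.
pose F t p := limn (fun n => Fn n t p).
have FB n t p : `|F t p - Fn n t p| <= 4 * eps * 2^-1 ^+ n * bgt b p.
  apply: (le_trans ((cau t p).2 n)).
  by le_ring.
have cF : profile_class F.
  split.
  - apply: (@measurable_fun_cvg _ _ _ _ (fun n (z : R3 R * mR) => Fn n z.2 z.1)).
      by move=> n; have [] := cFn n.
    by move=> z _; exact: (cau z.2 z.1).1.
  - move=> t; split.
      apply: (@measurable_fun_cvg _ _ _ _ (fun n p => Fn n t p)).
        by move=> n; have [_ /(_ t)[]] := cFn n.
      by move=> p _; exact: (cau t p).1.
    move=> p; have c0 := mulr_ge0 e4 (bgt_ge0 b p).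
    split; apply: (le_geometric c0) => n; have := FB n t p; have [_ /(_ t)[_ /(_ p)[h1 h2]] _] := cFn n;
      rewrite mulrAC ler_norml => /andP[h3 h4].
      by rewrite -[leLHS](addNr (4 * eps * bgt b p * 2^-1 ^+ n)) lerD2r (le_trans h3)// gerBl.
    by move: h4; rewrite lerBlDr => /le_trans; apply; rewrite addrC lerD2r.
  - move=> t s p; have c0 := mulr_ge0 e8 (bgt_ge0 b p).
    apply: (le_geometric c0) => n.
    have [_ _ /(_ t s p) h] := cFn n; have h1 := FB n t p; have h2 := FB n s p.
    have -> : F t p - F s p = (Fn n t p - Fn n s p) + ((F t p - Fn n t p) - (F s p - Fn n s p)) by ring.
    apply: (le_trans (ler_normD _ _)); apply: lerD => //.
    apply: (le_trans (ler_normB _ _)); apply: (le_trans (lerD h1 h2)).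
    by le_ring.
(* The limit and its Picard image are both close to [Fn n.+1], the latter by contraction. *)
exists F; split => // t p; apply/eqP; rewrite -subr_eq0 -normr_eq0; apply/eqP/le_anti.
rewrite normr_ge0 andbT.
have c0 := mulr_ge0 e4 (bgt_ge0 b p).
apply: (le_geometric c0) => n; rewrite add0r.
have h1 := picard_contracting cF (cFn n) _ (FB n) t p.
have {}h1 := h1 ltac:(by rewrite !mulr_ge0 ?exprn_ge0 ?invr_ge0// ltW).
have h2 := FB n.+1 t p.
have -> : picard F t p - F t p = (picard F t p - Fn n.+1 t p) - (F t p - Fn n.+1 t p) by ring.
apply: (le_trans (ler_normB _ _)); apply: (le_trans (lerD h1 h2)).
by rewrite exprS le_eqVlt; apply/orP; left; apply/eqP; field.
Qed.

End picard.

(** * The solution as a curve in X *)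

Section time_change.
Variable R : realType.
Variables (b cR t0 : R).
Hypotheses (b0 : 0 < b) (b1 : b < 1) (cR0 : 0 < cR) (t00 : 0 < t0).

Definition rate_factor (t : R) : R := scale_factor cR t0 t `^ (- 3 + b).

(** R(t)^(-3+b) is a multiple of (t + t0)^(-(k + 1)), and k > 0 makes it integrable at infinity. *)
Let k := (1 - b) / 2.
Let k0 : 0 < k. Proof. by rewrite divr_gt0// subr_gt0. Qed.
Let c := cR `^ (- 3 + b).
Let c0 : 0 < c. Proof. exact: powR_gt0. Qed.

Lemma rate_factor_ge0 (t : R) : 0 <= rate_factor t. Proof. exact: powR_ge0. Qed.

Let rate_factorE (t : R) : 0 < t + t0 -> rate_factor t = c * (t + t0) `^ (- (k + 1)).
Proof.
move=> tt; rewrite /rate_factor /scale_factor powRM ?powR_ge0 ?(ltW cR0)//.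
by rewrite -powRrM; congr (_ * _ `^ _); rewrite /k; field.
Qed.

Let derive_pow (s : R) (t : R) : 0 < t + t0 ->
  is_derive t 1 (fun t => (t + t0) `^ s) (s * (t + t0) `^ (s - 1)).
Proof.
move=> tt; have d1 : is_derive t 1 (fun t => t + t0) 1.
  by rewrite -[X in is_derive _ _ _ X]addr0; apply: is_deriveD.
have d2 := @is_derive1_powR R s _ tt.
have := @is_derive1_comp _ (fun x : R => x `^ s) (fun t => t + t0) t _ _ d2 d1.
by rewrite mulr1.
Qed.

Definition conformal_time (t : R) : R := c / k * (t0 `^ (- k) - (t + t0) `^ (- k)).

Lemma conformal_time0 : conformal_time 0 = 0.
Proof. by rewrite /conformal_time add0r subrr mulr0. Qed.

Let tt0 (t : R) : 0 <= t -> 0 < t + t0. Proof. by move=> t1; rewrite ltr_wpDl. Qed.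

Lemma conformal_time_derive (t : R) : 0 <= t -> is_derive t 1 conformal_time (rate_factor t).
Proof.
move=> t1; have h := tt0 t1; rewrite (rate_factorE h).
have d := is_deriveB (is_derive_cst (t0 `^ (- k)) t 1) (derive_pow (- k) h).
apply: (is_derive_eq (is_deriveZ (c / k) d)).
rewrite /GRing.scale/= sub0r opprD mulNr opprK; field; exact: lt0r_neq0.
Qed.

(** The limit of [conformal_time] at infinity, finite since the exponent [- k] is negative. *)
Definition total_time : R := c / k * t0 `^ (- k).

Lemma total_time_gt0 : 0 < total_time.
Proof. by rewrite mulr_gt0 ?powR_gt0// divr_gt0. Qed.

Lemma conformal_time_itv (t : R) : 0 <= t -> 0 <= conformal_time t <= total_time.
Proof.
move=> t1; have ck : 0 <= c / k by rewrite divr_ge0// ltW.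
rewrite /conformal_time /total_time ler_wpM2l ?gerBl ?powR_ge0// andbT.
by rewrite mulr_ge0// subr_ge0; apply: powRN_le; rewrite ?(ltW k0)// lerDr.
Qed.

Lemma rate_factor_anti (s t : R) : 0 <= s -> s <= t -> rate_factor t <= rate_factor s.
Proof.
move=> s0 st; rewrite !rate_factorE ?tt0 ?(le_trans s0 st)//.
rewrite ler_wpM2l ?(ltW c0)//; apply: powRN_le; rewrite ?tt0 ?lerD2r//.
by rewrite addr_ge0// ltW.
Qed.

Lemma rate_factor_lip : exists2 L : R, 0 <= L &
  forall s t, 0 <= s -> 0 <= t -> `|rate_factor s - rate_factor t| <= L * `|s - t|.
Proof.
pose L := c * ((k + 1) * t0 `^ (- (k + 2))).
have k1 : 0 <= k + 1 by rewrite addr_ge0// ltW.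
have L0 : 0 <= L by rewrite mulr_ge0 ?(ltW c0)// mulr_ge0 ?powR_ge0.
exists L => // s t s0 t1.
have dh (x : R) : 0 <= x -> is_derive x 1 (fun t => c * (t + t0) `^ (- (k + 1)))
    (c * (- (k + 1) * (x + t0) `^ (- (k + 2)))).
  move=> x0; have := is_deriveZ c (derive_pow (- (k + 1)) (tt0 x0)).
  by rewrite (_ : - (k + 1) - 1 = - (k + 2)); last by ring.
have [x [+ _ ]] := mean_value_ge0 dh s0 t1.
rewrite -!rate_factorE ?tt0// => stx ->.
have x0 : 0 <= x by apply: le_trans stx; rewrite le_min s0.
rewrite normrM ler_wpM2r// normrM (gtr0_norm c0) ler_wpM2l ?(ltW c0)//.
rewrite normrM normrN (ger0_norm k1) ler_wpM2l// ger0_norm ?powR_ge0//.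
by apply: powRN_le => //; [rewrite addr_ge0// ltW|rewrite lerDr].
Qed.

End time_change.

Section norms.
Variable R : realType.
Variable b : R.
Hypotheses (b0 : 0 < b) (b1 : b < 1).
Implicit Types (p : R3 R) (g : R3 R -> R).

(** The second summand is |p|^(-b/2) B, which appears when the loss frequency multiplies a time
    difference of the solution. Divided by |p| once more, its exponent 2 + b is still below 3, so it
    is integrable. *)
Definition cgt p : R := bgt b p + powR_exp3 (1 + b) 2^-1 p.

Lemma cgt_ge0 p : 0 <= cgt p.
Proof. by apply: addr_ge0; exact: powR_exp3_ge0. Qed.

Lemma measurable_cgt : measurable_fun setT cgt.
Proof. by apply: measurable_funD; [exact: measurable_bgt|exact: measurable_powR_exp3]. Qed.

Lemma bgt_le_cgt p : bgt b p <= cgt p.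
Proof. by rewrite lerDl powR_exp3_ge0. Qed.

Let powR_exp3M (s k r : R) p : s != 0 -> s + r != 0 ->
  powR_exp3 s k p * norm3 p `^ (- r) = powR_exp3 (s + r) k p.
Proof.
move=> s0 sr; rewrite /powR_exp3; have [->|p0] := eqVneq (norm3 p) 0.
  have ns : - s != 0 by rewrite oppr_eq0.
  have nsr : - (s + r) != 0 by rewrite oppr_eq0.
  by rewrite (powR0 ns) (powR0 nsr) !mul0r.
by rewrite mulrAC opprD powRD// p0 implybT.
Qed.

Lemma L1norm_cgt r : 0 <= r -> r <= 1 -> (L1norm (- r) cgt < +oo)%E.
Proof.
move=> r0 r1; have h : 0 < 2^-1 :> R by rewrite invr_gt0.
have e p : `|cgt p| * norm3 p `^ (- r) =
    powR_exp3 (1 + b / 2 + r) 2^-1 p + powR_exp3 (1 + b + r) 2^-1 p.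
  have b2 : 0 <= b / 2 by rewrite divr_ge0// ltW.
  have n1 : 1 + b / 2 != 0 by rewrite gt_eqF// ltr_pwDl.
  have n2 : 1 + b != 0 by rewrite gt_eqF// addr_gt0.
  have n3 : 1 + b / 2 + r != 0 by rewrite gt_eqF// ltr_pwDl// ltr_pwDl.
  have n4 : 1 + b + r != 0 by rewrite gt_eqF// ltr_pwDl// addr_gt0.
  by rewrite (ger0_norm (cgt_ge0 p)) mulrDl !powR_exp3M.
have -> : L1norm (- r) cgt = (\int[leb3 R]_p ((powR_exp3 (1 + b / 2 + r) 2^-1 p)%:E +
    (powR_exp3 (1 + b + r) 2^-1 p)%:E))%E.
  by apply: eq_integral => p _; rewrite e EFinD.
rewrite ge0_integralD//.
- apply: lte_add_pinfty; apply: integral_powR_exp3_lty => //; move: (b0) (b1) => ? ?; lra.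
- by move=> p _; rewrite lee_fin powR_exp3_ge0.
- by apply/measurable_EFinP; exact: measurable_powR_exp3.
- by move=> p _; rewrite lee_fin powR_exp3_ge0.
- by apply/measurable_EFinP; exact: measurable_powR_exp3.
Qed.

Definition X_const : R := fine (X_norm cgt).

Let L1norm_le r g (c : R) : measurable_fun setT g -> 0 <= c ->
  (forall p, `|g p| <= c * cgt p) -> (L1norm r g <= c%:E * L1norm r cgt)%E.
Proof.
move=> mg c0 gc; have mn : measurable_fun setT (fun p : R3 R => norm3 p `^ r).
  by apply: measurable_powRT; apply: measurable_norm3; exact: measurable_id.
rewrite /L1norm -ge0_integralZl//; last 2 first.
- apply/measurable_EFinP; apply: measurable_funM => //.
  by apply: measurable_normrT; exact: measurable_cgt.
- by move=> p _; rewrite lee_fin mulr_ge0// powR_ge0.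
apply: ge0_le_integral.
- exact: measurableT.
- by move=> p _; rewrite lee_fin mulr_ge0// powR_ge0.
- apply/measurable_EFinP; apply: measurable_funM => //; exact: measurable_normrT.
- apply: emeasurable_funM; first exact: measurable_cst.
  apply/measurable_EFinP; apply: measurable_funM => //.
  by apply: measurable_normrT; exact: measurable_cgt.
- move=> p _; rewrite -EFinM lee_fin mulrA ler_wpM2r ?powR_ge0//.
  by rewrite (le_trans (gc p))// ler_wpM2l// ler_norm.
Qed.

Let L10 : (L1norm 0 cgt < +oo)%E. Proof. by rewrite -oppr0; exact: L1norm_cgt. Qed.
Let L11 : (L1norm (-1) cgt < +oo)%E. Proof. exact: L1norm_cgt. Qed.

Let L1norm_ge0 r g : (0 <= L1norm r g)%E.
Proof. by apply: integral_ge0 => p _; rewrite lee_fin mulr_ge0 ?powR_ge0. Qed.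

Lemma in_X_dominated g (c : R) : measurable_fun setT g -> 0 <= c ->
  (forall p, `|g p| <= c * cgt p) -> in_X g.
Proof.
move=> mg c0 gc; have c0' : (0 <= c%:E)%E by rewrite lee_fin.
have cf : (c%:E \is a fin_num)%E by [].
split; split; [exact: mg| |exact: mg|].
- exact: (le_lt_trans (L1norm_le 0 mg c0 gc) (lte_mul_pinfty c0' cf L10)).
- exact: (le_lt_trans (L1norm_le (-1) mg c0 gc) (lte_mul_pinfty c0' cf L11)).
Qed.

Lemma X_norm_dominated g (c : R) : measurable_fun setT g -> 0 <= c ->
  (forall p, `|g p| <= c * cgt p) -> (0 <= X_norm g <= (c * X_const)%:E)%E.
Proof.
move=> mg c0 gc; apply/andP; split; first by rewrite adde_ge0.
have fin : (X_norm cgt \is a fin_num)%E.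
  rewrite ge0_fin_numE; first exact: (lte_add_pinfty L10 L11).
  by rewrite adde_ge0.
rewrite EFinM /X_const (fineK fin) /X_norm ge0_muleDr//.
by apply: leeD; exact: L1norm_le.
Qed.

End norms.

Section real_helpers.
Variable R : realType.

Lemma squeeze_dist (G : set_system R) {FG : Filter G} (t c : R) (h : R -> \bar R) :
  G --> t -> (\forall s \near G, (0 <= h s <= (c * `|s - t|)%:E)%E) -> h @ G --> 0%E.
Proof.
move=> Gt H; apply: (squeeze_cvge H); first exact: cvg_cst.
apply: cvg_EFin; first exact: nearW.
rewrite -[X in _ --> X](mulr0 c); apply: cvgMr.
rewrite -[X in _ --> X](@normr0 _ R) -(subrr t); apply: cvg_norm.
by apply: cvgB => //; exact: cvg_cst.
Qed.

End real_helpers.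

Section collision_integral.
Variables (R : realType) (b : R).

(** Separate integrability of gain and loss permits splitting the collision integral and passing
    from the iterated integral to the integral over the product. *)
Lemma collision_integralE (u : R3 R -> R) p :
  (colm R).-integrable setT (EFin \o gain_fun b u u p) ->
  (colm R).-integrable setT (EFin \o loss_fun b u p) ->
  (colm R).-integrable setT (fun z => (collision_integrand b u p z.1 z.2)%:E) /\
  (\int[leb3 R]_q \int[sphere_measure R]_w (collision_integrand b u p q w)%:E =
   (gain b u u p - u p * loss b u p)%:E)%E.
Proof.
move=> ig il.
have il' : (colm R).-integrable setT (EFin \o (fun z => u p * loss_fun b u p z)).
  by have := integrableZl measurableT (u p) il.
have e z : collision_integrand b u p z.1 z.2 = gain_fun b u u p z - u p * loss_fun b u p z.
  rewrite /collision_integrand /gain_fun /loss_fun -/(kern b p z.1).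
  by rewrite mulrBr (mulrCA (u p)).
have ic : (colm R).-integrable setT (fun z => (collision_integrand b u p z.1 z.2)%:E).
  have := integrableB measurableT ig il'; apply: eq_integrable; first exact: measurableT.
  by move=> z _; rewrite /= e EFinB.
split; first exact: ic.
have -> : (\int[leb3 R]_q \int[sphere_measure R]_w (collision_integrand b u p q w)%:E =
    \int[colm R]_z (collision_integrand b u p z.1 z.2)%:E)%E.
  exact: (@integral12_prod_meas1 _ _ _ _ R (leb3 R) (sphere_measure R) _ ic).
have <- : (\int[colm R]_z (gain_fun b u u p z - u p * loss_fun b u p z))%R =
    gain b u u p - u p * loss b u p.
  apply: (etrans (RintegralB measurableT ig il')); congr (_ - _).
  exact: (RintegralZl (u p) measurableT il).
rewrite /Rintegral fineK; first by apply: eq_integral => z _; rewrite e.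
have := integrable_fin_num measurableT (integrableB measurableT ig il').
by congr (_ \is a fin_num); apply: eq_integral => z _; rewrite EFinB.
Qed.

End collision_integral.

(** * Regularity of the constructed solution *)

Section existence.
Variable R : realType.
Notation mR := (measurableTypeR R).
Variables (b cR t0 K eps : R).
Hypotheses (b0 : 0 < b) (b1 : b < 1) (cR0 : 0 < cR) (t00 : 0 < t0).
Hypotheses (K0 : 0 < K) (eps0 : 0 < eps).
Hypothesis HK : collision_bounded b K.
Let T := total_time b cR t0.
Let T0 : 0 < T. Proof. exact: total_time_gt0. Qed.
Hypothesis small : 12 * K * eps * total_time b cR t0 <= 1.
Variable f0 : R3 R -> R.
Hypotheses (mf0 : measurable_fun setT f0)
  (f0W : forall p, 0 <= f0 p /\ f0 p <= eps * wgt p).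

Let a := rate_factor b cR t0.
Let tau := conformal_time b cR t0.
Variable F : R -> R3 R -> R.
Hypotheses (cF : profile_class b K eps F)
  (FP : forall t p, picard b T f0 F t p = F t p).

(** Built from [flow] and not from [F]: the two agree on [0, T], but [F] is frozen outside, whereas
    [flow] is differentiable at every nonnegative time, endpoints of [0, T] included. *)
Definition solution (t : R) (p : R3 R) : R := flow b f0 F (tau t) p.

Definition collision_rate (x : R) (p : R3 R) : R :=
  source b F p x - rate b F p x * flow b f0 F x p.

Definition solution_derivative (t : R) (p : R3 R) : R := a t * collision_rate (tau t) p.

Let tau_itv t : 0 <= t -> 0 <= tau t /\ tau t <= T.
Proof. by move=> t1; have /andP[] := conformal_time_itv b1 cR0 t00 t1. Qed.

Let flowE x p : 0 <= x -> x <= T -> flow b f0 F x p = F x p.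
Proof. by move=> x0 xT; rewrite -FP /picard clip_id// x0. Qed.

Let flow_class x y p : 0 <= x -> x <= T -> 0 <= y -> y <= T ->
  `|flow b f0 F x p - flow b f0 F y p| <= lip K eps * `|x - y| * bgt b p.
Proof. by move=> x0 xT y0 yT; rewrite !flowE//; have [_ _] := cF; exact. Qed.

Lemma solution_bounds t p : 0 <= t ->
  0 <= solution t p /\ solution t p <= 2 * eps * wgt p.
Proof.
move=> t1; have [h1 h2] := tau_itv t1.
exact: (flow_bounds K0 eps0 T0 HK small f0W p cF h1 h2).
Qed.

Let flow_meas x : measurable_fun setT (flow b f0 F x).
Proof.
exact: (measurable_flow (p := id) (t := cst (x : mR)) mf0 cF (@measurable_id _ _ _) (@measurable_cst _ _ _ _ _ _)).
Qed.

Lemma measurable_solution t : measurable_fun setT (solution t).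
Proof. exact: flow_meas. Qed.

Lemma small_profile_solution t : 0 <= t -> small_profile eps (solution t).
Proof. by move=> t1; split; [exact: measurable_solution|move=> p; exact: solution_bounds]. Qed.

Lemma measurable_solution_derivative t : measurable_fun setT (solution_derivative t).
Proof.
have m : measurable_fun setT (fun p : R3 R => (p, tau t : mR)) by exact: measurable_fun_pair.
apply: measurable_funM; first exact: measurable_cst.
apply: measurable_funB.
  exact: (measurableT_comp (measurable_source cF) m).
apply: measurable_funM; last exact: flow_meas.
exact: (measurableT_comp (measurable_rate cF) m).
Qed.

Lemma solution_derive t p : 0 <= t ->
  is_derive (t : R) 1 (fun t => solution t p) (solution_derivative t p).
Proof.
move=> t1; have [h1 _] := tau_itv t1.
have d1 := conformal_time_derive b1 cR0 t00 t1.
have d2 := flow_derive K0 eps0 HK f0 p cF h1.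
have := @is_derive1_comp _ (fun x => flow b f0 F x p) tau t _ _ d2 d1.
by rewrite mulrC.
Qed.

Let eK0 : 0 <= eps * K. Proof. by rewrite mulr_ge0// ltW. Qed.
Let lip0 : 0 <= lip K eps. Proof. by rewrite /lip !mulr_ge0 ?sqr_ge0// ltW. Qed.

Let powR_bgt p : norm3 p `^ (- (b / 2)) * bgt b p = powR_exp3 (1 + b) 2^-1 p.
Proof.
rewrite /bgt /powR_exp3; have b2 : 0 <= b / 2 by rewrite divr_ge0// ltW.
have [->|p0] := eqVneq (norm3 p) 0.
  have n1 : - (1 + b / 2) != 0 by rewrite oppr_eq0 gt_eqF// ltr_pwDl.
  have n2 : - (1 + b) != 0 by rewrite oppr_eq0 gt_eqF// addr_gt0.
  by rewrite (powR0 n1) (powR0 n2) !mul0r mulr0.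
rewrite mulrA -powRD ?p0 ?implybT//; congr (_ `^ _ * _); by field.
Qed.

(** The difference of the gains, and that of the loss frequencies multiplied by the flow, cost
    [bgt b]; the loss frequency acting on the difference of the flows costs |p|^(-b/2) [bgt b], the
    second part of [cgt b]. The constant 8 is a common bound for 4 + 2 and 2. *)
Lemma collision_rate_lip x y p : 0 <= x -> x <= T -> 0 <= y -> y <= T ->
  `|collision_rate x p - collision_rate y p| <= 8 * eps * K * lip K eps * `|x - y| * cgt b p.
Proof.
move=> x0 xT y0 yT; have [_ sF lF] := cF.
have N0 : 0 <= lip K eps * `|x - y| by rewrite mulr_ge0.
have h1 := small_gain_diff eps0 HK p (sF x) (sF y) N0 (lF x y).
have h2 := small_loss_diff eps0 HK p (sF x) (sF y) N0 (lF x y).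
have h3 := flow_class p x0 xT y0 yT.
have [f1 f2] := flow_bounds K0 eps0 T0 HK small f0W p cF x0 xT.
have r0 := rate_ge0 p y cF.
have [_ r1] := small_loss_integrable eps0 HK p (sF y).
have {}r1 : rate b F p y <= 2 * eps * (K * norm3 p `^ (- (b / 2))) by apply: le_trans r1; exact: ler_norm.
have -> : collision_rate x p - collision_rate y p = (source b F p x - source b F p y)
   - (rate b F p x - rate b F p y) * flow b f0 F x p
   - rate b F p y * (flow b f0 F x p - flow b f0 F y p).
  rewrite /collision_rate; move: (source b F p x) (source b F p y) (rate b F p x) (rate b F p y)
    (flow b f0 F x p) (flow b f0 F y p) => *; ring.
set N := lip K eps * `|x - y| in N0 h1 h2 h3.
set P := norm3 p `^ (- (b / 2)) in h2 r1.
have PW := wgt_powR_le_bgt b0 p; have PB := powR_bgt p; rewrite -/P in PW PB.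
have hP : 0 <= powR_exp3 (1 + b) 2^-1 p by exact: powR_exp3_ge0.
have hB := bgt_ge0 b p.
have k2 : `|(rate b F p x - rate b F p y) * flow b f0 F x p| <= 2 * (eps * K * N) * bgt b p.
  rewrite normrM (ger0_norm f1); apply: (le_trans (ler_pM (normr_ge0 _) f1 h2 f2)).
  have -> : N * (K * P) * (2 * eps * wgt p) = 2 * (eps * K * N) * (P * wgt p) by ring.
  by apply: ler_wpM2l => //; rewrite mulr_ge0// mulr_ge0.
have k3 : `|rate b F p y * (flow b f0 F x p - flow b f0 F y p)| <=
    2 * (eps * K * N) * powR_exp3 (1 + b) 2^-1 p.
  rewrite normrM (ger0_norm r0); apply: (le_trans (ler_pM r0 (normr_ge0 _) r1 h3)).
  by rewrite -PB le_eqVlt; apply/orP; left; apply/eqP; ring.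
apply: (le_trans (ler_normB _ _)); apply: (le_trans (lerD (ler_normB _ _) k3)).
apply: (le_trans (lerD (lerD h1 k2) (lexx _))).
have -> : 8 * eps * K * lip K eps * `|x - y| * cgt b p =
    8 * (eps * K * N * bgt b p) + 8 * (eps * K * N * powR_exp3 (1 + b) 2^-1 p).
  by rewrite /cgt /N; ring.
have -> : 4 * eps * K * N * bgt b p + 2 * (eps * K * N) * bgt b p = 6 * (eps * K * N * bgt b p) by ring.
rewrite -[2 * (eps * K * N) * _]mulrA; have eN : 0 <= eps * K * N by exact: mulr_ge0.
by apply: lerD; rewrite ler_wpM2r ?ler_nat//; exact: mulr_ge0.
Qed.

Let A := a 0.
Let A0 : 0 <= A. Proof. exact: rate_factor_ge0. Qed.
Let aA t : 0 <= t -> 0 <= a t /\ a t <= A.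
Proof. by move=> t1; split; [exact: rate_factor_ge0|exact: (rate_factor_anti b1 cR0 t00 (lexx 0) t1)]. Qed.

Let tau_lip s t : 0 <= s -> 0 <= t -> `|tau s - tau t| <= A * `|s - t|.
Proof.
move=> s0 t1; have [c [c1 _ ->]] := mean_value_ge0 (conformal_time_derive b1 cR0 t00) s0 t1.
have c0 : 0 <= c by apply: le_trans c1; rewrite le_min s0.
have [h1 h2] := aA c0; have := ler_wpM2r (normr_ge0 (s - t)) h2.
by rewrite normrM (ger0_norm h1).
Qed.

Lemma collision_rate_le x p : 0 <= x -> x <= T -> `|collision_rate x p| <= lip K eps * bgt b p.
Proof. exact: flow_rate_le. Qed.

Lemma solution_derivative_lip : exists2 D : R, 0 <= D & forall s t p, 0 <= s -> 0 <= t ->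
  `|solution_derivative s p - solution_derivative t p| <= D * `|s - t| * cgt b p.
Proof.
have [L L0 HL] := rate_factor_lip b1 cR0 t00.
pose D1 := 8 * eps * K * lip K eps.
have D10 : 0 <= D1 by rewrite /D1 -(mulrA 8) mulr_ge0// mulr_ge0.
exists (L * lip K eps + A * (D1 * A)); first by apply: addr_ge0; apply: mulr_ge0 => //; exact: mulr_ge0.
move=> s t p s0 t1; have [x0 xT] := tau_itv s0; have [y0 yT] := tau_itv t1.
have C0 := cgt_ge0 b p; have [a1 a2] := aA t1.
have -> : solution_derivative s p - solution_derivative t p =
    (a s - a t) * collision_rate (tau s) p +
    a t * (collision_rate (tau s) p - collision_rate (tau t) p).
  rewrite /solution_derivative; move: (collision_rate (tau s) p) (collision_rate (tau t) p) (a s) (a t).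
  by move=> *; ring.
apply: (le_trans (ler_normD _ _)); rewrite !normrM (ger0_norm a1) 2!mulrDl; apply: lerD.
  have h := le_trans (collision_rate_le p x0 xT) (ler_wpM2l lip0 (bgt_le_cgt b p)).
  apply: (le_trans (ler_pM (normr_ge0 _) (normr_ge0 _) (HL s t s0 t1) h)).
  by le_ring.
have h : `|collision_rate (tau s) p - collision_rate (tau t) p| <= D1 * (A * `|s - t|) * cgt b p.
  apply: (le_trans (collision_rate_lip p x0 xT y0 yT)); rewrite -/D1 ler_wpM2r//.
  by rewrite ler_wpM2l//; exact: tau_lip.
apply: (le_trans (ler_pM a1 (normr_ge0 _) a2 h)).
by le_ring.
Qed.

Lemma solution_C1 : C1_X solution solution_derivative.
Proof.
have [D D0 HD] := solution_derivative_lip.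
have mf := measurable_solution; have md := measurable_solution_derivative.
(* For each p the difference quotient equals the derivative at an intermediate time. That time
   depends on p, but the Lipschitz constant [D] does not, so the bound can be integrated in p. *)
have quot s t p : 0 <= s -> 0 <= t -> s != t ->
    `|(solution s p - solution t p) / (s - t) - solution_derivative t p| <= D * `|s - t| * cgt b p.
  move=> s0 t1 st.
  have [c [c1 c2 ->]] := mean_value_ge0 (fun x x0 => solution_derive p x0) s0 t1.
  have c0 : 0 <= c by apply: le_trans c1; rewrite le_min s0.
  rewrite mulfK ?subr_eq0//; apply: (le_trans (HD c t p c0 t1)).
  rewrite ler_wpM2r ?cgt_ge0// ler_wpM2l//.
  by move: c1 c2; have [h|h] := leP s t => c1 c2;
    [rewrite !ler0_norm ?subr_le0//|rewrite !ger0_norm ?subr_ge0// ?(ltW h)//]; lra.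
split.
- move=> t t1; have e0 : 0 <= 2 * eps by rewrite mulr_ge0// ltW.
  apply: (in_X_dominated b0 b1 (mf t) e0) => p; have [h1 h2] := solution_bounds p t1.
  rewrite ger0_norm//; apply: (le_trans h2); rewrite ler_wpM2l//.
  by apply: le_trans (bgt_le_cgt b p); exact: wgt_le_bgt.
- move=> t t1; have [a1 a2] := aA t1; have [x0 xT] := tau_itv t1.
  apply: (in_X_dominated b0 b1 (md t) (mulr_ge0 A0 lip0)) => p.
  have h := le_trans (collision_rate_le p x0 xT) (ler_wpM2l lip0 (bgt_le_cgt b p)).
  have -> : `|solution_derivative t p| = a t * `|collision_rate (tau t) p|.
    by rewrite /solution_derivative normrM (ger0_norm a1).
  by rewrite -(mulrA A); exact: ler_pM a1 (normr_ge0 _) a2 h.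
- move=> t t1.
  apply: (@squeeze_dist R _ _ t (D * X_const b)).
    by apply: cvg_trans (cvg_within _) _; exact: nbhs_dnbhs.
  rewrite near_withinE near_withinE; near=> s => st s0.
  have m : measurable_fun setT (fun p => (solution s p - solution t p) / (s - t) - solution_derivative t p).
    apply: measurable_funB; [apply: measurable_funM; [apply: measurable_funB|]|] => //.
  have := X_norm_dominated b0 b1 m (mulr_ge0 D0 (normr_ge0 (s - t))) (fun p => quot s t p s0 t1 st).
  by rewrite (mulrAC D).
- move=> t t1.
  apply: (@squeeze_dist R _ _ t (D * X_const b)); first exact: cvg_within.
  rewrite near_withinE; near=> s => s0.
  have m : measurable_fun setT (fun p => solution_derivative s p - solution_derivative t p).
    exact: measurable_funB.
  have := X_norm_dominated b0 b1 m (mulr_ge0 D0 (normr_ge0 (s - t))) (fun p => HD s t p s0 t1).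
  by rewrite (mulrAC D).
Unshelve. all: by end_near. Qed.

Lemma solution_boltzmann t : 0 <= t -> boltzmann_eq b cR t0 solution solution_derivative t.
Proof.
move=> t1; have [x0 xT] := tau_itv t1; apply: aeT => p.
have sp := small_profile_solution t1.
have [ig _] := small_gain_integrable HK p sp sp.
have [il _] := small_loss_integrable eps0 HK p sp.
have [ic ->] := collision_integralE ig il; split; first exact: ic.
have ef : solution t = F (tau t) by apply/funext => q; exact: (flowE q x0 xT).
rewrite -EFinM; congr EFin.
have -> : solution_derivative t p = a t *
    (gain b (solution t) (solution t) p - loss b (solution t) p * solution t p).
  by rewrite /solution_derivative /collision_rate /source /rate -ef.
by rewrite (mulrC (loss b _ p)).
Qed.

End existence.

(** * Uniqueness *)

Section dini.
Variable R : realType.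

(** After a small slope [c] is subtracted, the set of times up to [T] at which [psi] is at least
    [psi T] contains its infimum, by the right condition; a positive infimum would be pushed further
    left by the left condition. Hence psi T <= psi 0. *)
Lemma dini_le0 (phi : R -> R) : phi 0 <= 0 ->
  (forall t e : R, 0 < t -> 0 < e -> exists2 s, 0 <= s < t & phi t <= phi s + e * (t - s)) ->
  (forall t e : R, 0 <= t -> 0 < e -> exists2 delta : R, 0 < delta &
     forall s : R, t < s < t + delta -> phi s <= phi t + e) ->
  forall t : R, 0 <= t -> phi t <= 0.
Proof.
move=> phi0 left right T T0; apply/ler_addgt0Pr => e e0; rewrite add0r.
have T1 : 0 < T + 1 by rewrite ltr_wpDl.
(* T + 1 in place of T avoids a division by 0 and still gives c T <= e. *)
pose c := e / (T + 1); have c0 : 0 < c by rewrite divr_gt0.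
pose psi t := phi t - c * t.
pose S := [set s | 0 <= s <= T /\ psi T <= psi s].
have ST : S T by split; rewrite ?T0 ?lexx.
have hi : has_inf S by split; [exists T|exists 0 => s [/andP[]]].
have s0 : 0 <= inf S by apply: lb_le_inf; [exists T|move=> s [/andP[]]].
have sT : inf S <= T by apply: ge_inf => //; case: hi.
have Sinf : S (inf S).
  split; first by rewrite s0.
  apply/ler_addgt0Pr => eta eta0.
  have eta2 : 0 < eta / 2 by rewrite divr_gt0.
  have [delta d0 Hd] := right _ _ s0 eta2.
  have [s Ss] := inf_adherent d0 hi.
  have [_ hs] := Ss.
  have le : inf S <= s by apply: ge_inf => //; case: hi.
  rewrite -ltrBlDl => s1.
  have [e1|ne] := eqVneq s (inf S); first by rewrite -e1 (le_trans hs)// lerDl ltW.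
  have lt : inf S < s by rewrite lt_neqAle eq_sym ne.
  have := Hd s; rewrite lt -ltrBlDl s1 => /(_ isT) h.
  apply: (le_trans hs); rewrite /psi.
  have := ler_wpM2l (ltW c0) le; move: h; lra.
have e1 : inf S = 0.
  apply/eqP; rewrite eq_le s0 andbT leNgt; apply/negP => s1.
  have [s /andP[s2 s3] h] := left _ _ s1 c0.
  have : S s.
    split; first by rewrite s2 (le_trans (ltW s3)).
    by case: Sinf => _ /le_trans; apply; rewrite /psi; move: h; rewrite mulrBr; lra.
  by move=> /ge_inf h'; have := h' (proj2 hi); rewrite leNgt s3.
have [_] := Sinf; rewrite e1 /psi mulr0 subr0 => h.
have : phi T <= c * T by move: h; lra.
move=> /le_trans; apply; rewrite /c mulrAC ler_pdivrMr// ler_wpM2l ?(ltW e0)//.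
by rewrite lerDl.
Qed.

End dini.

Section L1_derivative.
Variable R : realType.
Implicit Types (g : R3 R -> R) (u v d : R -> R3 R -> R).

Definition L1_mass g : \bar R := (\int[leb3 R]_p (`|g p|)%:E)%E.

(** What uniqueness retains of [C1_X]: differentiability in the L^1 norm alone, as an explicit
    epsilon-delta condition. *)
Definition L1_derivative d dd : Prop :=
  forall t : R, 0 <= t -> [/\ measurable_fun setT (d t), measurable_fun setT (dd t),
    (L1_mass (d t) < +oo)%E, (L1_mass (dd t) < +oo)%E &
    forall e, 0 < e -> exists2 delta, 0 < delta & forall s, 0 <= s -> s != t -> `|s - t| < delta ->
      (L1_mass (fun p => (d s p - d t p) / (s - t) - dd t p)%R <= e%:E)%E].

Lemma L1_mass_ge0 g : (0 <= L1_mass g)%E.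
Proof. by apply: integral_ge0 => p _; rewrite lee_fin. Qed.

Let L1normE g : L1norm 0 g = L1_mass g.
Proof. by apply: eq_integral => p _; rewrite powRr0 mulr1. Qed.

Let X_norm_ge g : (L1_mass g <= X_norm g)%E.
Proof.
rewrite /X_norm L1normE leeDl//; apply: integral_ge0 => p _.
by rewrite lee_fin mulr_ge0// powR_ge0.
Qed.

Let measurable_absE g : measurable_fun setT g ->
  measurable_fun setT (fun p => (`|g p|)%:E).
Proof. by move=> mg; apply/measurable_EFinP; exact: measurable_normrT. Qed.

Lemma L1_mass_le g (h1 h2 : R3 R -> R) : measurable_fun setT g -> measurable_fun setT h1 ->
  measurable_fun setT h2 -> {ae leb3 R, forall p, `|g p| <= `|h1 p| + `|h2 p|} ->
  (L1_mass g <= L1_mass h1 + L1_mass h2)%E.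
Proof.
move=> mg m1 m2 le.
have -> : (L1_mass h1 + L1_mass h2 = \int[leb3 R]_p ((`|h1 p|)%:E + (`|h2 p|)%:E))%E.
  rewrite ge0_integralD//; try (by move=> p _; rewrite lee_fin); exact: measurable_absE.
apply: ae_ge0_le_integral; [exact: measurableT|by move=> p _; rewrite lee_fin| | | |].
- exact: measurable_absE.
- by move=> p _; rewrite -EFinD lee_fin addr_ge0.
- by apply: emeasurable_funD; exact: measurable_absE.
- by apply: ae_imp le => p h _; rewrite -EFinD lee_fin.
Qed.

Lemma L1_massB g1 g2 : measurable_fun setT g1 -> measurable_fun setT g2 ->
  (L1_mass (fun p => g1 p - g2 p)%R <= L1_mass g1 + L1_mass g2)%E.
Proof.
by move=> m1 m2; apply: L1_mass_le => //; [exact: measurable_funB|apply: aeT => p; exact: ler_normB].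
Qed.

Lemma C1_X_L1_derivative u du : C1_X u du -> L1_derivative u du.
Proof.
move=> [iu idu cu _] t t0; have [[mu Lu] _] := iu t t0; have [[mdu Ldu] _] := idu t t0.
split => //; [by rewrite -L1normE|by rewrite -L1normE|move=> e e0].
have e0' : (0%E < e%:E)%E by rewrite lte_fin.
have H : nbhs t (fun s => s != t -> 0 <= s ->
    (X_norm (fun p => (u s p - u t p) / (s - t) - du t p)%R < e%:E)%E).
  exact: (cu t t0 _ (open_ereal_lt' e0')).
move/nbhs_ballP : H => [delta d0 H]; exists delta => // s s0 st sd.
apply: (le_trans (X_norm_ge _)); apply: ltW; apply: H => //.
by rewrite /ball/= distrC.
Qed.

Lemma L1_derivativeB u v du dv : L1_derivative u du -> L1_derivative v dv ->
  L1_derivative (fun t p => u t p - v t p) (fun t p => du t p - dv t p).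
Proof.
move=> Hu Hv t t0; have [m1 m2 l1 l2 h1] := Hu t t0; have [m3 m4 l3 l4 h2] := Hv t t0.
split; [exact: measurable_funB|exact: measurable_funB| | |].
- by apply: (le_lt_trans (L1_massB m1 m3)); exact: lte_add_pinfty.
- by apply: (le_lt_trans (L1_massB m2 m4)); exact: lte_add_pinfty.
move=> e e0; have e2 : 0 < e / 2 by rewrite divr_gt0.
have [a a0 Ha] := h1 _ e2; have [b b0 Hb] := h2 _ e2.
exists (Num.min a b); first by rewrite lt_min a0.
move=> s s0 st; rewrite lt_min => /andP[sa sb].
have [ms1 _ _ _ _] := Hu s s0; have [ms3 _ _ _ _] := Hv s s0.
have mq (w dw : R -> R3 R -> R) : measurable_fun setT (w s) -> measurable_fun setT (w t) ->
    measurable_fun setT (dw t) -> measurable_fun setT (fun p => (w s p - w t p) / (s - t) - dw t p).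
  move=> x1 x2 x3; apply: measurable_funB => //; apply: measurable_funM; last exact: measurable_cst.
  exact: measurable_funB.
have -> : e = e / 2 + e / 2 by field.
rewrite EFinD; apply: le_trans (leeD (Ha s s0 st sa) (Hb s s0 st sb)).
apply: le_trans (L1_massB (mq u du ms1 m1 m2) (mq v dv ms3 m3 m4)).
by rewrite le_eqVlt; apply/orP; left; apply/eqP; congr L1_mass; apply/funext => p; ring.
Qed.

Lemma L1_massZ (c : R) g : measurable_fun setT g ->
  L1_mass (fun p => c * g p) = (`|c|%:E * L1_mass g)%E.
Proof.
move=> mg; rewrite /L1_mass -ge0_integralZl//; first by apply: eq_integral => p _; rewrite normrM EFinM.
exact: measurable_absE.
Qed.

(** [Ds] and [Dt] are the values at the times t - h and t, [e] is the derivative at t and [E] the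
    error of the difference quotient. The step goes backwards from t because the sign of [Dt]
    decides which one-sided bound on [e] is available. *)
Let comparison_step (Ds Dt E e m h a als alt : R) : 0 < h -> 0 <= m ->
  a * h <= alt - als -> Ds = Dt - h * (E + e) ->
  (0 <= Dt -> e <= a * m) -> (Dt <= 0 -> - e <= a * m) ->
  `|Num.max 0 (`|Dt| - alt * m)| <= `|Num.max 0 (`|Ds| - als * m)| + `|h * E|.
Proof.
move=> h0 m0 ah -> e1 e2.
have max_ge0 (x : R) : 0 <= Num.max 0 x by rewrite le_max lexx.
rewrite !(ger0_norm (max_ge0 _)) normrM (gtr0_norm h0) ge_max addr_ge0//=; last by rewrite mulr_ge0// ltW.
apply: (@le_trans _ _ (`|Dt - h * (E + e)| - als * m + h * `|E|)); last first.
  by rewrite lerD2r le_max lexx orbT.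
have am : a * m * h <= (alt - als) * m by rewrite mulrAC ler_wpM2r.
have E1 : h * E <= h * `|E| by rewrite ler_wpM2l ?(ltW h0)// ler_norm.
have E2 : h * (- E) <= h * `|E| by rewrite ler_wpM2l ?(ltW h0)// -normrN ler_norm.
have [D0|D0] := leP 0 Dt.
  have he : h * e <= h * (a * m) by rewrite ler_wpM2l ?(ltW h0)// e1.
  rewrite (ger0_norm D0); have := ler_norm (Dt - h * (E + e)); move: am E1 he; lra.
have he : h * - e <= h * (a * m) by rewrite ler_wpM2l ?(ltW h0)// e2// ltW.
rewrite (ltr0_norm D0); have := ler_norm (- (Dt - h * (E + e))); rewrite normrN; move: am E2 he; lra.
Qed.

(** The positive part of |d| - al m is dominated by |d|, so its mass is finite whatever the mass of
    m. Integrating [comparison_step] in p gives the left condition of [dini_le0], because the error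
    of the difference quotient is small in L^1; monotonicity of [al] and continuity of [d] in L^1
    give the right one. *)
Lemma L1_comparison d dd (m : R3 R -> R) (al a : R -> R) :
  L1_derivative d dd -> measurable_fun setT m -> (forall p, 0 <= m p) ->
  {ae leb3 R, forall p, d 0 p = 0} -> 0 <= al 0 ->
  (forall s t, 0 <= s -> s <= t -> al s <= al t) ->
  (forall s t, 0 <= s -> s <= t -> a t * (t - s) <= al t - al s) ->
  (forall t, 0 <= t -> {ae leb3 R, forall p,
    (0 <= d t p -> dd t p <= a t * m p) /\ (d t p <= 0 -> - dd t p <= a t * m p)}) ->
  forall t, 0 <= t -> {ae leb3 R, forall p, `|d t p| <= al t * m p}.
Proof.
move=> Hd mm m0 d0 al0 almono aal ineq.
pose ps t p := Num.max 0 (`|d t p| - al t * m p).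
have alge (t : R) : 0 <= t -> 0 <= al t by move=> t0; rewrite (le_trans al0)// almono.
have ps0 t p : 0 <= ps t p by rewrite le_max lexx.
have md (t : R) : 0 <= t -> measurable_fun setT (d t) by move=> /Hd[].
have mps (t : R) : 0 <= t -> measurable_fun setT (ps t).
  move=> t0; apply: measurable_maxr; first exact: measurable_cst.
  apply: measurable_funB; first by apply: measurable_normrT; exact: md.
  by apply: measurable_funM => //; exact: measurable_cst.
have Lps (t : R) : 0 <= t -> (L1_mass (ps t) < +oo)%E.
  move=> t0; have [_ _ l _ _] := Hd t t0; apply: le_lt_trans l.
  rewrite -[leRHS]adde0 -[X in (_ <= _ + X)%E](_ : L1_mass (fun=> 0) = 0%E); last first.
    by rewrite /L1_mass; under eq_integral do rewrite normr0; rewrite integral0.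
  apply: L1_mass_le; [exact: mps|exact: md|exact: measurable_cst|apply: aeT => p].
  rewrite normr0 addr0 (ger0_norm (ps0 t p)) ge_max normr_ge0/=.
  by rewrite gerBl mulr_ge0// alge.
have fps (t : R) : 0 <= t -> L1_mass (ps t) \is a fin_num.
  by move=> t0; rewrite ge0_fin_numE ?L1_mass_ge0// Lps.
pose err (t s : R) p := (d s p - d t p) / (s - t) - dd t p.
have merr (t s : R) : 0 <= t -> 0 <= s -> measurable_fun setT (err t s).
  move=> t0 s0; have [_ mdd _ _ _] := Hd t t0; apply: measurable_funB => //.
  apply: measurable_funM; last exact: measurable_cst.
  by apply: measurable_funB; exact: md.
have derr (t s : R) p : s != t -> d s p = d t p - (t - s) * (err t s p + dd t p).
  move=> st; rewrite /err subrK.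
  have st' : s - t != 0 by rewrite subr_eq0.
  by field.
suff main (t : R) : 0 <= t -> fine (L1_mass (ps t)) <= 0.
  move=> t t0.
  have Z : L1_mass (ps t) = 0%E.
    apply/eqP; rewrite eq_le L1_mass_ge0 andbT -(fineK (fps t t0)) lee_fin; exact: main.
  have : {ae leb3 R, forall p, (`|ps t p|)%:E = 0%E}.
    have pos p : (0 <= (`|ps t p|)%:E)%E by rewrite lee_fin.
    exact: (proj1 (ge0_integral_eq0_ae (leb3 R) (measurable_absE (mps t t0)) pos) Z).
  apply: ae_imp => p [/eqP]; rewrite normr_eq0 => /eqP e.
  have : `|d t p| - al t * m p <= ps t p by rewrite le_max lexx orbT.
  by rewrite e subr_le0.
move: t; apply: (@dini_le0 _ (fun t => fine (L1_mass (ps t)))).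
- rewrite -lee_fin (fineK (fps 0 (lexx 0))) le_eqVlt; apply/orP; left; apply/eqP.
  have pos p : (0 <= (`|ps 0 p|)%:E)%E by rewrite lee_fin.
  apply: (proj2 (ge0_integral_eq0_ae (leb3 R) (measurable_absE (mps 0 (lexx 0))) pos)).
  apply: ae_imp d0 => p e; rewrite /ps e normr0 sub0r max_l ?normr0//.
  by rewrite oppr_le0 mulr_ge0.
- move=> t e t0 e0; have t0' := ltW t0; have [_ _ _ _ /(_ e e0)[delta dl H]] := Hd t t0'.
  have dl2 : 0 < delta / 2 by rewrite divr_gt0.
  pose s := Num.max 0 (t - delta / 2).
  have s0 : 0 <= s by rewrite le_max lexx.
  have st : s < t by rewrite gt_max t0 gtrBl.
  exists s; first by rewrite s0.
  have ts : 0 < t - s by rewrite subr_gt0.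
  have sd : `|s - t| < delta.
    rewrite distrC gtr0_norm// ltrBlDr (@le_lt_trans _ _ (delta / 2 + s))//; last first.
      by rewrite ltrD2r ltr_pdivrMr// mulr_natr mulr2n ltrDl.
    by rewrite -lerBlDl le_max lexx orbT.
  rewrite -lee_fin EFinD (fineK (fps t t0')) (fineK (fps s s0)).
  apply: (@le_trans _ _ (L1_mass (ps s) + L1_mass (fun p => (t - s) * err t s p)%R)%E).
    apply: L1_mass_le; [exact: mps|exact: mps| |].
      by apply: measurable_funM; [exact: measurable_cst|exact: merr].
    apply: ae_imp (ineq t t0') => p [i1 i2].
    apply: (comparison_step ts (m0 p) _ (derr t s p _) i1 i2); last by rewrite lt_eqF.
    by apply: aal => //; exact: ltW.
  apply: leeD => //; rewrite L1_massZ; last exact: merr.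
  rewrite (gtr0_norm ts) [in leRHS]mulrC EFinM lee_wpmul2l ?lee_fin ?(ltW ts)//.
  by apply: H => //; rewrite lt_eqF.
- move=> t e t0 e0; have [_ mdd _ Ldd /(_ 1 ltr01)[delta dl H]] := Hd t t0.
  have fdd : L1_mass (dd t) \is a fin_num by rewrite ge0_fin_numE ?L1_mass_ge0.
  pose C := fine (L1_mass (dd t)); have C0 : 0 <= C by rewrite fine_ge0// L1_mass_ge0.
  have C1 : 0 < 1 + C by rewrite ltr_pwDl.
  exists (Num.min delta (e / (1 + C))); first by rewrite lt_min dl divr_gt0.
  move=> s /andP[ts]; rewrite -ltrBlDl lt_min => /andP[sd se].
  have s0 : 0 <= s by rewrite (le_trans t0)// ltW.
  have st0 : 0 < s - t by rewrite subr_gt0.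
  rewrite -lee_fin EFinD (fineK (fps t t0)) (fineK (fps s s0)).
  apply: (@le_trans _ _ (L1_mass (ps t) + L1_mass (fun p => d s p - d t p)%R)%E).
    apply: L1_mass_le; [exact: mps|exact: mps| |].
      by apply: measurable_funB; exact: md.
    apply: aeT => p; rewrite !(ger0_norm (ps0 _ _)) ge_max addr_ge0//=.
    apply: (@le_trans _ _ (`|d t p| - al t * m p + `|d s p - d t p|)); last first.
      by rewrite lerD2r le_max lexx orbT.
    have h1 : al t * m p <= al s * m p by rewrite ler_wpM2r// almono// ltW.
    have h2 := ler_normD (d t p) (d s p - d t p).
    by rewrite addrC subrK in h2; move: h1 h2; lra.
  apply: leeD => //.
  apply: (@le_trans _ _ (L1_mass (fun p => (s - t) * err t s p)%R + L1_mass (fun p => (s - t) * dd t p)%R)%E).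
    apply: L1_mass_le.
    - by apply: measurable_funB; exact: md.
    - by apply: measurable_funM; [exact: measurable_cst|exact: merr].
    - by apply: measurable_funM => //; exact: measurable_cst.
    apply: aeT => p; rewrite (derr t s p) ?gt_eqF// addrAC subrr sub0r -mulNr opprB mulrDr.
    exact: ler_normD.
  rewrite !L1_massZ//; last exact: merr.
  rewrite (gtr0_norm st0) -ge0_muleDr ?L1_mass_ge0// -(fineK fdd) -/C.
  apply: (@le_trans _ _ ((s - t)%:E * (1 + C)%:E)%E).
    rewrite lee_wpmul2l ?lee_fin ?(ltW st0)// EFinD leeD2r//.
    by apply: H => //; [rewrite gt_eqF|rewrite gtr0_norm].
  by rewrite -EFinM lee_fin ltW// -ltr_pdivlMr.
Qed.

End L1_derivative.

(** * Collision estimates for bounds that hold almost everywhere *)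

Section almost_everywhere_collisions.
Variable R : realType.
Variables (b K : R).
Hypotheses (b0 : 0 < b) (b1 : b < 1) (K0 : 0 < K).
Hypothesis HK : collision_bounded b K.

Lemma ae_sphere_norm3 : {ae sphere_measure R, forall w, norm3 w = 1}.
Proof.
exists [set w : R3 R | norm3 w != 1]; split.
- have m : measurable_fun setT (fun w : R3 R => norm3 w : measurableTypeR R).
    exact: (measurable_norm3 (@measurable_id _ _ setT)).
  have m1 : measurable [set (1 : measurableTypeR R)] by [].
  have := measurable_preimage m (measurableC m1); congr (measurable _).
  by apply/seteqP; split => w /= /eqP.
- rewrite /= /sphere_measure (_ : _ @^-1` _ = set0) ?setI0 ?integral_set0//.
  by apply/seteqP; split => // a /=; rewrite norm3_sphere_point eqxx.
- by move=> w /= /eqP.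
Qed.

(* The collision maps may send a set of positive measure to the origin, but
   only where the kernel vanishes. *)
Lemma ae_post_momenta (P : R3 R -> Prop) : {ae leb3 R, forall p, P p} ->
  {ae leb3 R, forall p, {ae colm R, forall z, kern b p z.1 = 0 \/
    (P (post_p p z.1 z.2) /\ P (post_q p z.1 z.2))}}.
Proof.
move=> [N [mN N0 PN]].
apply: filterS2 (post_p_nonsingular mN N0) (post_q_nonsingular mN N0) => p hp hq.
have hw : {ae colm R, forall z, norm3 z.2 = 1}.
  exact: (@ae_snd R _ _ _ _ (leb3 R) (sphere_measure R) (fun w => norm3 w = 1) ae_sphere_norm3).
apply: filterS3 hp hq hw => -[q w] /= hp hq w1.
have [k0|k0] := eqVneq (kern b p q) 0; [by left|right].
have [u u1 nu] := exists_axis (p + q).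
have [h _ _ _ _] := post_momenta_bounds w1 u1 nu.
have r0 : 0 < norm3 (post_p p q w) * norm3 (post_q p q w).
  apply: lt_le_trans h; rewrite divr_gt0// exprn_gt0// lt_neqAle rho_ge0 andbT eq_sym.
  by apply: contraNneq k0 => r; apply/eqP; apply: kern_eq0 => //; constructor 3.
have nz (x : R3 R) : norm3 x != 0 -> ~ (N `\ 0) x -> P x.
  move=> x0 nN; apply: contrapT => nP; apply: nN; split; first exact: PN.
  by move=> /= e; move: x0; rewrite e norm30 eqxx.
by split; apply: nz => //; apply: contraTneq r0 => ->; rewrite ?mul0r ?mulr0 ltxx.
Qed.

Variable E : R.
Hypothesis E0 : 0 <= E.

Definition ae_small (u : R3 R -> R) : Prop :=
  measurable_fun setT u /\ {ae leb3 R, forall p, 0 <= u p /\ u p <= E * wgt p}.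

Lemma ae_small_integrable u : ae_small u -> {ae leb3 R, forall p,
  (colm R).-integrable setT (EFin \o gain_fun b u u p) /\
  (colm R).-integrable setT (EFin \o loss_fun b u p)}.
Proof.
move=> [mu uW]; apply: ae_imp (ae_post_momenta uW) => p hp; split.
  apply: (proj1 (gain_dominated HK mu mu (sqr_ge0 E) _)).
  apply: ae_imp hp => z [k0|[[u1 u2] [u3 u4]]]; first by rewrite /gain_fun k0 !mul0r mulr0 normr0.
  rewrite /gain_fun ger0_norm; last by rewrite mulr_ge0 ?kern_ge0// mulr_ge0.
  rewrite [leRHS]mulrCA ler_wpM2l ?kern_ge0//.
  by rewrite expr2 mulrACA ler_pM.
apply: (proj1 (loss_dominated HK mu E0 _)).
have h := ae_fst (sphere_measure R) uW; apply: ae_imp h => z [u1 u2].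
rewrite /loss_fun ger0_norm; last by rewrite mulr_ge0 ?kern_ge0.
by rewrite [leRHS]mulrCA ler_wpM2l ?kern_ge0.
Qed.

(** Where v <= u, the term - (u - v) [loss b u] is nonpositive and is dropped; its size, of order
    |p|^(-b/2) [bgt b], could not be controlled by [bgt b]. The constant 3 collects 2 from the mixed
    gain terms and 1 from the difference of the losses. *)
Lemma collision_diff_le u v (N : R) : ae_small u -> ae_small v -> 0 <= N ->
  {ae leb3 R, forall p, `|u p - v p| <= N * bgt b p} ->
  {ae leb3 R, forall p, v p <= u p ->
    (gain b u u p - u p * loss b u p) - (gain b v v p - v p * loss b v p) <=
    3 * E * K * N * bgt b p}.
Proof.
move=> su sv N0 uv; have [mu uW] := su; have [mv vW] := sv.
have iu := ae_small_integrable su; have iv := ae_small_integrable sv.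
have W := ae_and (ae_and uW vW) uv.
apply: filterS3 (ae_post_momenta W) (ae_and iu iv) (ae_and uW vW) => p hp [[gu lu] [gv lv]] [[up1 up2] [vp1 vp2]] vu.
have gain_le : `|gain b u u p - gain b v v p| <= (E * N) * (2 * K * bgt b p).
  rewrite /gain -RintegralB//.
  apply: (proj2 (gain_diff_dominated HK _ _ _)); first by apply: measurable_funB; exact: measurable_gain_fun.
    exact: mulr_ge0.
  apply: ae_imp hp => z [k0|[[[[u1 u2] [v1 v2]] uv1] [[[u3 u4] [v3 v4]] uv2]]].
    by rewrite /gain_fun k0 !mul0r subrr normr0 addr0 mulr0.
  rewrite /gain_fun -!mulrBr -mulrDr mulrCA normrM (ger0_norm (kern_ge0 _ _ _)).
  rewrite ler_wpM2l ?kern_ge0//.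
  set x := post_p p z.1 z.2 in u1 u2 v1 v2 uv1 *; set y := post_q p z.1 z.2 in u3 u4 v3 v4 uv2 *.
  have -> : u x * u y - v x * v y = (u x - v x) * u y + v x * (u y - v y) by ring.
  apply: (le_trans (ler_normD _ _)); rewrite !normrM (ger0_norm u3) (ger0_norm v1) mulrDr.
  rewrite lerD//.
    apply: (le_trans (ler_pM (normr_ge0 _) u3 uv1 u4)).
    by le_ring.
  apply: (le_trans (ler_pM v1 (normr_ge0 _) v2 uv2)).
  by le_ring.
have loss_le : `|loss b u p - loss b v p| <= N * (K * norm3 p `^ (- (b / 2))).
  have e : (\int[colm R]_z (loss_fun b (fun q => u q - v q) p z))%R = loss b u p - loss b v p.
    rewrite /loss -RintegralB//; congr fine; apply: eq_integral => z _.
    by rewrite /loss_fun mulrBr.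
  rewrite -e; apply: (proj2 (loss_diff_dominated HK _ N0 _)); first exact: measurable_funB.
  have h := ae_fst (sphere_measure R) uv; apply: ae_imp h => z h.
  by rewrite /loss_fun normrM (ger0_norm (kern_ge0 _ _ _)) [leRHS]mulrCA ler_wpM2l ?kern_ge0.
(* The sign of [u] is known only almost everywhere, so the loss integral is first identified with
   the integral of the absolute value. *)
have l0 : 0 <= loss b u p.
  have m : measurable_fun setT (fun z => (loss_fun b u p z)%:E).
    by apply/measurable_EFinP; exact: measurable_loss_fun.
  have h := ae_fst (sphere_measure R) uW.
  have e : (\int[colm R]_z (loss_fun b u p z)%:E = \int[colm R]_z `|(loss_fun b u p z)%:E|)%E.
    apply: ae_eq_integral; [exact: measurableT|exact: m|exact: measurableT_comp|].
    apply: ae_imp h => z [u1 _] _; rewrite gee0_abs// lee_fin.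
    by apply: mulr_ge0 => //; exact: kern_ge0.
  by rewrite /loss /Rintegral e fine_ge0// integral_ge0.
have -> : gain b u u p - u p * loss b u p - (gain b v v p - v p * loss b v p) =
    (gain b u u p - gain b v v p) - (u p - v p) * loss b u p - v p * (loss b u p - loss b v p).
  by ring.
have -> : 3 * E * K * N * bgt b p = E * N * (2 * K * bgt b p) + E * K * N * bgt b p by ring.
have h1 : 0 <= (u p - v p) * loss b u p by rewrite mulr_ge0// subr_ge0.
have h2 : - (v p * (loss b u p - loss b v p)) <= E * K * N * bgt b p.
  apply: (le_trans (ler_norm _)); rewrite normrN normrM (ger0_norm vp1).
  apply: (le_trans (ler_pM vp1 (normr_ge0 _) vp2 loss_le)).
  have -> : E * wgt p * (N * (K * norm3 p `^ (- (b / 2)))) = E * K * N * (norm3 p `^ (- (b / 2)) * wgt p) by ring.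
  have c0 : 0 <= E * K * N by rewrite mulr_ge0// mulr_ge0// ltW.
  by apply: ler_wpM2l => //; exact: wgt_powR_le_bgt.
apply: lerD => //; rewrite lerBlDr; apply: (le_trans (ler_norm _)).
by apply: (le_trans gain_le); rewrite lerDl.
Qed.

End almost_everywhere_collisions.

Section uniqueness.
Variable R : realType.
Variables (b cR t0 K eps : R).
Hypotheses (b0 : 0 < b) (b1 : b < 1) (cR0 : 0 < cR) (t00 : 0 < t0).
Hypotheses (K0 : 0 < K) (eps0 : 0 < eps).
Hypothesis HK : collision_bounded b K.
Hypothesis small : 12 * K * eps * total_time b cR t0 <= 1.

Let E0 : 0 <= 2 * eps. Proof. by rewrite mulr_ge0// ltW. Qed.

Lemma boltzmann_eq_collision (f df : R -> R3 R -> R) t :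
  ae_small (2 * eps) (f t) -> boltzmann_eq b cR t0 f df t ->
  {ae leb3 R, forall p, df t p =
    rate_factor b cR t0 t * (gain b (f t) (f t) p - f t p * loss b (f t) p)}.
Proof.
move=> sf; rewrite /boltzmann_eq => eqf; have i := ae_small_integrable b0 b1 HK E0 sf.
apply: filterS2 i eqf => p [ig il] [_].
by have [_ ->] := collision_integralE ig il; rewrite -EFinM => -[].
Qed.

(** [L1_comparison] is applied with [conformal_time] as the height of the barrier and [rate_factor]
    as its speed. With E = 2 eps the coefficient is 6 eps K N, so over the total rescaled time the
    barrier rises to at most N / 2. *)
Lemma solutions_contract (f df g dg : R -> R3 R -> R) (N : R) :
  L1_derivative f df -> L1_derivative g dg ->
  (forall t, 0 <= t -> boltzmann_eq b cR t0 f df t) ->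
  (forall t, 0 <= t -> boltzmann_eq b cR t0 g dg t) ->
  (forall t, 0 <= t -> ae_small (2 * eps) (f t)) ->
  (forall t, 0 <= t -> ae_small (2 * eps) (g t)) ->
  {ae leb3 R, forall p, f 0 p - g 0 p = 0} -> 0 <= N ->
  (forall t, 0 <= t -> {ae leb3 R, forall p, `|f t p - g t p| <= N * bgt b p}) ->
  forall t, 0 <= t -> {ae leb3 R, forall p, `|f t p - g t p| <= N / 2 * bgt b p}.
Proof.
move=> Lf Lg bf bg sf sg fg0 N0 fgN t t1.
pose M p := 3 * (2 * eps) * K * N * bgt b p.
have c0 : 0 <= 3 * (2 * eps) * K * N.
  by apply: mulr_ge0 => //; apply: mulr_ge0; [exact: mulr_ge0|exact: ltW].
have M0 p : 0 <= M p by apply: mulr_ge0 => //; exact: bgt_ge0.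
have mM : measurable_fun setT M.
  by apply: measurable_funM; [exact: measurable_cst|exact: measurable_bgt].
(* By the mean value theorem, since [rate_factor] decreases and takes its smallest value at the
   later time. *)
have aal s u : 0 <= s -> s <= u ->
    rate_factor b cR t0 u * (u - s) <= conformal_time b cR t0 u - conformal_time b cR t0 s.
  move=> s0 su; have u0 := le_trans s0 su.
  have [c [c1 c2 ->]] := mean_value_ge0 (conformal_time_derive b1 cR0 t00) u0 s0.
  apply: ler_wpM2r; first by rewrite subr_ge0.
  apply: (rate_factor_anti b1 cR0 t00).
    by apply: le_trans c1; rewrite le_min u0.
  by apply: (le_trans c2); rewrite ge_max lexx.
have := L1_comparison (L1_derivativeB Lf Lg) mM M0 fg0 _ _ aal.
rewrite conformal_time0 => /(_ (lexx 0)) H.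
have mono s u : 0 <= s -> s <= u -> conformal_time b cR t0 s <= conformal_time b cR t0 u.
  move=> s0 su; rewrite -subr_ge0; apply: le_trans (aal s u s0 su).
  by apply: mulr_ge0; [exact: rate_factor_ge0|rewrite subr_ge0].
have {}H := H mono.
have ineq (u : R) : 0 <= u -> {ae leb3 R, forall p,
    (0 <= f u p - g u p -> df u p - dg u p <= rate_factor b cR t0 u * M p) /\
    (f u p - g u p <= 0 -> - (df u p - dg u p) <= rate_factor b cR t0 u * M p)}.
  move=> u0; have Ef := boltzmann_eq_collision (sf u u0) (bf u u0).
  have Eg := boltzmann_eq_collision (sg u u0) (bg u u0).
  have gfN : {ae leb3 R, forall p, `|g u p - f u p| <= N * bgt b p}.
    by apply: ae_imp (fgN u u0) => p; rewrite distrC.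
  have D1 := collision_diff_le b0 b1 K0 HK E0 (sf u u0) (sg u u0) N0 (fgN u u0).
  have D2 := collision_diff_le b0 b1 K0 HK E0 (sg u u0) (sf u u0) N0 gfN.
  have a0 : 0 <= rate_factor b cR t0 u := rate_factor_ge0 _ _ _ _.
  apply: filterS2 (ae_and Ef Eg) (ae_and D1 D2) => p [-> ->] [d1 d2]; split => h.
    by rewrite -mulrBr; apply: ler_wpM2l => //; apply: d1; rewrite -subr_ge0.
  by rewrite opprB -mulrBr; apply: ler_wpM2l => //; apply: d2; rewrite -subr_le0.
apply: ae_imp (H ineq t t1) => p /le_trans; apply.
have /andP[tau0 tauT] := conformal_time_itv b1 cR0 t00 t1.
apply: (le_trans (ler_wpM2r (M0 p) tauT)).
have -> : total_time b cR t0 * M p = 12 * K * eps * total_time b cR t0 * (N / 2 * bgt b p).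
  by rewrite /M; move: (total_time b cR t0) (bgt b p) => *; field.
by rewrite ler_piMl//; apply: mulr_ge0; [exact: divr_ge0|exact: bgt_ge0].
Qed.

Lemma solutions_eq (f df g dg : R -> R3 R -> R) :
  L1_derivative f df -> L1_derivative g dg ->
  (forall t, 0 <= t -> boltzmann_eq b cR t0 f df t) ->
  (forall t, 0 <= t -> boltzmann_eq b cR t0 g dg t) ->
  (forall t, 0 <= t -> ae_small (2 * eps) (f t)) ->
  (forall t, 0 <= t -> ae_small (2 * eps) (g t)) ->
  {ae leb3 R, forall p, f 0 p - g 0 p = 0} ->
  forall t, 0 <= t -> {ae leb3 R, forall p, g t p = f t p}.
Proof.
move=> Lf Lg bf bg sf sg fg0 t t1.
have step n (s : R) : 0 <= s -> {ae leb3 R, forall p, `|f s p - g s p| <= 2 * eps * 2^-1 ^+ n * bgt b p}.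
  elim: n s => [|n IH] s s0.
    have [_ h1] := sf s s0; have [_ h2] := sg s s0.
    apply: filterS2 h1 h2 => p [f1 f2] [g1 g2]; rewrite expr0 mulr1.
    apply: (@le_trans _ _ (2 * eps * wgt p)); last by rewrite ler_wpM2l// wgt_le_bgt.
    by rewrite ler_norml; apply/andP; split; lra.
  rewrite exprSr mulrA.
  apply: (solutions_contract Lf Lg bf bg sf sg fg0) => //.
  by rewrite mulr_ge0// exprn_ge0// invr_ge0.
apply: ae_imp (ae_nat (fun n => step n t t1)) => p h.
apply/esym/eqP; rewrite -subr_eq0 -normr_eq0; apply/eqP/le_anti; rewrite normr_ge0 andbT.
apply: (@le_geometric _ _ _ (2 * eps * bgt b p)); first by apply: mulr_ge0 => //; exact: bgt_ge0.
by move=> n; rewrite add0r mulrAC.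
Qed.

End uniqueness.

(** * The weighted sup norm and the conclusion *)

Section weighted_sup_norm.
Variable R : realType.
Implicit Types (g : R3 R -> R) (p : R3 R).

Lemma Linfw_normP g (E : R) : (Linfw_norm g <= E%:E)%E <->
  {ae leb3 R, forall p, `|norm3 p * expR (norm3 p) * g p| <= E}.
Proof.
rewrite /Linfw_norm unlock.
(* The norm of exponent infinity is the essential supremum only when the whole space has positive
   measure. *)
have -> : (0%E < leb3 R [set: R3 R])%E by rewrite leb3_setT.
by split => [/ess_sup_inf.ess_supP|H]; [apply: ae_imp => p /=; rewrite lee_fin|apply/ess_sup_inf.ess_supP; apply: ae_imp H => p /=; rewrite lee_fin].
Qed.

Lemma weight_le_wgt p (x E : R) : p != 0 ->
  `|norm3 p * expR (norm3 p) * x| <= E -> `|x| <= E * wgt p.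
Proof.
move=> p0; have n0 := norm3_gt0 p0.
have w0 : 0 < norm3 p * expR (norm3 p) by rewrite mulr_gt0 ?expR_gt0.
rewrite normrM (gtr0_norm w0) -ler_pdivlMl// mulrC.
by rewrite /wgt /powR_exp3 powR_inv1 ?norm3_ge0// mulN1r expRN invfM.
Qed.

Lemma weight_wgt_le p (x E : R) : 0 <= E -> `|x| <= E * wgt p ->
  `|norm3 p * expR (norm3 p) * x| <= E.
Proof.
move=> E0 h; have [n0|n0] := eqVneq (norm3 p) 0; first by rewrite n0 !mul0r normr0.
have w0 : 0 <= norm3 p * expR (norm3 p) by rewrite mulr_ge0 ?norm3_ge0 ?expR_ge0.
rewrite normrM (ger0_norm w0); apply: (le_trans (ler_wpM2l w0 h)).
rewrite /wgt /powR_exp3 powR_inv1 ?norm3_ge0// mulN1r expRN.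
by rewrite le_eqVlt; apply/orP; left; apply/eqP; field; rewrite n0 gt_eqF// expR_gt0.
Qed.

End weighted_sup_norm.

Theorem theorem1 (R : realType) (b cR t0 : R) (hb0 : 0 < b) (hb1 : b < 1)
    (hcR : 0 < cR) (ht0 : 0 < t0) :
  exists eps C : R, [/\ 0 < eps, 0 < C &
    forall f0 : R3 R -> R,
      {ae leb3 R, forall p, 0 <= f0 p} ->
      in_L1 (-2) f0 -> in_Linfw f0 ->
      (Linfw_norm f0 < eps%:E)%E ->
      exists f : R -> R3 R -> R,
        [/\ is_solution b cR t0 f0 f, nonneg_on f,
            (sup_Linfw_norm f <= (C * eps)%:E)%E &
            forall g : R -> R3 R -> R,
              is_solution b cR t0 f0 g -> nonneg_on g ->
              (sup_Linfw_norm g <= (C * eps)%:E)%E ->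
              forall t, 0 <= t -> {ae leb3 R, forall p, g t p = f t p}]].
Proof.
have [K K0 HK] := @collision_bounds R b hb0 hb1.
have T0 := total_time_gt0 hb1 hcR ht0.
have KT : 0 < 12 * K * total_time b cR t0 by apply: mulr_gt0 => //; exact: mulr_gt0.
(* The largest value allowed by the smallness condition, which then holds with equality. *)
pose eps : R := (12 * K * total_time b cR t0)^-1.
have eps0 : 0 < eps by rewrite invr_gt0.
have E0 : 0 <= 2 * eps by rewrite mulr_ge0// ltW.
have small : 12 * K * eps * total_time b cR t0 <= 1.
  by rewrite mulrAC /eps mulfV// gt_eqF.
exists eps, 2; split => // f0 f00 [mf0 _] _ f0eps.
(* The datum satisfies its bounds only almost everywhere, whereas the construction works at every p;
   truncation gives a representative that satisfies them everywhere. *)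
pose f1 p := Num.min (Num.max (f0 p) 0) (eps * wgt p).
have W0 (p : R3 R) : 0 <= eps * wgt p by rewrite mulr_ge0 ?wgt_ge0// ltW.
have mf1 : measurable_fun setT f1.
  apply: measurable_minr; first by apply: measurable_maxr => //; exact: measurable_cst.
  by apply: measurable_funM; [exact: measurable_cst|exact: measurable_wgt].
have f1W p : 0 <= f1 p /\ f1 p <= eps * wgt p.
  by rewrite le_min ge_min lexx orbT le_max lexx orbT W0.
have f1E : {ae leb3 R, forall p, f1 p = f0 p}.
  have /Linfw_normP h := ltW f0eps.
  apply: ae_imp (ae_and (ae_and (leb3_ae_neq0 R) f00) h) => p [[p0 p1] {}h].
  have := weight_le_wgt p0 h; rewrite ger0_norm// => h2.
  by rewrite /f1 (max_l p1) min_l.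
have [F [cF FP]] := picard_fixpoint hb0 hb1 K0 eps0 T0 HK small mf1 f1W.
pose f := solution b cR t0 f1 F; pose df := solution_derivative b cR t0 f1 F.
have fB t p : 0 <= t -> 0 <= f t p /\ f t p <= 2 * eps * wgt p.
  by move=> t1; apply: (solution_bounds hb1 hcR ht0 K0 eps0 HK small f1W cF).
have fC : C1_X f df by apply: (solution_C1 hb0 hb1 hcR ht0 K0 eps0 HK small mf1 f1W cF FP).
have fB' t : 0 <= t -> boltzmann_eq b cR t0 f df t.
  by move=> t1; apply: (solution_boltzmann hb1 hcR ht0 K0 eps0 HK small mf1 f1W cF FP).
have f0E p : f 0 p = f1 p by rewrite /f /solution conformal_time0; exact: linear_sol0.
have sf t : 0 <= t -> ae_small (2 * eps) (f t).
  move=> t1; split; last by apply: aeT => p; exact: fB.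
  by have [/(_ t t1)[[]]] := fC.
exists f; split.
- split; first by apply: ae_imp f1E => p; rewrite f0E.
  by exists df.
- by move=> t t1; apply: aeT => p; exact: (fB t p t1).1.
- apply: ge_ereal_sup => x [t /=]; rewrite in_itv/= andbT => t1 <-.
  apply/Linfw_normP; apply: aeT => p; have [h1 h2] := fB t p t1.
  by apply: weight_wgt_le => //; rewrite ger0_norm.
- move=> g [g0 [dg [gC gB]]] gpos gsup t t1.
  (* C = 2 places every competitor in the class bounded by 2 eps [wgt], the one for which the
     contraction was set up. *)
  have sg s : 0 <= s -> ae_small (2 * eps) (g s).
    move=> s0; split; first by have [/(_ s s0)[[]]] := gC.
    have : (Linfw_norm (g s) <= (2 * eps)%:E)%E.
      apply: le_trans gsup; apply: ereal_sup_ubound; exists s => //.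
      by rewrite /= in_itv/= s0.
    move=> /Linfw_normP h; apply: ae_imp (ae_and (ae_and (leb3_ae_neq0 R) (gpos s s0)) h) => p [[p0 p1] {}h].
    by split => //; have := weight_le_wgt p0 h; rewrite ger0_norm.
  have fg0 : {ae leb3 R, forall p, f 0 p - g 0 p = 0}.
    by apply: filterS2 f1E g0 => p e1 e2; rewrite f0E e1 e2 subrr.
  exact: (solutions_eq hb0 hb1 hcR ht0 K0 eps0 HK small (C1_X_L1_derivative fC)
    (C1_X_L1_derivative gC) fB' gB sf sg fg0 t1).
Qed.
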